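(* Let $G$ be a group, $G_1 \subseteq G$ a subgroup of index two, $r \in G\setminus G_1$ and $\tau(g) := rgr^{-1}$ for $g \in G_1$. (a) For two antiunitary representations $(U^j,\mathcal H_j)$, $j=1,2$, of $(G,G_1)$ we have $U^1 \cong U^2$ if and only if $U^1|_{G_1} \cong U^2|_{G_1}$. (b) For any antiunitary representation $(U,\mathcal H)$ of $(G,G_1)$, the von Neumann algebra $U_{G_1}'$ is the complexification of the real algebra $U_G'$. (c) An antiunitary representation $(U,\mathcal H)$ of $(G,G_1)$ is irreducible if and only if its commutant $U_G'$ is isomorphic to $\mathbb R$, $\mathbb C$ or $\mathbb H$. More specifically: (i) If $U_G' \cong \mathbb R$, then $U_{G_1}' \cong \mathbb C$ and $U|_{G_1}$ is irreducible. (ii) If $U_G' \cong \mathbb C$, then $U_{G_1}' \cong \mathbb C^2$ and $U|_{G_1}$ is a direct sum of two inequivalent irreducible representations which do not extend to an antiunitary representation of $G$. (iii) If $U_G' \cong \mathbb H$, then $U_{G_1}' \cong M_2(\mathbb C)$ and $U|_{G_1}$ is a direct sum of two equivalent irreducible representations which do not extend to an antiunitary representation of $G$. (d) For an irreducible unitary representation $(U,\mathcal H)$ of $G_1$, one of the following holds: (i) $U$ extends to an antiunitary representation $\overline U$ of $G$, and then $\overline U$ is irreducible with $\overline U_G' \cong \mathbb R$; or (ii) $U$ does not extend to an antiunitary representation of $G$. Then $V := U \oplus U^*\circ\tau$ extends to an irreducible antiunitary representation of $G$ (also denoted $V$), and $V_G' \cong \mathbb C$ if $U^*\circ\tau \not\cong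 U$, whereas $V_G' \cong \mathbb H$ if $U^*\circ\tau \cong U$.
   Context: Hilbert spaces are complex. $\mathrm{AU}(\mathcal H)$ is the group of all unitary and antiunitary (antilinear surjective isometric) operators on $\mathcal H$, and $\mathrm U(\mathcal H)$ is the unitary group. An antiunitary representation of a group pair $(G,G_1)$ ($G_1\subseteq G$ of index $2$), also called an antiunitary representation of $G$, is a homomorphism $U: G\to \mathrm{AU}(\mathcal H)$ with $U^{-1}(\mathrm U(\mathcal H)) = G_1$, i.e. $G_1$ acts by unitary operators and $G\setminus G_1$ by antiunitary operators. An extension of a unitary representation of $G_1$ to $G$ is on the same Hilbert space. Equivalence $\cong$ of representations means existence of a unitary (complex linear) intertwining operator; irreducible means nonzero without nontrivial proper closed complex invariant subspaces. The commutant $U_G' = \{A\in B(\mathcal H): AU_g = U_gA \ \forall g\in G\}$ consists of bounded complex linear operators; it is a real (in general not complex) algebra; $U_{G_1}'$ is defined analogously with $G_1$. Isomorphisms of $U_G'$ are isomorphisms of real algebras, those of $U_{G_1}'$ of complex algebras; $\mathbb H$ denotes the quaternions. $U^*$ denotes the dual representation of $G_1$ on the dual space $\mathcal H^*$, $U_g^*\lambda = \lambda\circ U_g^{-1}$, and $(U^*\circ\tau)_g = U^*_{\tau(g)}$. *)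

(* Defs.v *)
From HB Require Import structures.
From mathcomp Require Import all_boot all_order all_algebra sesquilinear.
From mathcomp Require Import complex ring.
From mathcomp Require Import all_classical all_reals all_analysis.

Set Implicit Arguments.
Unset Strict Implicit.
Unset Printing Implicit Defensive.

Import Order.TTheory GRing.Theory Num.Theory.
Import numFieldNormedType.Exports.

Local Open Scope classical_set_scope.
Local Open Scope ring_scope.
Local Open Scope complex_scope.

Section DotLmodule.
Variables (C : numClosedFieldType) (U : lmodType C) (f : {dot U for @Num.conj C}).

Lemma dot_proj x y (t := f x y / f y y) : y != 0 ->
  f (x - t *: y) (x - t *: y) = f x x - `|f x y| ^+ 2 / f y y.
Proof.
rewrite -(dnorm_gt0 f) => yy0; rewrite dnormB dnormZ linearZr_LR /=.
set q := `|f x y| ^+ 2 / f y y.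
have -> : `|t| ^+ 2 * f y y = q.
  rewrite normrM exprMn normfV (ger0_norm (ltW yy0)) exprVn [f y y ^+ 2]expr2.
  by rewrite invfM !mulrA mulfVK ?gt_eqF.
have -> : Num.conj t * f x y = q.
  rewrite rmorphM fmorphV /= (CrealP (ger0_real (ltW yy0))) /q normCK.
  by rewrite mulrAC [_^* * _]mulrC.
have -> : Num.conj q = q.
  by apply/CrealP/ger0_real/divr_ge0; [exact: exprn_ge0|exact: ltW].
by rewrite opprD addrA addrAC addrK.
Qed.

Lemma dot_CauchySchwarz x y : `|f x y| ^+ 2 <= f x x * f y y.
Proof.
have [->|y0] := eqVneq y 0.
  rewrite linear0r normr0 expr0n /=.
  exact: mulr_ge0 (dnorm_ge0 _ _) (dnorm_ge0 _ _).
have := dnorm_ge0 f (x - (f x y / f y y) *: y).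
by rewrite dot_proj// subr_ge0 ler_pdivrMr// dnorm_gt0.
Qed.

Lemma dot_triangle x y : sqrtC (f (x + y) (x + y)) <= sqrtC (f x x) + sqrtC (f y y).
Proof.
have fxy : `|f x y| <= sqrtC (f x x) * sqrtC (f y y).
  rewrite -(@ler_pXn2r _ 2) ?nnegrE ?mulr_ge0 ?sqrtC_ge0 ?dnorm_ge0//.
  by rewrite exprMn !sqrtCK dot_CauchySchwarz.
rewrite -(@ler_pXn2r _ 2) ?nnegrE ?addr_ge0 ?sqrtC_ge0 ?dnorm_ge0//.
rewrite sqrrD !sqrtCK dnormD [leRHS]addrAC lerD2l mulr2n.
apply: le_trans (lerD fxy fxy).
have h (z : C) : z + Num.conj z = 2 * 'Re z.
  by rewrite ReE mulrC divfK ?pnatr_eq0.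
rewrite h -mulr2n -[leRHS]mulr_natl ler_pM2l ?ltr0n//.
exact: le_trans (real_ler_norm (Creal_Re _)) (leif_normC_Re_Creal _).
Qed.

End DotLmodule.

(* [inner] is linear in its first argument and conjugate-linear in the second. *)
HB.mixin Record CompleteNormedModule_isHilbert (R : realType) H
    of CompleteNormedModule R[i] H := {
  inner : {dot H for @Num.conj R[i]};
  inner_norm : forall x : H, inner x x = `|x| ^+ 2
}.

#[short(type="hilbertType")]
HB.structure Definition Hilbert (R : realType) :=
  {H of CompleteNormedModule R[i] H & CompleteNormedModule_isHilbert R H}.

(* The last field is completeness for the norm x |-> sqrt (inner x x), phrased
   with squared distances. *)
HB.factory Record Lmodule_isHilbert (R : realType) H of GRing.Lmodule R[i] H := {
  inner : H -> H -> R[i];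
  innerP : forall (a : R[i]) x y z,
    inner (a *: x + y) z = a * inner x z + inner y z;
  innerC : forall x y, inner x y = Num.conj (inner y x);
  inner_gt0 : forall x, x != 0 -> 0 < inner x x;
  inner_complete : forall F : set_system H, ProperFilter F ->
    (forall e : R[i], 0 < e ->
       exists x, F [set y | inner (x - y) (x - y) < e]) ->
    exists l, forall e : R[i], 0 < e -> F [set y | inner (l - y) (l - y) < e]
}.

HB.builders Context R H of Lmodule_isHilbert R H.

Let innerZD_r a x y z :
  inner z (a *: x + y) = Num.conj a * inner z x + inner z y.
Proof.
rewrite innerC innerP rmorphD rmorphM.
by congr (_ * _ + _); rewrite [RHS]innerC.
Qed.

Let inner_bilinear : bilinear_for *%R (Num.conj \; *%R) inner.
Proof.
split; first by move=> z a x y; rewrite innerP.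
by move=> z a x y; rewrite /= innerZD_r.
Qed.

Let inner_herm x y : inner x y = (-1) ^+ false * Num.conj (inner y x).
Proof. by rewrite expr0 mul1r -innerC. Qed.

HB.instance Definition _ :=
  bilinear_isBilinear.Build R[i] H H R[i] *%R (Num.conj \; *%R) inner inner_bilinear.
HB.instance Definition _ :=
  isHermitianSesquilinear.Build R[i] H false Num.conj inner inner_herm.
HB.instance Definition _ := isDotProduct.Build R[i] H inner inner_gt0.

Let dot : {dot H for @Num.conj R[i]} := inner.


Let nrm x := sqrtC (inner x x).

Let inner_ge0 x : 0 <= inner x x. Proof. exact: (dnorm_ge0 dot x). Qed.

Let nrmZ (a : R[i]) x : nrm (a *: x) = `|a| * nrm x.
Proof.
rewrite /nrm -[inner _ _]/(dot _ _) dnormZ sqrtCM ?nnegrE ?exprn_ge0//.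
by rewrite sqrCK.
Qed.

Let nrm0_eq0 x : nrm x = 0 -> x = 0.
Proof.
by move=> /eqP; rewrite sqrtC_eq0 -[inner _ _]/(dot _ _) dnorm_eq0 => /eqP.
Qed.

Let nrmD x y : nrm (x + y) <= nrm x + nrm y.
Proof. exact: (dot_triangle dot x y). Qed.

HB.instance Definition _ := @Lmodule_isNormed.Build R[i] H nrm nrmD nrmZ nrm0_eq0.

Let normE (x : H) : `|x| = nrm x. Proof. by []. Qed.

Let ball_inner (x : H) (e : R[i]) : 0 < e ->
  [set y | inner (x - y) (x - y) < e ^+ 2] = ball x e.
Proof.
move=> e0; apply/funext => y /=; rewrite -ball_normE /= normE /nrm; congr is_true.
rewrite -[in RHS](@ltr_pXn2r _ 2) ?nnegrE ?sqrtC_ge0 ?inner_ge0 ?ltW//.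
by rewrite sqrtCK.
Qed.

Let complete (F : set_system H) : ProperFilter F -> cauchy F -> cvg F.
Proof.
move=> PF /cauchyP cF.
have [e e0|l Fl] := inner_complete PF.
  have [|x Fx] := cF (sqrtC e); first by rewrite sqrtC_gt0.
  by exists x; rewrite -(sqrtCK e) ball_inner// sqrtC_gt0.
apply/cvg_ex; exists l => A /nbhs_ballP[e /= e0 lA].
apply: filterS lA _; rewrite -ball_inner//.
by apply: Fl; exact: exprn_gt0.
Qed.

HB.instance Definition _ := Uniform_isComplete.Build H complete.

Let inner_norm (x : H) : dot x x = `|x| ^+ 2.
Proof. by rewrite normE /nrm sqrtCK. Qed.

HB.instance Definition _ := CompleteNormedModule_isHilbert.Build R H inner_norm.

HB.end.

Section HilbertTheory.
Context {R : realType} {H : hilbertType R}.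

Lemma ball_inner (x : H) (e : R[i]) : 0 < e ->
  [set y | inner (x - y) (x - y) < e ^+ 2] = ball x e.
Proof.
move=> e0; apply/funext => y /=; rewrite -ball_normE /= inner_norm; congr is_true.
by rewrite ltr_pXn2r ?nnegrE// ltW.
Qed.

Lemma hilbert_complete (F : set_system H) : ProperFilter F ->
  (forall e : R[i], 0 < e ->
     exists x, F [set y | inner (x - y) (x - y) < e]) ->
  exists l, forall e : R[i], 0 < e -> F [set y | inner (l - y) (l - y) < e].
Proof.
move=> PF Fc; have /cauchy_cvg/cvg_ex[l Fl] : cauchy F.
  apply/cauchyP => e e0; have [|x Fx] := Fc (e ^+ 2); first exact: exprn_gt0.
  by exists x; rewrite -ball_inner.
exists l => e e0; rewrite -(sqrtCK e) ball_inner ?sqrtC_gt0//.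
by apply: Fl; apply: nbhsx_ballx; rewrite sqrtC_gt0.
Qed.

End HilbertTheory.

(* An alias of the product, so that it carries the Hilbert norm instead of the
   library's max norm on pairs. *)
Definition hsum (R : realType) (H K : hilbertType R) : Type := (H * K)%type.

Section HilbertSum.
Context {R : realType} {H K : hilbertType R}.

HB.instance Definition _ := GRing.Lmodule.copy (hsum H K) (H * K)%type.

Let sum_inner (x y : hsum H K) : R[i] := inner x.1 y.1 + inner x.2 y.2.

Let sum_innerP (a : R[i]) (x y z : hsum H K) :
  sum_inner (a *: x + y) z = a * sum_inner x z + sum_inner y z.
Proof.
by rewrite /sum_inner/= !linearDl !linearZl_LR /= mulrDr addrACA.
Qed.

Let sum_innerC (x y : hsum H K) : sum_inner x y = Num.conj (sum_inner y x).
Proof.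
rewrite /sum_inner rmorphD; congr (_ + _); rewrite [LHS]hermC mul1r//.
Qed.

Let sum_inner_gt0 (x : hsum H K) : x != 0 -> 0 < sum_inner x x.
Proof.
case: x => x y xy0; rewrite /sum_inner /=.
have [x0|x0] := eqVneq x 0.
  apply: ltr_wpDl; first exact: dnorm_ge0.
  by rewrite dnorm_gt0; apply: contraNneq xy0 => ->; rewrite x0.
by apply: ltr_pwDl; [rewrite dnorm_gt0|exact: dnorm_ge0].
Qed.

Let le_addl (a b : R[i]) : 0 <= b -> a <= a + b.
Proof. by rewrite lerDl. Qed.

Let le_addr (a b : R[i]) : 0 <= b -> a <= b + a.
Proof. by rewrite lerDr. Qed.

Let sum_inner_complete (F : set_system (hsum H K)) : ProperFilter F ->
  (forall e : R[i], 0 < e ->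
     exists x, F [set y | sum_inner (x - y) (x - y) < e]) ->
  exists l, forall e : R[i], 0 < e ->
    F [set y | sum_inner (l - y) (l - y) < e].
Proof.
move=> PF Fc.
have [|h Fh] := @hilbert_complete R H (fmap (fst : hsum H K -> H) F) _.
  move=> e /Fc[x Fx]; exists x.1; apply: (@filterS _ F _ _ _ _ Fx) => y /=.
  by apply: le_lt_trans; apply: le_addl; exact: dnorm_ge0.
have [|k Fk] := @hilbert_complete R K (fmap (snd : hsum H K -> K) F) _.
  move=> e /Fc[x Fx]; exists x.2; apply: (@filterS _ F _ _ _ _ Fx) => y /=.
  by apply: le_lt_trans; apply: le_addr; exact: dnorm_ge0.
exists (h, k) => e e0.
have e20 : 0 < e / 2 by apply: divr_gt0 => //; rewrite ltr0n.
have he : F [set y | inner (h - y.1) (h - y.1) < e / 2] := Fh _ e20.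
have ke : F [set y | inner (k - y.2) (k - y.2) < e / 2] := Fk _ e20.
apply: filterS (filterI he ke) => y [/= hy ky].
by rewrite [ltRHS]splitr; exact: ltrD hy ky.
Qed.

HB.instance Definition _ := @Lmodule_isHilbert.Build R (hsum H K)
  sum_inner sum_innerP sum_innerC sum_inner_gt0 sum_inner_complete.

Lemma hsum_innerE (x y : hsum H K) : inner x y = inner x.1 y.1 + inner x.2 y.2.
Proof. by []. Qed.

End HilbertSum.
Definition bounded_linear (R : realType) (V W : normedModType R[i]) (A : V -> W) :=
  linear A /\ exists M : R[i], forall x, `|A x| <= M * `|x|.

Section Riesz.
Context {R : realType} {H : hilbertType R}.

Let near_orth (d : R[i]) (lam : H -> R[i]^o) (y z : H) (e : R[i]) :
  linear lam -> (forall x, lam x = 1 -> d <= inner x x) ->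
  lam y = 1 -> lam z = 0 -> inner y y < d + e ^+ 2 -> 0 <= e ->
  `|inner y z| <= e * `|z|.
Proof.
move=> lamL dP y1 z0 ye e0.
have [->|zn0] := eqVneq z 0; first by rewrite linear0r !normr0 mulr0.
have zz0 : 0 < inner z z by rewrite dnorm_gt0.
pose t := inner y z / inner z z.
have : d <= inner (y - t *: z) (y - t *: z).
  apply: dP; rewrite addrC -scaleNr lamL y1 z0 scaler0 add0r//.
rewrite dot_proj// lerBrDr -lerBrDl => dle.
have : `|inner y z| ^+ 2 / inner z z <= e ^+ 2.
  by apply: le_trans dle _; rewrite lerBlDl ltW.
rewrite ler_pdivrMr// inner_norm -exprMn.
by rewrite ler_pXn2r// nnegrE mulr_ge0.
Qed.

Let small (a K : R[i]) : 0 <= a -> 0 < K ->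
  (forall e : R[i], 0 < e -> a <= K * e) -> a = 0.
Proof.
move=> a0 K0 aK; apply/eqP; apply: contraT => an0.
have {an0}a0 : 0 < a by rewrite lt_def an0.
have h2 : 0 < (2 : R[i]) by rewrite ltr0n.
have := aK (a / 2 / K) (divr_gt0 (divr_gt0 a0 h2) K0).
rewrite mulrC mulfVK ?gt_eqF// => /le_gtF.
by rewrite ltr_pdivrMr// ltr_pMr// ltr1n.
Qed.

Let min_seq (lam : H -> R[i]^o) x0 : lam x0 = 1 ->
  exists2 d : R[i], 
   (forall x, lam x = 1 -> d <= inner x x) &
   (forall e, 0 < e -> exists2 x, lam x = 1 & inner x x < d + e).
Proof.
move=> x01; pose D := [set complex.Re (inner x x) | x in [set x | lam x = 1]].
have innerR x : (complex.Re (inner x x))%:C = inner x x.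
  by apply: RRe_real; apply: ger0_real; exact: dnorm_ge0.
have D0 : D !=set0 by exists (complex.Re (inner x0 x0)), x0.
have Dlb : lbound D 0.
  by move=> _ [x _ <-]; rewrite -ler0c innerR dnorm_ge0.
have Dinf : has_inf D by split=> //; exists 0.
exists (inf D)%:C => [x x1|e e0].
  by rewrite -innerR lecR; apply: ge_inf; [exists 0|exists x].
have eR : (complex.Re e)%:C = e by apply/RRe_real/ger0_real/ltW.
have [|_ [x x1 <-] xlt] := @inf_adherent _ _ (complex.Re e) _ Dinf.
  by rewrite -ltcR eR.
exists x => //; rewrite -innerR -eR -rmorphD ltcR//.
Qed.

Lemma riesz_exists (lam : H -> R[i]^o) : bounded_linear lam ->
  exists y, forall x, lam x = inner x y.
Proof.
move=> [lamL [M lamM]].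
have lamD x y : lam (x + y) = lam x + lam y by rewrite -[x]scale1r lamL !scale1r.
have lam0 : lam 0 = 0 by apply: (@addrI _ (lam 0)); rewrite -lamD !addr0.
have lamZ a x : lam (a *: x) = a * lam x.
  by rewrite -[a *: x]addr0 lamL lam0 addr0.
have lamB x y : lam (x - y) = lam x - lam y.
  by rewrite lamD -scaleN1r lamZ mulN1r.
have [lam_0|] := pselect (forall x, lam x = 0).
  by exists 0 => x; rewrite lam_0 linear0r.
move=> /existsNP[x0 /eqP lx0].
have [|d dP dinf] := @min_seq lam ((lam x0)^-1 *: x0).
  by rewrite lamZ mulVf.
pose S (e : R[i]) := [set x | lam x = 1 /\ inner x x < d + e].
pose F := filter_from [set e : R[i] | 0 < e] S.
have PF : ProperFilter F.
  apply: filter_from_proper; last first.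
    by move=> e /dinf[x x1 xe]; exists x.
  apply: filter_from_filter; first by exists 1; exact: ltr01.
  move=> i j i0 j0.
  have [ij|ji] := orP (real_leVge (gtr0_real i0) (gtr0_real j0)).
    exists i => // x [x1 xi]; split; split=> //.
    by apply: lt_le_trans xi _; rewrite lerD2l.
  exists j => // x [x1 xj]; split; split=> //.
  by apply: lt_le_trans xj _; rewrite lerD2l.
have h2 : 0 < (2 : R[i]) by rewrite ltr0n.
have [e e0|l Fl] := @hilbert_complete R H F PF.
  have e40 : 0 < e / 2 / 2 by apply: divr_gt0 => //; exact: divr_gt0.
  have [x x1 xe] := dinf _ e40.
  exists x, (e / 2 / 2) => // y [y1 ye] /=.
  have xy1 : lam (2^-1 *: (x + y)) = 1.
    by rewrite lamZ lamD x1 y1 mulVf ?gt_eqF.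
  have := dP _ xy1; rewrite dnormZ normfV (gtr0_norm h2) dnormD.
  rewrite exprVn ler_pdivlMl ?exprn_gt0// => dxy.
  rewrite dnormB; set c := _ + _^* in dxy *.
  have -> : inner x x + inner y y - c =
      (inner x x + inner y y) *+ 2 - (inner x x + inner y y + c).
    by ring.
  apply: lt_le_trans (_ : (d + e / 2 / 2 + (d + e / 2 / 2)) *+ 2 - 2 ^+ 2 * d <= e).
    by apply: ltr_leB => //; rewrite ltr_pMn2r// ltrD.
  have -> : (d + e / 2 / 2 + (d + e / 2 / 2)) *+ 2 - 2 ^+ 2 * d = e by field.
  by [].
pose K := `|M| + 1.
have K0 : 0 < K by apply: ltr_wpDl.
have lamK x : `|lam x| <= K * `|x|.
  apply: le_trans (lamM x) _; rewrite mulrDl mul1r.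
  have Mx : M * `|x| \is Num.real.
    by apply: ger0_real; apply: le_trans (lamM x).
  apply: le_trans (real_ler_norm Mx) _; rewrite normrM normr_id lerDl.
  exact: normr_ge0.
have near e : 0 < e -> exists y, [/\ lam y = 1, inner y y < d + e ^+ 2 & `|l - y| < e].
  move=> e0; have e20 : 0 < e ^+ 2 by exact: exprn_gt0.
  have Se : F (S (e ^+ 2)) by exists (e ^+ 2).
  have [y [/= ley [y1 ye]]] := @filter_ex _ F PF _ (@filterI _ F PF _ _ (Fl _ e20) Se).
  exists y; split=> //; move: ley; rewrite inner_norm.
  by rewrite ltr_pXn2r ?nnegrE ?(ltW e0).
have l1 : lam l = 1.
  apply/eqP; rewrite -subr_eq0 -normr_eq0; apply/eqP.
  apply: (@small _ K) => // e /near[y [y1 _ lye]].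
  rewrite -{}y1 -lamB; apply: le_trans (lamK _) _.
  by rewrite ler_pM2l// ltW.
have lz z : lam z = 0 -> inner l z = 0.
  move=> z0; apply/eqP; rewrite -normr_eq0; apply/eqP.
  apply: (@small _ (`|z| + `|z| + 1)) => //.
  move=> e e0; have [y [y1 ye lye]] := near _ e0.
  have -> : inner l z = inner (l - y) z + inner y z.
    by rewrite -linearDl subrK.
  apply: le_trans (ler_normD _ _) _.
  apply: le_trans (_ : e * `|z| + e * `|z| <= _); last first.
    have -> : (`|z| + `|z| + 1) * e = e * `|z| + e * `|z| + e by ring.
    by rewrite lerDl ltW.
  apply: lerD; last exact: near_orth lamL dP y1 z0 ye (ltW e0).
  apply: le_trans (_ : `|l - y| * `|z| <= _).
    rewrite -(@ler_pXn2r _ 2) ?nnegrE ?mulr_ge0// exprMn -!inner_norm.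
    exact: dot_CauchySchwarz.
  by apply: ler_wpM2r => //; exact: ltW.
have l0 : l != 0 by apply: contra_eq_neq l1 => ->; rewrite lam0 eq_sym oner_eq0.
have ll0 : 0 < inner l l by rewrite dnorm_gt0.
exists ((inner l l)^-1 *: l) => x.
have /lz : lam (x - lam x *: l) = 0 by rewrite lamB lamZ l1 mulr1 subrr.
move=> /eqP; rewrite herm_eq0C linearBl linearZl_LR /= subr_eq0 => /eqP xl.
rewrite linearZr_LR /= xl fmorphV /= (CrealP (gtr0_real ll0)).
by rewrite mulrCA mulVf ?mulr1// gt_eqF.
Qed.

End Riesz.

Section DualSpace.
Context {R : realType} {H : hilbertType R}.

Definition bounded_functional : {pred H -> R[i]^o} :=
  [pred lam | `[< bounded_linear lam >]].

Let bounded_functional_submod : submod_closed bounded_functional.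
Proof.
split=> [|a f g].
  apply/asboolP; split=> [a x y|]; first by rewrite /= scaler0 addr0.
  by exists 0 => x; rewrite normr0 mul0r.
move=> /asboolP[fL [M fM]] /asboolP[gL [N gN]]; apply/asboolP; split.
  move=> b x y.
  change (a *: f (b *: x + y) + g (b *: x + y) =
    b *: (a *: f x + g x) + (a *: f y + g y)).
  by rewrite fL gL !scalerDr !scalerA [a * b]mulrC addrACA.
exists (`|a| * M + N) => x; rewrite mulrDl.
apply: le_trans (ler_normD _ _) _; apply: lerD => //.
by rewrite normrZ -mulrA ler_wpM2l.
Qed.

HB.instance Definition _ := GRing.isSubmodClosed.Build R[i] (H -> R[i]^o)
  bounded_functional bounded_functional_submod.
End DualSpace.

Record dual (R : realType) (H : hilbertType R) := Dual {
  dual_fun :> H -> R[i]^o;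
  dual_funP : dual_fun \in bounded_functional
}.

HB.instance Definition _ R H := [isSub for @dual_fun R H].
HB.instance Definition _ R H := [Choice of @dual R H by <:].
HB.instance Definition _ R H := [SubChoice_isSubLmodule of @dual R H by <:].

Section DualHilbert.
Context {R : realType} {H : hilbertType R}.
Implicit Types (lam mu : dual H).
 
Lemma dual_bounded lam : bounded_linear lam.
Proof. exact/asboolP/(dual_funP lam). Qed.

Definition riesz lam : H := projT1 (cid (riesz_exists (dual_bounded lam))).

Lemma rieszE lam x : lam x = inner x (riesz lam).
Proof. by rewrite /riesz; case: cid. Qed.

Lemma rieszP a lam mu : riesz (a *: lam + mu) = Num.conj a *: riesz lam + riesz mu.
Proof.
apply/eqP; rewrite -subr_eq0 -(dnorm_eq0 inner).
set z := _ - _; rewrite {2}/z linearBr /= linearDr /= linearZr_LR /= conjCK.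
by rewrite -!rieszE subrr.
Qed.

Let to_dual_subproof (y : H) : (inner ^~ y : H -> R[i]^o) \in bounded_functional.
Proof.
apply/asboolP; split=> [a u v|]; first by rewrite linearDl linearZl_LR.
exists `|y| => x; rewrite mulrC -(@ler_pXn2r _ 2) ?nnegrE ?mulr_ge0//.
by rewrite exprMn -!inner_norm dot_CauchySchwarz.
Qed.

Let to_dual (y : H) : dual H := Dual (to_dual_subproof y).

Lemma dualP lam mu : lam =1 mu -> lam = mu.
Proof. by move=> lm; apply/val_inj/funext. Qed.

Let to_dualK : cancel to_dual riesz.
Proof.
move=> y; apply/eqP; rewrite -subr_eq0 -(dnorm_eq0 inner) linearBr /=.
by rewrite -rieszE subrr.
Qed.

Let rieszK : cancel riesz to_dual.
Proof. by move=> lam; apply: dualP => x; rewrite (rieszE lam). Qed.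

Let rieszB lam mu : riesz (lam - mu) = riesz lam - riesz mu.
Proof.
by rewrite addrC -scaleN1r rieszP rmorphN rmorph1 scaleN1r addrC.
Qed.

(* The inner product polarizing the operator norm, see [dual_normP]; the
   arguments are swapped because [riesz] is conjugate-linear. *)
Let dual_inner lam mu : R[i] := inner (riesz mu) (riesz lam).

Let dual_innerP (a : R[i]) lam mu nu :
  dual_inner (a *: lam + mu) nu = a * dual_inner lam nu + dual_inner mu nu.
Proof. by rewrite /dual_inner rieszP linearDr linearZr_LR /= conjCK. Qed.

Let dual_innerC lam mu : dual_inner lam mu = Num.conj (dual_inner mu lam).
Proof. by rewrite /dual_inner [LHS]hermC mul1r. Qed.

Let dual_inner_gt0 lam : lam != 0 -> 0 < dual_inner lam lam.
Proof.
rewrite /dual_inner dnorm_gt0; apply: contra_neq => lam0.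
apply: dualP => x; rewrite rieszE lam0 linear0r.
by rewrite -[dual_fun 0]/(val (0 : dual H)) raddf0.
Qed.

Let dual_inner_complete (F : set_system (dual H)) : ProperFilter F ->
  (forall e : R[i], 0 < e ->
     exists lam, F [set mu | dual_inner (lam - mu) (lam - mu) < e]) ->
  exists l, forall e : R[i], 0 < e ->
    F [set mu | dual_inner (l - mu) (l - mu) < e].
Proof.
move=> PF Fc; have [|l Fl] := @hilbert_complete R H (fmap riesz F) _.
  move=> e /Fc[lam Flam]; exists (riesz lam).
  by apply: (@filterS _ F _ _ _ _ Flam) => mu /=; rewrite /dual_inner rieszB.
exists (to_dual l) => e /Fl Fle.
by apply: (@filterS _ F _ _ _ _ Fle) => mu /=; rewrite /dual_inner rieszB to_dualK.
Qed.

HB.instance Definition _ := @Lmodule_isHilbert.Build R (dual H)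
  dual_inner dual_innerP dual_innerC dual_inner_gt0 dual_inner_complete.

Lemma dual_innerE lam mu : inner lam mu = inner (riesz mu) (riesz lam).
Proof. by []. Qed.

Let dual_norm_riesz lam : `|lam| = `|riesz lam|.
Proof.
apply/eqP; rewrite -(@eqrXn2 _ 2)// -!inner_norm.
by [].
Qed.

(* The norm of [dual H] is the operator norm. *)
Lemma dual_normP lam : (forall x, `|lam x| <= `|lam| * `|x|) /\
  (forall M : R[i], 0 <= M -> (forall x, `|lam x| <= M * `|x|) -> `|lam| <= M).
Proof.
split=> [x|M M0 lamM]; rewrite dual_norm_riesz.
  rewrite mulrC -(@ler_pXn2r _ 2) ?nnegrE ?mulr_ge0//.
  by rewrite exprMn -!inner_norm rieszE dot_CauchySchwarz.
have := lamM (riesz lam); rewrite rieszE inner_norm normrX normr_id.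
have [->|r0] := eqVneq (riesz lam) 0; first by rewrite normr0.
by rewrite expr2 ler_pM2r// normr_gt0.
Qed.

End DualHilbert.

Definition quat (R : realType) : Type := (R^o * R^o * R^o * R^o)%type.

Section Quaternions.
Context {R : realType}.

HB.instance Definition _ := GRing.Lmodule.copy (quat R) (R^o * R^o * R^o * R^o)%type.

(* [(a, b, c, d)] stands for a + b i + c j + d k. *)
Let quat_mul (p q : quat R) : quat R :=
  let: (a, b, c, d) := p in let: (a', b', c', d') := q in
  (a * a' - b * b' - c * c' - d * d',
   a * b' + b * a' + c * d' - d * c',
   a * c' - b * d' + c * a' + d * b',
   a * d' + b * c' - c * b' + d * a').

Let quat_one : quat R := (1, 0, 0, 0).

Let quatE (a b c d a' b' c' d' : R) :
  a = a' -> b = b' -> c = c' -> d = d' -> (a, b, c, d) = (a', b', c', d') :> quat R.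
Proof. by move=> -> -> -> ->. Qed.

Let quat_mulA : associative quat_mul.
Proof.
by move=> [[[? ?] ?] ?] [[[? ?] ?] ?] [[[? ?] ?] ?]; apply: quatE => /=; ring.
Qed.

Let quat_mul1l : left_id quat_one quat_mul.
Proof. by move=> [[[? ?] ?] ?]; apply: quatE => /=; ring. Qed.

Let quat_mul1r : right_id quat_one quat_mul.
Proof. by move=> [[[? ?] ?] ?]; apply: quatE => /=; ring. Qed.

Let quat_mulDl : left_distributive quat_mul +%R.
Proof.
by move=> [[[? ?] ?] ?] [[[? ?] ?] ?] [[[? ?] ?] ?]; apply: quatE => /=; ring.
Qed.

Let quat_mulDr : right_distributive quat_mul +%R.
Proof.
by move=> [[[? ?] ?] ?] [[[? ?] ?] ?] [[[? ?] ?] ?]; apply: quatE => /=; ring.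
Qed.

Let quat_one_neq0 : quat_one != 0.
Proof. by apply/eqP => -[/eqP]; rewrite oner_eq0. Qed.

HB.instance Definition _ := GRing.Zmodule_isNzRing.Build (quat R)
  quat_mulA quat_mul1l quat_mul1r quat_mulDl quat_mulDr quat_one_neq0.

Let scaleE (k x : R) : k *: (x : R^o) = k * x.
Proof. by []. Qed.

Let quat_scaleAl (k : R) (p q : quat R) : k *: (p * q) = (k *: p : quat R) * q.
Proof.
by move: p q => [[[? ?] ?] ?] [[[? ?] ?] ?]; apply: quatE => /=;
  rewrite !scaleE; ring.
Qed.

HB.instance Definition _ := GRing.Lmodule_isLalgebra.Build R (quat R) quat_scaleAl.

Let quat_scaleAr (k : R) (p q : quat R) : k *: (p * q) = p * (k *: q : quat R).
Proof.
by move: p q => [[[? ?] ?] ?] [[[? ?] ?] ?]; apply: quatE => /=;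
  rewrite !scaleE; ring.
Qed.

HB.instance Definition _ := GRing.Lalgebra_isAlgebra.Build R (quat R) quat_scaleAr.

End Quaternions.

Section Operators.
Context {R : realType}.
Implicit Types H K : hilbertType R.

Definition unitary_op H K (A : H -> K) :=
  [/\ linear A, (forall x, `|A x| = `|x|) & (forall y, exists x, A x = y)].

Definition antiunitary_op H K (A : H -> K) :=
  [/\ GRing.linear_for (@Num.conj R[i] \; *:%R) A,
      (forall x, `|A x| = `|x|) & (forall y, exists x, A x = y)].

Definition commutant H (X : set (H -> H)) : set (H -> H) :=
  [set A | bounded_linear A /\ forall B, X B -> A \o B = B \o A].

Definition adjoint_of H (A B : H -> H) := forall x y, inner (A x) y = inner x (B y).

Definition von_neumann_algebra H (X : set (H -> H)) :=
  (forall A, X A -> exists2 B, X B & adjoint_of A B) /\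
  commutant (commutant X) = X.

(* [X] is isomorphic to [A] as a unital algebra over [K], where [K] acts on
   operators through [c : K -> R[i]]. *)
Definition algebra_iso (K : nzRingType) (c : K -> R[i]) (A : lalgType K)
    H (X : set (H -> H)) :=
  exists phi : A -> H -> H,
    [/\ set_bij setT X phi,
        (forall a b x, phi (a + b) x = phi a x + phi b x),
        (forall k a x, phi (k *: a) x = c k *: phi a x),
        (forall a b, phi (a * b) = phi a \o phi b)
      & phi 1 = idfun].

Definition real_algebra_iso (A : lalgType R) H (X : set (H -> H)) :=
  algebra_iso (real_complex R) A X.

Definition complex_algebra_iso (A : lalgType R[i]) H (X : set (H -> H)) :=
  algebra_iso (@idfun R[i]) A X.

(* The complexification of the real algebra [X] is [X `*` X], the pair [(B, C)]
   standing for B (x) 1 + C (x) i; the complex algebra [Y] is the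
   complexification of [X] when the canonical map B (x) 1 + C (x) i |-> B + i C
   is an isomorphism of complex algebras onto [Y]. *)
Definition is_complexification H (X Y : set (H -> H)) :=
  let can (p : (H -> H) * (H -> H)) := fun x => p.1 x + 'i *: p.2 x in
  [/\ set_bij (X `*` X) Y can,
      (forall p q, (X `*` X) p -> (X `*` X) q -> forall x,
         can (fun y => p.1 y + q.1 y, fun y => p.2 y + q.2 y) x
         = can p x + can q x),
      (forall (a b : R) p, (X `*` X) p -> forall x,
         can (fun y => a%:C *: p.1 y - b%:C *: p.2 y,
              fun y => a%:C *: p.2 y + b%:C *: p.1 y) x
         = (a +i* b) *: can p x)
    & (forall p q, (X `*` X) p -> (X `*` X) q -> forall x,
         can (fun y => p.1 (q.1 y) - p.2 (q.2 y),
              fun y => p.1 (q.2 y) + p.2 (q.1 y)) x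
         = can p (can q x))].

(* Precomposition with [A]; only meaningful when [A] is linear and bounded, and
   the zero functional otherwise. *)
Definition dual_op H (A : H -> H) (lam : dual H) : dual H :=
  insubd (0 : dual H) (lam \o A : H -> R[i]^o).

Lemma dual_opE H (A : H -> H) lam x :
  bounded_linear A -> dual_op A lam x = lam (A x).
Proof.
move=> [AL [M AM]]; rewrite /dual_op -[dual_fun _]/(val _) val_insubd ifT//.
have [lamL _] := dual_bounded lam.
apply/asboolP; split=> [a u v|]; first by rewrite /= AL lamL.
exists (`|lam| * M) => u /=; rewrite -mulrA.
by apply: le_trans ((dual_normP lam).1 _) _; rewrite ler_wpM2l.
Qed.

End Operators.

Section Representations.
Context {R : realType} {G : groupType}.
Implicit Types (H K : hilbertType R) (S : {pred G}).

Definition index_two (G1 : {pred G}) :=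
  group_closed G1 /\
  ([set [set (g * h)%g | h in [set` G1]] | g in [set: G]] #= `I_2)%card.

Definition unitary_rep (G1 : {pred G}) H (U : G -> H -> H) :=
  {in G1, forall g, unitary_op (U g)} /\
  {in G1 &, forall g h, U (g * h)%g = U g \o U h}.

Definition antiunitary_rep (G1 : {pred G}) H (U : G -> H -> H) :=
  [/\ forall g, unitary_op (U g) \/ antiunitary_op (U g),
      forall g h, U (g * h)%g = U g \o U h
    & U @^-1` @unitary_op R H H = [set` G1]].

Definition extension_of (G1 : {pred G}) H (U V : G -> H -> H) := {in G1, forall g, V g = U g}.

Definition extendable (G1 : {pred G}) H (U : G -> H -> H) :=
  exists V : G -> H -> H, antiunitary_rep G1 V /\ extension_of G1 U V.

Definition equivalent_rep S H K (U : G -> H -> H) (V : G -> K -> K) :=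
  exists2 T : H -> K, unitary_op T & {in S, forall g, T \o U g = V g \o T}.

Definition irreducible_rep S H (U : G -> H -> H) :=
  (exists x : H, x != 0) /\
  forall E : set H, closed E -> E 0 ->
    (forall (a : R[i]) x y, E x -> E y -> E (a *: x + y)) ->
    {in S, forall g x, E x -> E (U g x)} ->
    E = [set 0] \/ E = setT.

Definition rep_commutant S H (U : G -> H -> H) : set (H -> H) :=
  commutant (U @` [set` S]).

Definition sum_rep H K (U : G -> H -> H) (V : G -> K -> K) g (x : hsum H K) :
  hsum H K := (U g x.1, V g x.2).

(* On the subgroup where [U] is a representation, [U g^-1] is the inverse of
   [U g]. *)
Definition dual_rep H (U : G -> H -> H) g : dual H -> dual H :=
  dual_op (U (g^-1)%g).

End Representations.

(* Main.v *)
Require Import Defs.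
From HB Require Import structures.
From mathcomp Require Import all_boot all_order all_algebra sesquilinear.
From mathcomp Require Import complex ring lra.
From mathcomp Require Import all_classical all_reals all_analysis.

Set Implicit Arguments.
Unset Strict Implicit.
Unset Printing Implicit Defensive.

Import Order.TTheory GRing.Theory Num.Theory.
Import numFieldNormedType.Exports.

Local Open Scope classical_set_scope.
Local Open Scope ring_scope.
Local Open Scope complex_scope.

(** All spectral theory is reduced to one fact: a bounded operator [T] has an
    absolute value, obtained as a limit of the iteration
    [Y := (K + Y^2) / 2] for a contraction [K], and hence commuting with every
    bounded real-linear map that commutes with [T^* T]. It yields Schur's lemma
    (for a self-adjoint [B] in the commutant, the kernel of [|B| - B] is trivial
    or everything), including for families of unitary and antiunitary operators.

    (a) If [T] intertwines two antiunitary representations on [G1], then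
    [u := T^-1 U2_r T U1_r^-1] is a unitary in the commutant, inverted by
    conjugation with [U1_r]; if [W] is a square root of [u] with the same
    property, [T W] intertwines the two representations on [G].

    (b) Conjugation with [U_r] is an antilinear involution of the commutant of
    [G1], and its fixed points form the commutant of [G].

    (c) Schur's lemma makes the self-adjoint part of the commutant of [G] real,
    so Frobenius' argument on its skew part applies. An imaginary unit [I] in the
    commutant commutes with the antiunitary [U_r], which therefore exchanges the
    eigenspaces of [I] for [i] and [-i]; these are the two irreducible summands.

    (d) On [H + H^*], the map [(x, l) |-> (riesz l, riesz^-1 (U_(r^2) x))] extends
    [U + U^* o tau]. The range of an invariant projection [P] that is neither
    [0] nor [1] is the image of [H] under a multiple of [x |-> P (x, 0)], and
    transporting the representation back to [H] extends [U]. *)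

(** The obstacle throughout is that antiunitary operators are only real-linear: whatever is built
    from an operator has to be compatible with them. The iterates for the absolute value are
    polynomials with real coefficients, which is why the limit commutes with real-linear maps. In
    (a), [u] measures the failure of [T] to intertwine at [r]. Passing from [T] to [T W] turns [u]
    into [W^-1 u (U1_r W U1_r^-1) = W^-1 u W^-1], which is 1 for a square root inverted by
    conjugation with [U1_r]. In (c), an extension of one summand, compared with [U_r], yields a
    [G1]-intertwiner from one eigenspace of [I] to the other. In the complex case only 0 is
    available; in the quaternionic case it is a multiple [w J], and [J^2 = -1] leads to
    [1 + |w|^2 = 0]. In (d), the compression of [P] to the first summand commutes with [U], so it is
    a scalar [a], and [W_r] carries the same scalar to the second summand. The values 0 and 1 of [a]
    are the trivial projections; any other value makes [x |-> P (x, 0) / sqrt a] an isometry onto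
    the range of [P]. *)

(** * Subgroups of index two *)

Section IndexTwo.
Context {G : groupType} {G1 : {pred G}}.
Hypothesis hG1 : index_two G1.

Lemma index2_1 : 1%g \in G1.
Proof. by have [[]] := hG1. Qed.

Lemma index2_V g : g \in G1 -> (g^-1)%g \in G1.
Proof.
have [[h1 hd] _] := hG1 => gG; have := hd _ _ h1 gG.
by rewrite mul1g.
Qed.

Lemma index2_VE g : ((g^-1)%g \in G1) = (g \in G1).
Proof. by apply/idP/idP => /index2_V; rewrite ?invgK. Qed.

Lemma index2_M g h : g \in G1 -> h \in G1 -> (g * h)%g \in G1.
Proof.
have [[h1 hd] _] := hG1 => gG /index2_V hG.
by have := hd _ _ gG hG; rewrite invgK.
Qed.

Lemma index2_Ml g h : g \in G1 -> ((g * h)%g \in G1) = (h \in G1).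
Proof.
move=> gG; apply/idP/idP => [ghG|]; last exact: index2_M.
by rewrite -[h](mulKg g) index2_M// index2_V.
Qed.

Lemma index2_Mr g h : h \in G1 -> ((g * h)%g \in G1) = (g \in G1).
Proof. by move=> hG; rewrite -index2_VE invgM index2_Ml ?index2_VE. Qed.

(* Three pairwise distinct left cosets would contradict the cardinality 2. *)
Lemma index2_MN g h : g \notin G1 -> h \notin G1 -> (g * h)%g \in G1.
Proof.
move=> gG hG; apply: contraT => ghG.
have [_ hc] := hG1.
pose coset x := [set (x * h)%g | h in [set` G1]].
have inc x y : coset x = coset y -> ((x^-1 * y)%g \in G1).
  move=> xy; have : coset y y by exists 1%g; rewrite ?mulg1//; exact: index2_1.
  by rewrite -xy => -[z /= zG <-]; rewrite mulKg.
have [f [fI finj _]] := card_set_bijP hc.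
have Cx x : [set coset y | y in [set: G]] (coset x) by exists x.
have f2 x : (f (coset x) < 2)%N := fI _ (Cx x).
have inj x y : f (coset x) = f (coset y) -> (x^-1 * y)%g \in G1.
  by move=> /(finj _ _ (mem_set (Cx x)) (mem_set (Cx y)))/inc.
have d1 : f (coset 1%g) <> f (coset h).
  by move=> /inj; rewrite invg1 mul1g; exact/negP.
have d2 : f (coset 1%g) <> f (coset (g^-1)%g).
  by move=> /inj; rewrite invg1 mul1g index2_VE; exact/negP.
have d3 : f (coset (g^-1)%g) <> f (coset h).
  by move=> /inj; rewrite invgK; exact/negP.
move: d1 d2 d3 (f2 1%g) (f2 h) (f2 (g^-1)%g).
by case: (f _) => [|[|?]]; case: (f _) => [|[|?]]; case: (f _) => [|[|?]].
Qed.

End IndexTwo.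

(** * Inner product calculus *)

Section InnerProduct.
Context {R : realType} {H : hilbertType R}.
Implicit Types (x y z : H) (a : R[i]).

Lemma innerDl x y z : inner (x + y) z = inner x z + inner y z.
Proof. exact: linearDl. Qed.
Lemma innerDr x y z : inner z (x + y) = inner z x + inner z y.
Proof. exact: linearDr. Qed.
Lemma innerZl a x y : inner (a *: x) y = a * inner x y.
Proof. exact: linearZl_LR. Qed.
Lemma innerZr a x y : inner x (a *: y) = Num.conj a * inner x y.
Proof. exact: linearZr_LR. Qed.
Lemma innerNl x y : inner (- x) y = - inner x y.
Proof. exact: linearNl. Qed.
Lemma innerNr x y : inner x (- y) = - inner x y.
Proof. exact: linearNr. Qed.
Lemma inner0l x : inner 0 x = 0 :> R[i].
Proof. exact: linear0l. Qed.
Lemma inner0r x : inner x 0 = 0 :> R[i].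
Proof. exact: linear0r. Qed.
Lemma inner_conj x y : inner x y = Num.conj (inner y x).
Proof. by rewrite [LHS]hermC mul1r. Qed.

Lemma inner_eq0 x : inner x x = 0 -> x = 0.
Proof. by move/eqP; rewrite dnorm_eq0 => /eqP. Qed.

Lemma inner_inj x y : (forall z, inner x z = inner y z) -> x = y.
Proof.
move=> xy; apply/eqP; rewrite -subr_eq0; apply/eqP/inner_eq0.
by rewrite innerDl innerNl xy subrr.
Qed.

Lemma inner_injr x y : (forall z, inner z x = inner z y) -> x = y.
Proof. by move=> xy; apply: inner_inj => z; rewrite inner_conj xy -inner_conj. Qed.

Lemma ler_inner x y : `|inner x y| <= `|x| * `|y|.
Proof.
rewrite -(@ler_pXn2r _ 2) ?nnegrE ?mulr_ge0// exprMn -!inner_norm.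
exact: dot_CauchySchwarz.
Qed.

Lemma norm_eq_inner (K : hilbertType R) x (y : K) :
  inner x x = inner y y -> `|x| = `|y|.
Proof. by rewrite !inner_norm => /eqP; rewrite eqrXn2// => /eqP. Qed.

Lemma real_conj (b : R) : Num.conj (b%:C : R[i]) = b%:C.
Proof. by apply: (CrealP _); rewrite complex_real. Qed.

Lemma real_half (b : R) : (b / 2)%:C = b%:C / 2 :> R[i].
Proof. by rewrite rmorphM fmorphV rmorph_nat. Qed.

Lemma ImagE (a b : R) : (a +i* b) = a%:C + 'i%R * b%:C :> R[i].
Proof. by rewrite -complexiE [LHS]complexE. Qed.

Lemma imag_sqr : 'i%R * 'i%R = -1 :> R[i].
Proof. by rewrite -expr2 sqrCi. Qed.

Lemma conj_opp_i : Num.conj (- 'i%R : R[i]) = 'i%R.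
Proof. by rewrite rmorphN /= conjCi opprK. Qed.

Lemma half_conj : Num.conj (2^-1 : R[i]) = 2^-1.
Proof. by rewrite fmorphV /= rmorph_nat. Qed.

End InnerProduct.

Definition innerE := (@innerDl, @innerNl, @innerZl, @inner0l).
Definition innerrE := (@innerDr, @innerNr, @innerZr, @inner0r).

(* Equations between vectors are tested against all vectors, which turns them
   into scalar equations that [ring] can solve. *)
Ltac vec := apply: inner_inj => ?; rewrite !innerE; ring.
Ltac veci R := apply: inner_inj => ?; rewrite !innerE; ring: (@imag_sqr R).

(* Proves an equation whose sides differ, up to ring identities, by the two
   sides of [h]. *)
Ltac eqring h :=
  let t := type of h in let t := eval cbv beta in t in
  match t with ?a = ?b => apply: subr0_eq;
    transitivity (a - b); [ring | by apply/eqP; rewrite subr_eq0; apply/eqP; exact: h] end.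

(** * Bounded, unitary and antiunitary operators *)

Section Operators.
Context {R : realType}.
Implicit Types H K L : hilbertType R.

Lemma linE H K (A : H -> K) : linear A ->
  (forall x y, A (x + y) = A x + A y) * (forall (a : R[i]) x, A (a *: x) = a *: A x) *
  (forall x, A (- x) = - A x) * (A 0 = 0).
Proof.
move=> AL.
have AD x y : A (x + y) = A x + A y by rewrite -[x]scale1r AL !scale1r.
have A0 : A 0 = 0 by apply: (@addrI _ (A 0)); rewrite -AD !addr0.
have AZ a x : A (a *: x) = a *: A x by rewrite -[a *: x]addr0 AL A0 addr0.
split=> [|//]; split=> [|x]; first by split.
by rewrite -scaleN1r AZ scaleN1r.
Qed.

Lemma antiE H K (A : H -> K) : GRing.linear_for (@Num.conj R[i] \; *:%R) A ->
  (forall x y, A (x + y) = A x + A y) *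
  (forall (a : R[i]) x, A (a *: x) = Num.conj a *: A x) *
  (forall x, A (- x) = - A x) * (A 0 = 0).
Proof.
move=> AL.
have AD x y : A (x + y) = A x + A y.
  by rewrite -[x]scale1r AL /= rmorph1 !scale1r.
have A0 : A 0 = 0 by apply: (@addrI _ (A 0)); rewrite -AD !addr0.
have AZ a x : A (a *: x) = Num.conj a *: A x.
  by rewrite -[a *: x]addr0 AL A0 addr0.
split=> [|//]; split=> [|x]; first by split.
by rewrite -scaleN1r AZ rmorphN rmorph1 scaleN1r.
Qed.

(** The constant in [bounded_linear] is an arbitrary complex number; [|M| + 1] is a positive one
    with the same effect. *)
Lemma bounded_linearP H K (A : H -> K) : bounded_linear A ->
  exists2 M : R[i], 0 < M & forall x, `|A x| <= M * `|x|.
Proof.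
move=> [_ [M AM]]; exists (`|M| + 1) => [|x]; first by rewrite ltr_wpDl.
apply: le_trans (AM x) _.
have Mx : M * `|x| \is Num.real by apply: ger0_real; apply: le_trans (AM x).
apply: le_trans (real_ler_norm Mx) _; rewrite normrM normr_id ler_wpM2r//.
by rewrite lerDl.
Qed.

Lemma bounded_linear_id H : bounded_linear (@idfun H).
Proof. by split=> [a x y //|]; exists 1 => x; rewrite mul1r. Qed.

Lemma bounded_linear_comp H K L (A : K -> L) (B : H -> K) :
  bounded_linear A -> bounded_linear B -> bounded_linear (fun x => A (B x)).
Proof.
move=> bA bB; have [M M0 AM] := bounded_linearP bA.
have [N N0 BN] := bounded_linearP bB.
split=> [a x y|]; first by rewrite bB.1 bA.1.
exists (M * N) => x; apply: le_trans (AM _) _.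
by rewrite -mulrA ler_pM2l.
Qed.

Lemma bounded_linearD H K (A B : H -> K) :
  bounded_linear A -> bounded_linear B -> bounded_linear (fun x => A x + B x).
Proof.
move=> bA bB; have [M M0 AM] := bounded_linearP bA.
have [N N0 BN] := bounded_linearP bB.
split=> [a x y|]; first by rewrite bB.1 bA.1; vec.
exists (M + N) => x; apply: le_trans (ler_normD _ _) _.
by rewrite mulrDl lerD.
Qed.

Lemma bounded_linearZ H K (a : R[i]) (A : H -> K) :
  bounded_linear A -> bounded_linear (fun x => a *: A x).
Proof.
move=> bA; have [M M0 AM] := bounded_linearP bA.
split=> [b x y|]; first by rewrite bA.1; vec.
by exists (`|a| * M) => x; rewrite normrZ -mulrA ler_wpM2l.
Qed.

Lemma bounded_linearN H K (A : H -> K) :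
  bounded_linear A -> bounded_linear (fun x => - A x).
Proof.
move=> /(bounded_linearZ (-1)) [L [M B]]; split=> [a x y|]; last first.
  by exists M => x; rewrite -scaleN1r.
by have := L a x y; rewrite !scaleN1r.
Qed.

Lemma bounded_linearB H K (A B : H -> K) :
  bounded_linear A -> bounded_linear B -> bounded_linear (fun x => A x - B x).
Proof. by move=> bA bB; apply: bounded_linearD => //; exact: bounded_linearN. Qed.

Lemma bounded_linear_scale H (a : R[i]) : bounded_linear (fun x : H => a *: x).
Proof. exact: bounded_linearZ (bounded_linear_id H). Qed.

Lemma adjoint_exists H K (A : H -> K) : bounded_linear A ->
  exists2 B : K -> H, bounded_linear B & forall x y, inner (A x) y = inner x (B y).
Proof.
move=> bA; have [M M0 AM] := bounded_linearP bA.
have ex y : exists z, forall x, inner (A x) y = inner x z.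
  apply: riesz_exists; split=> [a u v|]; first by rewrite bA.1 innerDl innerZl.
  exists (M * `|y|) => x; apply: le_trans (ler_inner _ _) _.
  by rewrite mulrAC ler_wpM2r.
have [B BP] := choice ex; exists B => //; split=> [a x y|].
  apply: inner_injr => z; rewrite -BP !innerrE -!BP//.
(* [|B y|^2 = <A (B y), y> <= M |B y| |y|], divided by [|B y|]. *)
exists M => y; have [->|By0] := eqVneq (B y) 0; first by rewrite normr0 mulr_ge0// ltW.
have Byp : 0 < `|B y| by rewrite normr_gt0.
rewrite -(ler_pM2l Byp) -expr2 -inner_norm -BP.
have Mp : M * `|B y| * `|y| \is Num.real by rewrite ger0_real// !mulr_ge0// ltW.
have [r0|] := boolP (inner (A (B y)) y <= M * `|B y| * `|y|).
  by rewrite mulrCA mulrA.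
rewrite BP inner_norm -real_ltNge ?(ger0_real (exprn_ge0 _ _))// -inner_norm -BP.
move=> h; have := ler_inner (A (B y)) y.
rewrite ger0_norm; last by rewrite BP inner_norm exprn_ge0.
move=> /(lt_le_trans h)/lt_le_trans => /(_ (M * `|B y| * `|y|)).
by rewrite ler_wpM2r// ltxx => /(_ isT).
Qed.

Lemma adjoint_sym H K (A : H -> K) B : (forall x y, inner (A x) y = inner x (B y)) ->
  forall x y, inner (B x) y = inner x (A y).
Proof. by move=> AB x y; rewrite inner_conj -AB -inner_conj. Qed.

Lemma linear_isometry_inner H K (A : H -> K) : linear A ->
  (forall x, `|A x| = `|x|) -> forall x y, inner (A x) (A y) = inner x y.
Proof.
move=> /linE AE An x y.
have An2 z : inner (A z) (A z) = inner z z by rewrite !inner_norm An.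
have h1 := An2 (x + y); have h2 := An2 ('i%R *: x + y).
rewrite !AE !(innerE, innerrE) !An2 ?conjCi in h1 h2.
(* Polarization: ['i] times the identity at [x + y] plus the one at ['i x + y] leaves [2 'i <x, y>]
   on both sides. *)
apply: (@mulfI _ (2 * 'i%R)); first by rewrite mulf_neq0 ?neq0Ci ?pnatr_eq0.
by eqring (congr2 (fun u v : R[i] => 'i%R * u + v) h1 h2).
Qed.

Lemma antilinear_isometry_inner H K (A : H -> K) :
  GRing.linear_for (@Num.conj R[i] \; *:%R) A ->
  (forall x, `|A x| = `|x|) -> forall x y, inner (A x) (A y) = inner y x.
Proof.
move=> /antiE AE An x y.
have An2 z : inner (A z) (A z) = inner z z by rewrite !inner_norm An.
have h1 := An2 (x + y); have h2 := An2 ('i%R *: x + y).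
rewrite !AE !(innerE, innerrE) !An2 ?conjCK ?conjCi in h1 h2.
apply: (@mulfI _ (2 * 'i%R)); first by rewrite mulf_neq0 ?neq0Ci ?pnatr_eq0.
by eqring (congr2 (fun u v : R[i] => 'i%R * u - v) h1 h2).
Qed.

Definition au_op H K (A : H -> K) := unitary_op A \/ antiunitary_op A.

(** Covers unitary and antiunitary operators at once, so that one commutation statement serves
    both. *)
Definition real_bounded H K (S : H -> K) :=
  [/\ forall x y, S (x + y) = S x + S y,
      forall (a : R) x, S (a%:C *: x) = a%:C *: S x
    & exists2 M : R[i], 0 < M & forall x, `|S x| <= M * `|x|].

Lemma bounded_linear_real H K (A : H -> K) : bounded_linear A -> real_bounded A.
Proof.
move=> bA; split; last exact: bounded_linearP.
  by move=> x y; rewrite (linE bA.1).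
by move=> a x; rewrite (linE bA.1).
Qed.

Lemma unitary_bounded H K (A : H -> K) : unitary_op A -> bounded_linear A.
Proof. by move=> [L N _]; split=> //; exists 1 => x; rewrite N mul1r. Qed.

Lemma au_real H K (A : H -> K) : au_op A -> real_bounded A.
Proof.
move=> [/unitary_bounded/bounded_linear_real//|[/antiE AE AN _]].
split=> [x y|a x|]; first by rewrite AE.
  by rewrite AE real_conj.
by exists 1 => // x; rewrite AN mul1r.
Qed.

Lemma au_norm H K (A : H -> K) : au_op A -> forall x, `|A x| = `|x|.
Proof. by move=> [] []. Qed.

Lemma au_surj H K (A : H -> K) : au_op A -> forall y, exists x, A x = y.
Proof. by move=> [] []. Qed.

Lemma auD H K (A : H -> K) : au_op A -> forall x y, A (x + y) = A x + A y.
Proof. by move=> /au_real[]. Qed.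

Lemma auN H K (A : H -> K) : au_op A -> forall x, A (- x) = - A x.
Proof. by move=> [] [] => [/linE|/antiE] AE _ _ x; rewrite AE. Qed.

Lemma au0 H K (A : H -> K) : au_op A -> A 0 = 0.
Proof. by move=> [] [] => [/linE|/antiE] AE _ _; rewrite AE. Qed.

Lemma auR H K (A : H -> K) : au_op A -> forall (a : R) x, A (a%:C *: x) = a%:C *: A x.
Proof. by move=> /au_real[]. Qed.

Lemma au_eq0 H K (A : H -> K) : au_op A -> forall x, A x = 0 -> x = 0.
Proof. by move=> /au_norm AN x Ax; apply/normr0_eq0; rewrite -AN Ax normr0. Qed.

Lemma au_inj H K (A : H -> K) : au_op A -> injective A.
Proof.
move=> hA x y Axy; apply/eqP; rewrite -subr_eq0; apply/eqP/(au_eq0 hA).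
by rewrite (auD hA) (auN hA) Axy subrr.
Qed.

Lemma au_inner_eq0 H K (A : H -> K) : au_op A ->
  forall x y, inner x y = 0 -> inner (A x) (A y) = 0.
Proof.
move=> [[L N _]|[L N _]] x y xy; first by rewrite linear_isometry_inner.
by rewrite antilinear_isometry_inner// inner_conj xy rmorph0.
Qed.

Lemma unitary_inner H K (A : H -> K) : unitary_op A ->
  forall x y, inner (A x) (A y) = inner x y.
Proof. by move=> [L N _]; exact: linear_isometry_inner. Qed.

Lemma antiunitary_inner H K (A : H -> K) : antiunitary_op A ->
  forall x y, inner (A x) (A y) = inner y x.
Proof. by move=> [L N _]; exact: antilinear_isometry_inner. Qed.

Lemma unitary_comp H K L (A : K -> L) (B : H -> K) :
  unitary_op A -> unitary_op B -> unitary_op (fun x => A (B x)).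
Proof.
move=> [AL AN AS] [BL BN BS]; split=> [a x y|x|z]; first by rewrite BL AL.
  by rewrite AN BN.
by have [y <-] := AS z; have [x <-] := BS y; exists x.
Qed.

Lemma unitary_antiunitary_comp H K L (A : K -> L) (B : H -> K) :
  unitary_op A -> antiunitary_op B -> antiunitary_op (fun x => A (B x)).
Proof.
move=> [AL AN AS] [BL BN BS]; split=> [a x y|x|z]; first by rewrite BL AL.
  by rewrite AN BN.
by have [y <-] := AS z; have [x <-] := BS y; exists x.
Qed.

Lemma antiunitary_unitary_comp H K L (A : K -> L) (B : H -> K) :
  antiunitary_op A -> unitary_op B -> antiunitary_op (fun x => A (B x)).
Proof.
move=> [AL AN AS] [BL BN BS]; split=> [a x y|x|z]; first by rewrite BL AL.
  by rewrite AN BN.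
by have [y <-] := AS z; have [x <-] := BS y; exists x.
Qed.

Lemma antiunitary_comp H K L (A : K -> L) (B : H -> K) :
  antiunitary_op A -> antiunitary_op B -> unitary_op (fun x => A (B x)).
Proof.
move=> [AL AN AS] [BL BN BS]; split=> [a x y|x|z].
- by rewrite BL AL /= conjCK.
- by rewrite AN BN.
- by have [y <-] := AS z; have [x <-] := BS y; exists x.
Qed.

(** On the zero space the two notions coincide, hence the nonzero vector. *)
Lemma antiunitary_not_unitary H K (A : H -> K) (x : H) :
  x != 0 -> antiunitary_op A -> ~ unitary_op A.
Proof.
move=> x0 hA hB; have [/linE lA _ _] := hB; have [/antiE aA _ _] := hA.
have := aA.1.1.2 'i%R x; rewrite lA conjCi scaleNr => /eqP.
rewrite -subr_eq0 opprK -mulr2n -scaler_nat !scaler_eq0 pnatr_eq0 (negPf (neq0Ci _)) /=.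
by move=> /eqP/(au_eq0 (or_introl hB)) x00; rewrite x00 eqxx in x0.
Qed.

Lemma inv_exists H K (A : H -> K) : au_op A ->
  exists B : K -> H, (forall x, B (A x) = x) /\ (forall y, A (B y) = y).
Proof.
move=> hA; have [B AB] := choice (au_surj hA); exists B; split=> // x.
by apply: (au_inj hA); rewrite AB.
Qed.

Lemma unitary_inv H K (A : H -> K) (B : K -> H) : unitary_op A ->
  (forall x, B (A x) = x) -> (forall y, A (B y) = y) -> unitary_op B.
Proof.
move=> [AL AN AS] BA AB; split=> [a x y|x|y]; last by exists (A y).
  by rewrite -{1}[x]AB -{1}[y]AB -AL BA.
by rewrite -AN AB.
Qed.

Lemma antiunitary_inv H K (A : H -> K) (B : K -> H) : antiunitary_op A ->
  (forall x, B (A x) = x) -> (forall y, A (B y) = y) -> antiunitary_op B.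
Proof.
move=> [AL AN AS] BA AB; split=> [a x y|x|y]; last by exists (A y).
  by rewrite -{1}[x]AB -{1}[y]AB -{1}[a]conjCK -AL BA.
by rewrite -AN AB.
Qed.

Lemma unitary_adjoint H K (A : H -> K) (B : K -> H) : unitary_op A ->
  (forall y, A (B y) = y) -> forall x y, inner (A x) y = inner x (B y).
Proof. by move=> uA AB x y; rewrite -{1}[y]AB unitary_inner. Qed.

End Operators.

(** * Closed subspaces and projections *)

Record closed_subspace (R : realType) (H : hilbertType R) := ClosedSubspace {
  csub :> H -> Prop;
  csub_closed : closed (csub : set H);
  csub0 : csub 0;
  csubP : forall (a : R[i]) x y, csub x -> csub y -> csub (a *: x + y)
}.

Section ClosedSubspace.
Context {R : realType} {H : hilbertType R}.
Implicit Types E : closed_subspace H.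

Definition csub_pred E : {pred H} := [pred x | `[< E x >]].

Let csub_submod E : submod_closed (csub_pred E).
Proof.
split=> [|a x y]; first by apply/asboolP; exact: csub0.
by move=> /asboolP Ex /asboolP Ey; apply/asboolP; exact: csubP.
Qed.

HB.instance Definition _ E :=
  GRing.isSubmodClosed.Build R[i] H (csub_pred E) (csub_submod E).

End ClosedSubspace.

(** A type of its own, so that a closed subspace becomes a Hilbert space: Riesz on it provides the
    projection, and subrepresentations live on it. *)
Record subsp (R : realType) (H : hilbertType R) (E : closed_subspace H) := Subsp {
  subsp_val :> H;
  subspP : subsp_val \in csub_pred E
}.

HB.instance Definition _ R H E := [isSub for @subsp_val R H E].
HB.instance Definition _ R H E := [Choice of @subsp R H E by <:].
HB.instance Definition _ R H E := [SubChoice_isSubLmodule of @subsp R H E by <:].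

Section SubspHilbert.
Context {R : realType} {H : hilbertType R} {E : closed_subspace H}.
Implicit Types x y : subsp E.

Let sub_inner x y : R[i] := inner (val x) (val y).

Let sub_innerP (a : R[i]) x y z :
  sub_inner (a *: x + y) z = a * sub_inner x z + sub_inner y z.
Proof. by rewrite /sub_inner raddfD /= innerDl innerZl. Qed.

Let sub_innerC x y : sub_inner x y = Num.conj (sub_inner y x).
Proof. by rewrite /sub_inner -inner_conj. Qed.

Let sub_inner_gt0 x : x != 0 -> 0 < sub_inner x x.
Proof.
move=> x0; rewrite dnorm_gt0; apply: contra_neq x0 => x0.
by apply: val_inj; rewrite x0 raddf0.
Qed.

Let sub_inner_complete (F : set_system (subsp E)) : ProperFilter F ->
  (forall e : R[i], 0 < e ->
     exists x, F [set y | sub_inner (x - y) (x - y) < e]) ->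
  exists l, forall e : R[i], 0 < e -> F [set y | sub_inner (l - y) (l - y) < e].
Proof.
move=> PF Fc; have [|l Fl] := @hilbert_complete R H (fmap (val : subsp E -> H) F) _.
  move=> e /Fc[x Fx]; exists (val x).
  by apply: (@filterS _ F _ _ _ _ Fx) => y /=; rewrite /sub_inner raddfB.
have El : E l.
  apply: csub_closed => B /nbhs_ballP[e /= e0 lB].
  have Fle : F [set y | inner (l - val y) (l - val y) < e ^+ 2].
    by apply: Fl; exact: exprn_gt0.
  have [y ly] := @filter_ex _ F PF _ Fle.
  exists (val y); split; first exact/asboolP/(subspP y).
  by apply: lB; rewrite -ball_inner.
exists (Subsp (asboolT El)) => e /Fl Fle.
by apply: (@filterS _ F _ _ _ _ Fle) => y /=; rewrite /sub_inner raddfB.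
Qed.

HB.instance Definition _ := @Lmodule_isHilbert.Build R (subsp E)
  sub_inner sub_innerP sub_innerC sub_inner_gt0 sub_inner_complete.

Lemma subsp_innerE x y : inner x y = inner (val x) (val y).
Proof. by []. Qed.

Lemma subsp_in x : E (val x).
Proof. exact/asboolP/(subspP x). Qed.

Lemma subsp_normE x : `|x| = `|val x|.
Proof. exact: norm_eq_inner. Qed.

Lemma subspD x y : val (x + y) = val x + val y.
Proof. exact: raddfD. Qed.

Lemma subspZ (a : R[i]) x : val (a *: x) = a *: val x.
Proof. exact: linearZ. Qed.

Lemma subsp0 : val (0 : subsp E) = 0.
Proof. exact: raddf0. Qed.

(** The projection of [x] is the Riesz vector of the functional [<., x>] restricted to the
    subspace. *)
Lemma subsp_proj_exists (x : H) :
  exists y : subsp E, forall z : subsp E, inner x (val z) = inner (val y) (val z).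
Proof.
have [|y yP] := @riesz_exists R (subsp E) (fun z => inner (val z) x).
  split=> [a u v|]; first by rewrite subspD subspZ innerDl innerZl.
  exists `|x| => z; rewrite mulrC subsp_normE; exact: ler_inner.
by exists y => z; rewrite inner_conj yP -inner_conj.
Qed.

End SubspHilbert.

Section Projection.
Context {R : realType} {H : hilbertType R} (E : closed_subspace H).

Definition sproj (x : H) : subsp E := projT1 (cid (@subsp_proj_exists R H E x)).

Definition proj (x : H) : H := val (sproj x).

Lemma proj_in x : E (proj x).
Proof. exact: subsp_in. Qed.

Lemma proj_inner x z : E z -> inner (proj x) z = inner x z.
Proof.
move=> Ez; rewrite /proj /sproj; case: cid => y /= yP.
by rewrite -(yP (Subsp (asboolT Ez))).
Qed.

Lemma proj_uniq x y : E y -> (forall z, E z -> inner (x - y) z = 0) -> proj x = y.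
Proof.
move=> Ey xy; apply/eqP; rewrite -subr_eq0; apply/eqP/inner_eq0.
have Ez : E (proj x - y).
  by rewrite addrC -scaleN1r; apply: csubP => //; exact: proj_in.
by rewrite innerDl innerNl proj_inner// -innerNl -innerDl xy.
Qed.

Lemma proj_id x : E x -> proj x = x.
Proof. by move=> Ex; apply: proj_uniq => // z _; rewrite subrr inner0l. Qed.

Lemma proj_proj x : proj (proj x) = proj x.
Proof. exact/proj_id/proj_in. Qed.

Lemma proj_adj x y : inner (proj x) y = inner x (proj y).
Proof.
by rewrite [LHS]inner_conj -(proj_inner _ (proj_in x)) -inner_conj proj_inner//;
  exact: proj_in.
Qed.

Lemma proj_linear : linear proj.
Proof.
move=> a x y; apply: proj_uniq => [|z Ez].
  by apply: csubP; exact: proj_in.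
by rewrite !innerE !proj_inner//; ring.
Qed.

Lemma sproj_linear : linear sproj.
Proof.
move=> a x y; apply: val_inj; rewrite -[LHS]/(proj _) proj_linear.
by rewrite subspD subspZ.
Qed.

Lemma proj_norm x : `|proj x| <= `|x|.
Proof.
have [->|p0] := eqVneq (proj x) 0; first by rewrite normr0.
have p1 : 0 < `|proj x| by rewrite normr_gt0.
rewrite -(ler_pM2r p1) -expr2 -inner_norm proj_inner; last exact: proj_in.
apply: le_trans (ler_inner _ _).
by rewrite ger0_norm// -proj_inner ?inner_norm ?exprn_ge0//; exact: proj_in.
Qed.

Lemma proj_bounded : bounded_linear proj.
Proof. by split; [exact: proj_linear|exists 1 => x; rewrite mul1r proj_norm]. Qed.

Lemma sproj_bounded : bounded_linear sproj.
Proof.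
split; first exact: sproj_linear.
by exists 1 => x; rewrite mul1r subsp_normE proj_norm.
Qed.

Lemma val_bounded : bounded_linear (val : subsp E -> H).
Proof.
split; first by move=> a x y; rewrite subspD subspZ.
by exists 1 => x; rewrite mul1r subsp_normE.
Qed.

Lemma proj_val (x : subsp E) : proj (val x) = val x.
Proof. exact/proj_id/subsp_in. Qed.

Lemma sproj_val (x : subsp E) : sproj (val x) = x.
Proof. by apply: val_inj; exact: proj_val. Qed.

(** [S] preserves orthogonality and maps [E] onto itself, so it also preserves the orthogonal
    complement. *)
Lemma proj_comm_au (S : H -> H) : au_op S -> (forall x, E (S x) <-> E x) ->
  forall x, proj (S x) = S (proj x).
Proof.
move=> hS ES x; apply: proj_uniq => [|z Ez]; first exact/ES/proj_in.
have [z' zz'] := au_surj hS z; rewrite -zz' in Ez *.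
rewrite -(auN hS) -(auD hS); apply: au_inner_eq0 => //.
by rewrite innerDl innerNl proj_inner ?subrr//; exact/ES.
Qed.

Lemma proj_comm_sa (A : H -> H) : linear A -> adjoint_of A A ->
  (forall x, E x -> E (A x)) -> forall x, proj (A x) = A (proj x).
Proof.
move=> AL AA EA x; apply: proj_uniq => [|z Ez]; first exact/EA/proj_in.
rewrite innerDl innerNl !AA proj_inner ?subrr//; exact: EA.
Qed.

End Projection.

Section Kernel.
Context {R : realType} {H K : hilbertType R} (A : H -> K).
Hypothesis bA : bounded_linear A.

Let ker_closed : closed [set x | A x = 0].
Proof.
have [M M0 AM] := bounded_linearP bA; have AE := linE bA.1.
move=> x clx /=; apply/eqP; rewrite -normr_eq0; apply: contraT => Ax0.
have Axp : 0 < `|A x| by rewrite lt_def Ax0 normr_ge0.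
have [|y [/= Ay0]] := clx (ball x (`|A x| / M)).
  by apply: nbhsx_ballx; rewrite divr_gt0.
rewrite -ball_normE /= ltr_pdivlMr// mulrC => lt.
have := le_lt_trans (AM (x - y)) lt.
by rewrite !AE Ay0 oppr0 addr0 ltxx.
Qed.

(** Left transparent so that [kernelE] holds by computation. *)
Definition kernel : closed_subspace H.
Proof.
apply: (@ClosedSubspace R H [set x | A x = 0]) => //=.
- by rewrite (linE bA.1).
- by move=> a x y Ax Ay; rewrite bA.1 Ax Ay scaler0 addr0.
Defined.

Lemma kernelE x : kernel x <-> A x = 0.
Proof. by []. Qed.

End Kernel.

(** * Absolute value of an operator *)

Section SquareRootSequence.
Context {R : realType}.

(* Newton-type iteration for [1 - sqrt (1 - t)] at [t = 1]. *)
Fixpoint rootseq n : R := if n is m.+1 then (1 + rootseq m ^+ 2) / 2 else 0.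

Lemma rootseq_bound n : 0 <= rootseq n <= 1.
Proof.
elim: n => [|n /andP[h0 h1]] /=; first by rewrite lexx ler01.
by apply/andP; split; [rewrite divr_ge0// addr_ge0// exprn_ge0|rewrite ler_pdivrMr//; nra].
Qed.

Lemma rootseqS n : rootseq n <= rootseq n.+1.
Proof. by rewrite /= ler_pdivlMr//; have := sqr_ge0 (1 - rootseq n); nra. Qed.

(** The gap [q = 1 - rootseq] evolves by [q - q^2 / 2]; the differential equation [q' = - q^2 / 2]
    with [q(0) = 1] has the solution [2 / (t + 2)]. *)
Lemma rootseq_rate n : 1 - rootseq n <= 2 / n.+2%:R.
Proof.
elim: n => [|n]; first by rewrite subr0 divff.
have /andP[] := rootseq_bound n; have := rootseqS n => /=; move: (rootseq n) => p _ p0 p1.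
rewrite -[n.+3]addn1 natrD; have : 2 <= n.+2%:R :> R by rewrite ler_nat.
move: n.+2%:R => t t2; have t0 : 0 < t by lra.
rewrite !ler_pdivlMr ?ltr_wpDr//; move=> h.
have : (1 - p) * t <= 2 := h; nra.
Qed.

Lemma rootseq_small (c e : R[i]) : 0 <= c -> 0 < e ->
  exists n, (1 - rootseq n)%:C * c < e.
Proof.
move=> c0 e0.
have cE : (complex.Re c)%:C = c by apply/RRe_real/ger0_real.
have eE : (complex.Re e)%:C = e by apply/RRe_real/ger0_real/ltW.
move: c0 e0; rewrite -cE -eE ler0c -[0 < _]/(0%:C < _) ltcR; move: (complex.Re c) (complex.Re e).
move=> {cE eE} c' e' c0 e0.
have [n nP] : exists n : nat, 2 * c' / e' < n%:R.
  by exists (Num.bound (2 * c' / e')); apply: archi_boundP; rewrite divr_ge0// ?mulr_ge0// ltW.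
exists n; rewrite -rmorphM ltcR.
apply: le_lt_trans (ler_wpM2r c0 (rootseq_rate n)) _.
rewrite mulrAC ltr_pdivrMr ?ltr0n// -ltr_pdivrMl//.
rewrite mulrC; apply: lt_trans nP _.
by rewrite ltr_nat leqW.
Qed.

(** Every identity for the limit operator is obtained by bounding the norm [r] of its defect in this
    way. *)
Lemma rootseq_eq0 (c r : R[i]) : 0 <= c -> 0 <= r ->
  (forall n, r <= (1 - rootseq n)%:C * c) -> r = 0.
Proof.
move=> c0 r0 h; apply/eqP; apply: contraT => rn0.
have rp : 0 < r by rewrite lt_def rn0.
by have [n /(le_lt_trans (h n))] := rootseq_small c0 rp; rewrite ltxx.
Qed.

End SquareRootSequence.

Section Complete.
Context {R : realType} {H : hilbertType R}.

Lemma cauchy_sequence_limit (v : nat -> H) (d : nat -> R[i]) :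
  (forall n m, (n <= m)%N -> `|v m - v n| <= d n) ->
  (forall e, 0 < e -> exists n, d n < e) ->
  exists l, forall n, `|l - v n| <= d n.
Proof.
move=> vd ds; have : cauchy (v @ \oo).
  apply/cauchyP => e /ds[n dn]; exists (v n); exists n => // m /= nm.
  by rewrite -ball_normE /= distrC; exact: le_lt_trans (vd _ _ nm) dn.
move=> /cauchy_cvg/cvg_ex[l vl]; exists l => n.
have dr : d n \is Num.real by apply: ger0_real; apply: le_trans (vd n n _).
rewrite real_leNgt// ?ger0_real//; apply/negP => lt.
have := vl (ball l (`|l - v n| - d n)) => /=.
case; first by apply: nbhsx_ballx; rewrite subr_gt0.
move=> N _ /(_ (maxn N n)) /=; rewrite leq_maxl => /(_ isT).
rewrite -ball_normE /= ltrBrDr => h.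
have := le_lt_trans (lerD (lexx _) (vd _ _ (leq_maxr N n))) h.
move=> /(le_lt_trans (ler_distD (v (maxn N n)) l (v n))).
by rewrite ltxx.
Qed.

End Complete.

Section ContractionFix.
Context {R : realType} {H : hilbertType R} (K : H -> H).
Hypotheses (KL : linear K) (K1 : forall x, `|K x| <= `|x|).

Local Notation p := (@rootseq R).

(** A polynomial in [K] with nonnegative coefficients; substituting 1 for [K] gives [rootseq n], so
    for a contraction the scalar sequence dominates norms and increments. *)
Fixpoint rootop n (x : H) : H :=
  if n is m.+1 then 2^-1 *: (K x + rootop m (rootop m x)) else 0.

Let rootop_linear n : linear (rootop n).
Proof.
elim: n => [|n IH] a x y /=; first by rewrite scaler0 addr0.
by rewrite KL !IH; vec.
Qed.

Let half_le (u v : H) (a b : R) : `|u| <= a%:C * `|v| -> forall w : H, `|w| <= b%:C * `|v| ->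
  `|2^-1 *: (u + w)| <= ((a + b) / 2)%:C * `|v|.
Proof.
move=> ua w wb; rewrite normrZ normfV normr_nat rmorphM fmorphV rmorph_nat rmorphD /=.
rewrite [_ * 2^-1]mulrC -mulrA ler_pM2l ?invr_gt0// mulrDl.
by apply: le_trans (ler_normD _ _) _; exact: lerD.
Qed.

Let p0 n : 0 <= (p n)%:C :> R[i].
Proof. by rewrite ler0c; have /andP[] := @rootseq_bound R n. Qed.

Let rootop_norm n x : `|rootop n x| <= (p n)%:C * `|x|.
Proof.
elim: n x => [|n IH] x /=; first by rewrite normr0 mul0r.
apply: half_le; first by rewrite mul1r.
rewrite expr2 rmorphM -mulrA; apply: le_trans (IH _) _.
by rewrite ler_wpM2l.
Qed.

Let rootop_norm1 n x : `|rootop n x| <= `|x|.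
Proof.
apply: le_trans (rootop_norm n x) _; rewrite ler_piMl//.
by rewrite -(rmorph1 (real_complex R)) lecR; have /andP[] := @rootseq_bound R n.
Qed.

Let rootop_step n x :
  `|rootop n.+1 x - rootop n x| <= (p n.+1 - p n)%:C * `|x|.
Proof.
elim: n x => [|n IH] x.
  have -> : rootop 1 x - rootop 0 x = 2^-1 *: (K x + 0) by rewrite /= subr0.
  by rewrite subr0; apply: half_le; rewrite ?normr0 ?mul0r ?mul1r// expr0n mul0r.
(* [Z^2 - Y^2 = Z (Z - Y) + (Z - Y) Y] without any commutation; the scalar increments factor
   alike. *)
have -> : rootop n.+2 x - rootop n.+1 x =
   2^-1 *: (rootop n.+1 (rootop n.+1 x - rootop n x) +
            (rootop n.+1 (rootop n x) - rootop n (rootop n x))).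
  have E1 : rootop n.+2 x = 2^-1 *: (K x + rootop n.+1 (rootop n.+1 x)) by [].
  have E2 : rootop n.+1 x = 2^-1 *: (K x + rootop n (rootop n x)) by [].
  have L := linE (rootop_linear n.+1).
  by rewrite L.1.1.1 L.1.2 E1 [X in _ - X = _]E2; vec.
have -> : p n.+2 - p n.+1 = (p n.+1 * (p n.+1 - p n) + (p n.+1 - p n) * p n) / 2.
  by rewrite [p n.+2]/= -/(p n.+1) [in X in _ - X]/=; field.
have d0 : 0 <= (p n.+1 - p n)%:C :> R[i] by rewrite ler0c subr_ge0 rootseqS.
apply: half_le; rewrite rmorphM -mulrA.
  by apply: le_trans (rootop_norm _ _) _; rewrite ler_wpM2l.
by apply: le_trans (IH _) _; rewrite ler_wpM2l// rootop_norm.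
Qed.

Let rootop_dist n m x : (n <= m)%N ->
  `|rootop m x - rootop n x| <= (p m - p n)%:C * `|x|.
Proof.
move=> /subnK<-; elim: (m - n)%N => [|k IH]; first by rewrite !add0n !subrr normr0 mul0r.
rewrite addSn.
have -> : rootop (k + n).+1 x - rootop n x =
  (rootop (k + n).+1 x - rootop (k + n) x) + (rootop (k + n) x - rootop n x).
  by rewrite addrA subrK.
have -> : p (k + n).+1 - p n = (p (k + n).+1 - p (k + n)) + (p (k + n) - p n).
  by rewrite addrA subrK.
rewrite rmorphD mulrDl; apply: le_trans (ler_normD _ _) _.
by apply: lerD.
Qed.

(** [2 Y = K + Y^2] says [(1 - Y)^2 = 1 - K]: [1 - Y] is a square root of [1 - K]. *)
Lemma contraction_fix : exists Y : H -> H,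
  [/\ linear Y, forall x, `|Y x| <= `|x|,
      forall x, 2 *: Y x = K x + Y (Y x),
      adjoint_of K K -> adjoint_of Y Y
    & forall S : H -> H, real_bounded S -> (forall x, S (K x) = K (S x)) ->
        forall x, S (Y x) = Y (S x)].
Proof.
have ex x : exists l, forall n, `|l - rootop n x| <= (1 - p n)%:C * `|x|.
  apply: (@cauchy_sequence_limit R H (rootop ^~ x)) => [n m nm|e e0].
    apply: le_trans (rootop_dist x nm) _; rewrite ler_wpM2r// lecR lerD2r.
    by have /andP[] := @rootseq_bound R m.
  exact: rootseq_small.
have q0 n : 0 <= (1 - p n)%:C :> R[i].
  by rewrite ler0c subr_ge0; have /andP[] := @rootseq_bound R n.
have qS n : (1 - p n.+1)%:C <= (1 - p n)%:C :> R[i].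
  by rewrite lecR lerD2l lerN2 rootseqS.
have [Y YP] := choice ex; exists Y.
have Y1 x : `|Y x| <= `|x|.
  rewrite -[Y x](subrK (rootop 0 x)) addr0; apply: le_trans (YP x 0%N) _.
  by rewrite subr0 mul1r.
have YL : linear Y.
  move=> a x y; apply/eqP; rewrite -subr_eq0 -normr_eq0; apply/eqP.
  apply: (@rootseq_eq0 R (`|a *: x + y| + `|a| * `|x| + `|y|)) => [||n]; [|exact: normr_ge0|].
    by rewrite !addr_ge0// mulr_ge0.
  have -> : Y (a *: x + y) - (a *: Y x + Y y) =
    (Y (a *: x + y) - rootop n (a *: x + y)) +
    ((- a) *: (Y x - rootop n x) + - (Y y - rootop n y)).
    by rewrite rootop_linear; vec.
  rewrite -[X in _ <= _ * X]addrA [leRHS]mulrDr.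
  apply: le_trans (ler_normD _ _) _; apply: lerD => //.
  rewrite [leRHS]mulrDr; apply: le_trans (ler_normD _ _) _; apply: lerD; last by rewrite normrN.
  by rewrite normrZ normrN mulrCA ler_wpM2l.
split=> // [x|Ks x y|S [SD SR [M M0 SM]] SK x].
- apply/eqP; rewrite -subr_eq0 -normr_eq0; apply/eqP.
  apply: (@rootseq_eq0 R (2 * `|x| + (`|x| + `|x|))) => [||n]; [|exact: normr_ge0|].
    by rewrite !addr_ge0// mulr_ge0.
  have -> : 2 *: Y x - (K x + Y (Y x)) = 2 *: (Y x - rootop n.+1 x) +
      (- (Y (Y x) - rootop n (Y x)) + - rootop n (Y x - rootop n x)).
    rewrite /= (linE (rootop_linear n)).1.1.1 (linE (rootop_linear n)).1.2.
    by apply: inner_inj => z; rewrite !innerE; field.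
  rewrite [leRHS]mulrDr; apply: le_trans (ler_normD _ _) _; apply: lerD.
    rewrite normrZ normr_nat mulrCA ler_pM2l//.
    by apply: le_trans (YP _ _) _; rewrite ler_wpM2r.
  rewrite [leRHS]mulrDr; apply: le_trans (ler_normD _ _) _; rewrite !normrN; apply: lerD.
    by apply: le_trans (YP _ _) _; rewrite ler_wpM2l.
  exact: le_trans (rootop_norm1 _ _) (YP _ _).
- have Yn n u v : inner (rootop n u) v = inner u (rootop n v).
    elim: n u v => [|n IH] u v /=; first by rewrite inner0l inner0r.
    by rewrite innerZl innerZr half_conj innerDl innerDr Ks !IH.
  apply/eqP; rewrite -subr_eq0 -normr_eq0; apply/eqP.
  apply: (@rootseq_eq0 R (`|x| * `|y| + `|x| * `|y|)) => [||n]; [|exact: normr_ge0|].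
    by rewrite addr_ge0// mulr_ge0.
  have -> : inner (Y x) y - inner x (Y y) =
     inner (Y x - rootop n x) y - inner x (Y y - rootop n y).
    by rewrite innerDl innerDr innerNl innerNr Yn; ring.
  apply: le_trans (ler_normB _ _) _; rewrite [leRHS]mulrDr; apply: lerD.
    by apply: le_trans (ler_inner _ _) _; rewrite mulrA ler_wpM2r.
  by apply: le_trans (ler_inner _ _) _; rewrite mulrCA ler_wpM2l.
- have S0 : S 0 = 0 by apply: (@addrI _ (S 0)); rewrite -SD !addr0.
  have SN z : S (- z) = - S z.
    by apply/eqP; rewrite -subr_eq0 opprK -SD addNr S0.
  have h2 : 2^-1 = (2^-1 : R)%:C :> R[i] by rewrite fmorphV rmorph_nat.
  have Sn n z : S (rootop n z) = rootop n (S z).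
    elim: n z => [|n IH] z //=.
    by rewrite h2 SR SD SK !IH.
  apply/eqP; rewrite -subr_eq0 -normr_eq0; apply/eqP.
  apply: (@rootseq_eq0 R (M * `|x| + `|S x|)) => [||n]; [|exact: normr_ge0|].
    by rewrite addr_ge0// mulr_ge0// ltW.
  have -> : S (Y x) - Y (S x) = S (Y x - rootop n x) - (Y (S x) - rootop n (S x)).
    by rewrite SD SN Sn; vec.
  apply: le_trans (ler_normB _ _) _; rewrite [leRHS]mulrDr; apply: lerD => //.
  by apply: le_trans (SM _) _; rewrite mulrCA ler_pM2l.
Qed.

End ContractionFix.

Section AbsoluteValue.
Context {R : realType} {H : hilbertType R}.

Lemma abs_exists (T Ts : H -> H) : bounded_linear T -> bounded_linear Ts ->
  adjoint_of T Ts ->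
  exists N : H -> H, [/\ bounded_linear N, adjoint_of N N,
    forall x, N (N x) = Ts (T x), forall x, inner (N x) x = 0 -> N x = 0
  & forall S : H -> H, real_bounded S ->
      (forall x, S (Ts (T x)) = Ts (T (S x))) -> forall x, S (N x) = N (S x)].
Proof.
move=> bT bTs TTs.
have [M1 M10 TM] := bounded_linearP bT; have [M2 M20 TsM] := bounded_linearP bTs.
pose M := M1 + M2; have M0 : 0 < M by rewrite addr_gt0.
have Mr : M = (complex.Re M)%:C by rewrite RRe_real// ger0_real// ltW.
have Mn0 : M != 0 by rewrite gt_eqF.
have MC : Num.conj M = M by rewrite Mr real_conj.
have MVC : Num.conj (M^-1) = M^-1 by rewrite fmorphV /= MC.
(* [M] dominates the bound of [Ts], which makes [K] a contraction; then [(1 - Y)^2 = M^-2 Ts T], so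
   [M (1 - Y)] is the absolute value. *)
pose K x := x - (M^-1 ^+ 2) *: Ts (T x).
have KL : linear K by move=> a x y; rewrite /K bT.1 bTs.1; vec.
have TsTM x : `|Ts (T x)| <= M * `|T x|.
  apply: le_trans (TsM _) _; rewrite ler_wpM2r// lerDr ltW//.
have K1 x : `|K x| <= `|x|.
  rewrite -(@ler_pXn2r _ 2) ?nnegrE// -!inner_norm.
  have TT : inner (Ts (T x)) x = inner (T x) (T x) by rewrite (adjoint_sym TTs).
  have -> : inner (K x) (K x) = inner x x - M^-1 ^+ 2 * inner (T x) (T x) -
      (M^-1 ^+ 2 * (inner (T x) (T x) - M^-1 ^+ 2 * inner (Ts (T x)) (Ts (T x)))).
    rewrite /K !(innerE, innerrE) rmorphXn /= MVC -TTs TT; ring.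
  have T0 : 0 <= M^-1 ^+ 2 :> R[i] by rewrite exprn_ge0// invr_ge0 ltW.
  have h1 : 0 <= M^-1 ^+ 2 * inner (T x) (T x) by rewrite mulr_ge0// dnorm_ge0.
  rewrite -addrA gerDl -opprD oppr_le0 addr_ge0// mulr_ge0// subr_ge0.
  rewrite exprVn ler_pdivrMl ?exprn_gt0// !inner_norm -exprMn.
  by rewrite ler_pXn2r ?nnegrE ?mulr_ge0// ltW.
have Ks : adjoint_of K K.
  move=> x y; rewrite /K !(innerE, innerrE) rmorphXn /= MVC -TTs.
  by rewrite (adjoint_sym TTs).
have [Y [YL Y1 YK /(_ Ks) Ys YS]] := contraction_fix KL K1.
have YE := linE YL.
exists (fun x => M *: (x - Y x)); split.
- apply: bounded_linearZ; apply: bounded_linearB; first exact: bounded_linear_id.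
  by split=> //; exists 1 => x; rewrite mul1r.
- by move=> x y; rewrite innerZl innerZr MC !(innerE, innerrE) Ys.
- move=> x; rewrite !YE.
  have -> : Y (Y x) = 2 *: Y x - K x by rewrite YK; vec.
  by rewrite /K; apply: inner_inj => z; rewrite !innerE; field.
(* Instead of positivity, [|Y x| <= |x|] is used: if [<x, x> = <Y x, x>], then
   [|Y x - x|^2 = |Y x|^2 - |x|^2 <= 0]. *)
- move=> x /eqP; rewrite innerZl mulf_eq0 (negPf Mn0) /= innerDl innerNl subr_eq0.
  move=> /eqP xY; suff -> : Y x = x by rewrite subrr scaler0.
  apply/eqP; rewrite -subr_eq0; apply/eqP/inner_eq0/eqP.
  rewrite eq_le dnorm_ge0 andbT !(innerE, innerrE) [inner x (Y x)]inner_conj -xY.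
  rewrite -[in Num.conj _]inner_conj subrr subr0 subr_le0.
  by rewrite !inner_norm ler_pXn2r ?nnegrE.
- move=> S bS SC x; have [SD SR _] := bS.
  have S0 : S 0 = 0 by apply: (@addrI _ (S 0)); rewrite -SD !addr0.
  have SN z : S (- z) = - S z.
    by apply/eqP; rewrite -subr_eq0 opprK -SD addNr S0.
  rewrite [in LHS]Mr SR SD SN YS -?Mr// => z.
  rewrite /K SD SN; have -> : M^-1 ^+ 2 = ((complex.Re M)^-1 ^+ 2)%:C.
    by rewrite rmorphXn fmorphV /= -Mr.
  by rewrite SR SC.
Qed.

End AbsoluteValue.

(** * Commutants and Schur's lemma *)

Section AuRep.
Context {R : realType} {G : groupType} {S : {pred G}} {H : hilbertType R}.
Variable U : G -> H -> H.

(** The common part of unitary representations of [G1] and antiunitary ones of [G], so that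
    commutants and Schur's lemma are treated once. *)
Definition au_rep := forall g, g \in S ->
  [/\ au_op (U g), (g^-1)%g \in S, forall x, U (g^-1)%g (U g x) = x
    & forall x, U g (U (g^-1)%g x) = x].

Lemma rep_commutantP (A : H -> H) : rep_commutant S U A <->
  bounded_linear A /\ forall g, g \in S -> forall x, A (U g x) = U g (A x).
Proof.
split=> [[bA AU]|[bA AU]]; split=> //.
  move=> g gS x; have /(congr1 (@^~ x)) := AU (U g) (imageP U (gS : [set` S] g)).
  by [].
by move=> _ [g gS <-]; apply/funext => x /=; exact: AU.
Qed.

Hypothesis auU : au_rep.

Local Notation D := (rep_commutant S U).

Lemma comm_bounded A : D A -> bounded_linear A.
Proof. by move=> /rep_commutantP[]. Qed.

Lemma comm_U A g x : D A -> g \in S -> A (U g x) = U g (A x).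
Proof. by move=> /rep_commutantP[_ AU] gS; exact: AU. Qed.

Lemma comm_id : D idfun.
Proof. by apply/rep_commutantP; split=> //; exact: bounded_linear_id. Qed.

Lemma comm_comp A B : D A -> D B -> D (fun x => A (B x)).
Proof.
move=> dA dB; apply/rep_commutantP; split=> [|g gS x].
  by apply: bounded_linear_comp; exact: comm_bounded.
by rewrite (comm_U _ dB)// (comm_U _ dA).
Qed.

Lemma commD A B : D A -> D B -> D (fun x => A x + B x).
Proof.
move=> dA dB; apply/rep_commutantP; split=> [|g gS x].
  by apply: bounded_linearD; exact: comm_bounded.
by have [hg _ _ _] := auU gS; rewrite (comm_U _ dB)// (comm_U _ dA)// (auD hg).
Qed.

Lemma comm_realZ (a : R) A : D A -> D (fun x => a%:C *: A x).
Proof.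
move=> dA; apply/rep_commutantP; split=> [|g gS x].
  by apply: bounded_linearZ; exact: comm_bounded.
by have [hg _ _ _] := auU gS; rewrite (comm_U _ dA)// (auR hg).
Qed.

Lemma commN A : D A -> D (fun x => - A x).
Proof.
move=> dA; apply/rep_commutantP; split=> [|g gS x].
  by apply: bounded_linearN; exact: comm_bounded.
by have [hg _ _ _] := auU gS; rewrite (comm_U _ dA)// (auN hg).
Qed.

Lemma commB A B : D A -> D B -> D (fun x => A x - B x).
Proof. by move=> dA dB; apply: commD => //; exact: commN. Qed.

Lemma comm_real (a : R) : D (fun x => a%:C *: x).
Proof. exact: comm_realZ comm_id. Qed.

Lemma comm_adjoint A B : D A -> bounded_linear B -> adjoint_of A B -> D B.
Proof.
move=> dA bB AB; apply/rep_commutantP; split=> // g gS x.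
have [hg gVS UVK UK] := auU gS; have BA := adjoint_sym AB.
apply: inner_inj => y; rewrite BA -[A y]UK -(comm_U _ dA)// -{2}[y]UK.
(* An antiunitary operator swaps the arguments of the inner product, which turns the adjoint
   relation around. *)
case: hg => hg; first by rewrite !(unitary_inner hg) BA.
by rewrite !(antiunitary_inner hg) AB.
Qed.

Lemma comm_adjoint_exists A : D A -> exists2 B, D B & adjoint_of A B.
Proof.
move=> dA; have [B bB AB] := adjoint_exists (comm_bounded dA).
by exists B => //; exact: comm_adjoint dA bB AB.
Qed.

Lemma proj_comm (E : closed_subspace H) :
  (forall g, g \in S -> forall x, E x -> E (U g x)) -> D (proj E).
Proof.
move=> EU; apply/rep_commutantP; split=> [|g gS x]; first exact: proj_bounded.
have [hg gVS UVK _] := auU gS.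
by apply: proj_comm_au => // z; split=> [/(EU _ gVS)|/(EU _ gS)//]; rewrite UVK.
Qed.

(** The projection onto an invariant closed subspace lies in the commutant. *)
Lemma irreducible_of_commutant : (exists x : H, x != 0) ->
  (forall P, D P -> adjoint_of P P -> (forall x, P (P x) = P x) ->
     (forall x, P x = 0) \/ (forall x, P x = x)) ->
  irreducible_rep S U.
Proof.
move=> H0 hP; split=> // E0 Ec Ez El EU.
pose E := ClosedSubspace Ec Ez El.
have [||x|P0|P1] := hP (proj E).
- exact: proj_comm.
- by move=> x y; exact: proj_adj.
- exact: proj_proj.
- left; apply/seteqP; split=> [x Ex|_ ->//] /=.
  by rewrite -(P0 x); apply/esym/(@proj_id _ _ E).
- by right; apply/seteqP; split=> // x _; rewrite -(P1 x); exact: (@proj_in _ _ E).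
Qed.

Hypothesis irrU : irreducible_rep S U.

Lemma irreducible_kernel A : D A -> (forall x, A x = 0 -> x = 0) \/ (forall x, A x = 0).
Proof.
move=> dA; have bA := comm_bounded dA; have [_ hE] := irrU.
have [|E0|ET] := hE [set x | A x = 0] (@csub_closed _ _ (kernel bA)) (csub0 (kernel bA))
  (@csubP _ _ (kernel bA)).
- move=> g gS x /= Ax; have [hg _ _ _] := auU gS.
  by rewrite (comm_U _ dA)// Ax (au0 hg).
- by left => x Ax; have : [set x | A x = 0] x by []; rewrite E0.
- by right => x; have : setT x by []; rewrite -ET.
Qed.

Lemma schur_selfadjoint A : D A -> adjoint_of A A ->
  exists a : R, forall x, A x = a%:C *: x.
Proof.
move=> dA AA; have [[x0 x00] _] := irrU.
have x0n : inner x0 x0 != 0 by rewrite dnorm_eq0.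
(* The only possible scalar. Subtracting it gives [<B x0, x0> = 0], and a single zero [B x0 = 0]
   suffices because kernels are trivial or everything. *)
pose lam := inner (A x0) x0 / inner x0 x0.
have lamE : lam = (complex.Re lam)%:C.
  apply/esym/RRe_real/CrealP; rewrite rmorphM fmorphV /=.
  by rewrite -!inner_conj -AA.
exists (complex.Re lam); pose B x := A x - (complex.Re lam)%:C *: x.
have dB : D B by apply: commB => //; exact: comm_real.
have BB : adjoint_of B B.
  by move=> x y; rewrite /B !(innerE, innerrE) AA real_conj.
have bB := comm_bounded dB.
have Bx0 : inner (B x0) x0 = 0.
  by rewrite /B innerDl innerNl innerZl -lamE mulfVK ?subrr.
suff Bx00 : B x0 = 0.
  have [/(_ _ Bx00)/eqP|B0 x] := irreducible_kernel dB; first by rewrite (negPf x00).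
  by apply/eqP; rewrite -subr_eq0; apply/eqP/B0.
move: B dB BB bB Bx0 => B dB BB bB Bx0.
have [N [bN NN N2 N0 NS]] := abs_exists bB bB BB.
have dN : D N.
  apply/rep_commutantP; split=> // g gS x; have [hg _ _ _] := auU gS.
  by apply/esym/NS => [|z]; [exact: au_real|rewrite !(comm_U _ dB)].
have NB x : N (B x) = B (N x) by apply/esym/NS => //; exact: bounded_linear_real.
(* [(N - B) (N + B) = 0], so [N = - B] or [N = B]; either way [<N x0, x0> = 0], and [N0] applies. *)
have [h|h] := irreducible_kernel (commB dN dB).
  have NBx x : N x = - B x.
    apply/eqP; rewrite -subr_eq0 opprK; apply/eqP/h.
    by rewrite !(linE bN.1) !(linE bB.1) N2 NB; vec.
  have : N x0 = 0 by apply: N0; rewrite NBx innerNl Bx0 oppr0.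
  by rewrite NBx => /eqP; rewrite oppr_eq0 => /eqP.
have NBx x : N x = B x by apply/eqP; rewrite -subr_eq0 h.
by rewrite -NBx; apply: N0; rewrite NBx.
Qed.

End AuRep.

Arguments au_rep {R G} S {H} U.

Section Schur.
Context {R : realType} {G : groupType} {S : {pred G}} {H : hilbertType R}.
Variable U : G -> H -> H.
Hypotheses (auU : au_rep S U) (uU : forall g, g \in S -> unitary_op (U g)).

Local Notation D := (rep_commutant S U).

Lemma commZ (a : R[i]) A : D A -> D (fun x => a *: A x).
Proof.
move=> dA; apply/rep_commutantP; split=> [|g gS x].
  by apply: bounded_linearZ; exact: comm_bounded dA.
by rewrite (comm_U _ dA)//; have [L _ _] := uU gS; rewrite (linE L).
Qed.

Lemma comm_scale (a : R[i]) : D (fun x => a *: x).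
Proof. exact: commZ (comm_id _). Qed.

Lemma schur A : irreducible_rep S U -> D A -> exists a : R[i], forall x, A x = a *: x.
Proof.
move=> irrU dA; have [B dB AB] := comm_adjoint_exists auU dA.
have BA := adjoint_sym AB.
(* Self-adjoint real and imaginary parts of [A]. *)
have dP : D (fun x => 2^-1 *: (A x + B x)) by apply: commZ; exact: commD.
have dQ : D (fun x => (- 'i%R / 2) *: (A x - B x)) by apply: commZ; exact: commB.
have [|a aP] := schur_selfadjoint auU irrU dP.
  by move=> x y; rewrite !(innerE, innerrE) half_conj AB BA [inner x (A y) + _]addrC.
have [|b bP] := schur_selfadjoint auU irrU dQ.
  have hc : Num.conj (- 'i%R / 2 : R[i]) = 'i%R / 2.
    by rewrite rmorphM rmorphN /= conjCi half_conj opprK.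
  move=> x y; rewrite !(innerE, innerrE) hc AB BA.
  by ring.
exists (a%:C + 'i%R * b%:C) => x; rewrite scalerDl -scalerA -aP -bP.
by apply: inner_inj => z; rewrite !innerE; field: (@imag_sqr R).
Qed.

End Schur.

Section SchurIntertwiner.
Context {R : realType} {G : groupType} {S : {pred G}} {H K : hilbertType R}.
Variables (U : G -> H -> H) (V : G -> K -> K).
Hypotheses (auU : au_rep S U) (auV : au_rep S V).
Hypotheses (uU : forall g, g \in S -> unitary_op (U g)).
Hypotheses (uV : forall g, g \in S -> unitary_op (V g)).
Hypotheses (irrU : irreducible_rep S U) (irrV : irreducible_rep S V).

Lemma schur_intertwiner (T : H -> K) : bounded_linear T ->
  (forall g, g \in S -> forall x, T (U g x) = V g (T x)) ->
  (exists x, T x != 0) -> equivalent_rep S U V.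
Proof.
move=> bT TU [x0 Tx0]; have [Ts bTs TTs] := adjoint_exists bT.
have TsT := adjoint_sym TTs.
have TsV g : g \in S -> forall y, Ts (V g y) = U g (Ts y).
  move=> gS y; have [_ gVS UVK UK] := auU gS; have [_ _ VVK VK] := auV gS.
  apply: inner_inj => x; rewrite TsT -{2}[x]UK (unitary_inner (uU gS)).
  by rewrite -{1}[x]UK TU// (unitary_inner (uV gS)) TsT.
have [|a aP] := @schur _ _ _ _ _ auU uU (fun x => Ts (T x)) irrU.
  apply/rep_commutantP; split=> [|g gS x]; first exact: bounded_linear_comp.
  by rewrite TU// TsV.
have [|b bP] := @schur _ _ _ _ _ auV uV (fun x => T (Ts x)) irrV.
  apply/rep_commutantP; split=> [|g gS x]; first exact: bounded_linear_comp.
  by rewrite TsV// TU.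
have TE := linE bT.1.
(* [T Ts T x0] is both [a T x0] and [b T x0]. *)
have ab : a = b.
  have : (a - b) *: T x0 = 0.
    by rewrite scalerBl -TE -aP -bP subrr.
  by move=> /eqP; rewrite scaler_eq0 (negPf Tx0) orbF subr_eq0 => /eqP.
have x00 : x0 != 0 by apply: contra_neq Tx0 => ->; rewrite TE.
have Tn x : inner (T x) (T x) = a * inner x x by rewrite -TsT aP innerZl.
have a0 : 0 < a.
  by rewrite -(@pmulr_lgt0 _ (inner x0 x0)) ?dnorm_gt0// -Tn dnorm_gt0.
have an0 : a != 0 by rewrite gt_eqF.
have s0 : 0 < sqrtC a by rewrite sqrtC_gt0.
have sn0 : sqrtC a != 0 by rewrite gt_eqF.
have sC : Num.conj (sqrtC a)^-1 = (sqrtC a)^-1.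
  by apply/CrealP; rewrite rpredV gtr0_real.
exists (fun x => (sqrtC a)^-1 *: T x).
  split=> [c x y|x|y]; first by rewrite bT.1; vec.
    apply: norm_eq_inner; rewrite innerZl innerZr sC Tn !mulrA -invfM -expr2 sqrtCK.
    by rewrite mulVf ?mul1r.
  exists ((sqrtC a)^-1 *: Ts y); rewrite TE scalerA -invfM -expr2 sqrtCK bP -ab.
  by rewrite scalerA mulVf ?scale1r.
move=> g gS; apply/funext => x /=; rewrite TU//.
by have [L _ _] := uV gS; rewrite (linE L).
Qed.

End SchurIntertwiner.

(** * Square root of a unitary operator *)

Section SignOperator.
Context {R : realType} {H : hilbertType R} (N s : H -> H).
Hypotheses (bN : bounded_linear N) (bs : bounded_linear s).
Hypotheses (NN : adjoint_of N N) (ss : adjoint_of s s).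
Hypotheses (Ns : forall x, N (s x) = s (N x)) (N2 : forall x, N (N x) = s (s x)).

(* [N] plays the role of [|s|]; the sign is [+1] on the kernel of [N - s] and
   [-1] on its orthogonal complement. *)
Lemma sign_operator : exists F : H -> H,
  [/\ bounded_linear F, adjoint_of F F, forall x, F (F x) = x,
      forall x, F (N x) = s x
    & (forall S, au_op S -> (forall x, S (N x) = N (S x)) ->
         (forall x, S (s x) = s (S x)) -> forall x, S (F x) = F (S x)) /\
      (forall A, linear A -> adjoint_of A A -> (forall x, A (N x) = N (A x)) ->
         (forall x, A (s x) = s (A x)) -> forall x, F (A x) = A (F x))].
Proof.
have bB : bounded_linear (fun x => N x - s x) by exact: bounded_linearB.
have NE := linE bN.1; have sE := linE bs.1.
pose E := kernel bB; pose P := proj E; pose F x := 2 *: P x - x.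
have PL : linear P by exact: proj_linear.
have [[[PE PZ] PN] _] := linE PL.
have PP x : P (P x) = P x by exact: proj_proj.
have FF x : F (F x) = x by rewrite /F !(PE, PN, PZ) PP; vec.
(* [N - s] annihilates the range of [N + s], since [N^2 = s^2], and [P] annihilates the range of
   [N - s]; so [F] fixes [N + s] and negates [N - s]. *)
have Fs x : F (s x) = N x.
  have h1 : P (N x) - P (s x) = 0.
    rewrite -PN -PE; apply: inner_inj => y.
    rewrite [LHS]proj_adj innerDl innerNl NN ss -innerNr -innerDr.
    by have /kernelE -> := proj_in E y; rewrite inner0r inner0l.
  have h2 : P (N x) + P (s x) = N x + s x.
    rewrite -PE; apply: proj_id; apply/kernelE.
    by rewrite !NE !sE N2 Ns; vec.
  rewrite /F; have -> : 2 *: P (s x) = P (N x) + P (s x) - (P (N x) - P (s x)) by vec.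
  by rewrite h1 h2; vec.
exists F; split=> // [|x y|x|].
- apply: bounded_linearB; last exact: bounded_linear_id.
  by apply: bounded_linearZ; exact: proj_bounded.
- rewrite /F !(innerE, innerrE) rmorph_nat /P proj_adj//.
- by rewrite -Fs FF.
- have SF S : (forall x y, S (x + y) = S x + S y) -> (forall x, S (- x) = - S x) ->
      (forall x, S (P x) = P (S x)) -> forall x, S (F x) = F (S x).
    move=> SD SN SP x; rewrite /F SD SN; congr (_ - _).
    by rewrite !scalerDl !scale1r SD SP.
  split=> [S hS SN Ss|A AL AA AN As x]; last first.
    have AE := linE AL.
    apply/esym; apply: SF => [y z|y|y]; rewrite ?AE//.
    apply/esym/proj_comm_sa => // z /kernelE Ez.
    by apply/kernelE; rewrite -AN -As -AE.1.2 -AE.1.1.1 Ez AE.2.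
  apply: SF; [exact: auD|exact: auN|].
  move=> x; apply/esym/proj_comm_au => // z.
  have -> : E (S z) <-> S (N z - s z) = 0.
    by rewrite (auD hS) (auN hS) SN Ss.
  by split=> [/(au_eq0 hS)//|/kernelE ->]; exact: au0.
Qed.

End SignOperator.

Section UnitarySquareRoot.
Context {R : realType} {H : hilbertType R} (u us : H -> H).
Hypotheses (hu : unitary_op u) (usu : forall x, us (u x) = x) (uus : forall x, u (us x) = x).

(* With [u = c + i s], the square root is [cos + i sgn(s) sin] of half the
   angle, where [cos^2 = (1 + c) / 2] and [sin^2 = (1 - c) / 2]; no Borel
   functional calculus is needed. *)
Lemma unitary_sqrt : exists W Ws : H -> H,
  [/\ unitary_op W, (forall x, Ws (W x) = x) /\ (forall x, W (Ws x) = x),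
      forall x, W (W x) = u x,
      forall S, unitary_op S -> (forall x, S (u x) = u (S x)) ->
        forall x, S (W x) = W (S x)
    & forall S, antiunitary_op S -> (forall x, S (u x) = us (S x)) ->
        forall x, S (W x) = Ws (S x)].
Proof.
have hus := unitary_inv hu usu uus.
have bu := unitary_bounded hu; have bus := unitary_bounded hus.
have uE := linE bu.1; have usE := linE bus.1.
have uA := unitary_adjoint hu uus; have usA := adjoint_sym uA.
pose c x := 2^-1 *: (u x + us x); pose s x := (- 'i%R / 2) *: (u x - us x).
have is_conj : Num.conj (- 'i%R / 2 : R[i]) = 'i%R / 2.
  by rewrite rmorphM rmorphN /= conjCi half_conj opprK.
have bc : bounded_linear c by apply: bounded_linearZ; exact: bounded_linearD.
have bs : bounded_linear s by apply: bounded_linearZ; exact: bounded_linearB.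
have cc : adjoint_of c c.
  by move=> x y; rewrite /c !(innerE, innerrE) half_conj uA usA; ring.
have ss : adjoint_of s s.
  by move=> x y; rewrite /s !(innerE, innerrE) is_conj uA usA; ring.
have cs1 x : c (c x) + s (s x) = x.
  rewrite /c /s !(uE, usE) !(usu, uus).
  by apply: inner_inj => z; rewrite !innerE; field: (@imag_sqr R).
have cs x : c (s x) = s (c x) by rewrite /c /s !(uE, usE) !(usu, uus); vec.
have uc x : u x = c x + 'i%R *: s x.
  by rewrite /c /s; apply: inner_inj => z; rewrite !innerE; field: (@imag_sqr R).
(* Cosine for [e = 0], sine for [e = 1]: each is the absolute value of [T = (1 + (-1)^e u) / 2],
   since [Ts T = (1 + (-1)^e c) / 2]. *)
have half e : exists a : H -> H, [/\ bounded_linear a, adjoint_of a a,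
    forall x, a (a x) = 2^-1 *: (x + (-1) ^+ e *: c x)
  & forall S, real_bounded S -> (forall x, S (c x) = c (S x)) ->
      forall x, S (a x) = a (S x)].
  pose sg : R[i] := (-1) ^+ e.
  have sgC : Num.conj sg = sg by rewrite rmorphXn rmorphN rmorph1.
  have sg2 : sg * sg = 1 by rewrite -expr2 sqrr_sign.
  pose T x := 2^-1 *: (x + sg *: u x); pose Ts x := 2^-1 *: (x + sg *: us x).
  have TsT x : Ts (T x) = 2^-1 *: (x + sg *: c x).
    rewrite /T /Ts /c !(uE, usE) usu.
    by apply: inner_inj => z; rewrite !innerE; field: sg2.
  have [||x y|a [ba aa a2 _ aS]] := @abs_exists R H T Ts.
  - apply: bounded_linearZ; apply: bounded_linearD; first exact: bounded_linear_id.
    exact: bounded_linearZ.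
  - apply: bounded_linearZ; apply: bounded_linearD; first exact: bounded_linear_id.
    exact: bounded_linearZ.
  - by rewrite /T /Ts !(innerE, innerrE) half_conj sgC uA.
  exists a; split=> // [x|S bS Sc]; first by rewrite a2 TsT.
  apply: aS => // x; rewrite !TsT; have [SD SR _] := bS.
  have h2 : 2^-1 = (2^-1 : R)%:C :> R[i] by rewrite fmorphV rmorph_nat.
  have sgE : sg = ((-1) ^+ e : R)%:C by rewrite rmorphXn rmorphN rmorph1.
  by rewrite h2 sgE SR SD SR Sc.
have [a [ba aa a2 aS]] := half 0%N; have [b [bb bb' b2 bS]] := half 1%N.
rewrite expr0 in a2; rewrite expr1 in b2.
have ac x : a (c x) = c (a x).
  by apply/esym/aS => //; exact: bounded_linear_real.
have bc' x : b (c x) = c (b x).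
  by apply/esym/bS => //; exact: bounded_linear_real.
have as_ x : a (s x) = s (a x).
  by apply/esym/aS => [|y]; [exact: bounded_linear_real|].
have bs_ x : b (s x) = s (b x).
  by apply/esym/bS => [|y]; [exact: bounded_linear_real|].
have ab x : a (b x) = b (a x).
  by apply/bS => //; exact: bounded_linear_real.
have aE := linE ba.1; have bE := linE bb.1; have cE := linE bc.1; have sE := linE bs.1.
(* The double angle formula: [N^2 = 4 a^2 b^2 = 1 - c^2 = s^2]. *)
pose N x := 2 *: a (b x).
have [||||x|x|F [bF FF F2 FN [FS FA]]] := @sign_operator R H N s.
- by apply: bounded_linearZ; exact: bounded_linear_comp.
- by [].
- by move=> x y; rewrite innerZl innerZr rmorph_nat ab bb' aa.
- by [].
- by rewrite /N bs_ as_ sE.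
- rewrite /N !(aE, bE) -[b (a (b x))]ab.
  have -> : a (a (b (b x))) = 2^-1 *: (2^-1 *: (x - c (c x))).
    by rewrite b2 a2 !cE; vec.
  have -> : s (s x) = x - c (c x) by rewrite -{2}(cs1 x) addrC addKr.
  by apply: inner_inj => z; rewrite !innerE; field.
have FE := linE bF.1.
have Fa x : F (a x) = a (F x).
  by apply: FA; [exact: ba.1|exact: aa|move=> y; rewrite /N aE ab|exact: as_].
have Fb x : F (b x) = b (F x).
  by apply: FA; [exact: bb.1|exact: bb'|move=> y; rewrite /N bE -ab|exact: bs_].
(* All factors commute and [F^2 = 1], so [Ws W = a^2 + b^2 = 1] and
   [W^2 = a^2 - b^2 + 'i F N = c + 'i s]. *)
pose W x := a x + 'i%R *: F (b x); pose Ws x := a x - 'i%R *: F (b x).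
have ab1 x : a (a x) + b (b x) = x.
  by rewrite a2 b2; apply: inner_inj => z; rewrite !innerE; field.
have WsW x : Ws (W x) = x.
  rewrite /Ws /W !(aE, bE, FE) !Fb !Fa F2 -[in RHS](ab1 x) -!ab.
  by veci R.
have WWs x : W (Ws x) = x.
  rewrite /Ws /W !(aE, bE, FE) !Fb !Fa F2 -[in RHS](ab1 x) -!ab.
  by veci R.
have W2 x : W (W x) = u x.
  rewrite uc -FN /N /W !(aE, bE, FE) !(Fa, Fb) F2 -!ab.
  have -> : c x = a (a x) - b (b x).
    by rewrite a2 b2; apply: inner_inj => z; rewrite !innerE; field.
  by veci R.
have comm S : au_op S -> (forall x, S (c x) = c (S x)) -> (forall x, S (s x) = s (S x)) ->
    (forall x, S (a x) = a (S x)) /\ (forall x, S (F (b x)) = F (b (S x))).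
  move=> hS Sc Ss; have rS := au_real hS; have Sa := aS _ rS Sc; have Sb := bS _ rS Sc.
  split=> // x; rewrite FS// ?Sb// => y.
  by rewrite /N !scalerDl !scale1r (auD hS) Sa Sb.
have WA x y : inner (W x) y = inner x (Ws y).
  by rewrite /W /Ws !(innerE, innerrE) conjCi aa FF bb' -Fb; ring.
exists W, Ws; split=> // [|S uS Su x|S aS' Su x].
- split=> [e x y|x|y]; last by exists (Ws y).
    by rewrite /W ba.1 bb.1 bF.1; vec.
  by apply: norm_eq_inner; rewrite WA WsW.
- have SE := linE (unitary_bounded uS).1.
  have Sus y : S (us y) = us (S y) by rewrite -{2}[y]uus Su usu.
  have [|y|y|Sa SFb] := comm S; [by left|..].
  + by rewrite /c !SE Su Sus.
  + by rewrite /s !SE Su Sus.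
  by rewrite /W !SE Sa SFb.
(* [S] exchanges [u] and [us]; in [s] this is undone by conjugating the factor [- 'i / 2]. So [S]
   commutes with [c] and [s], hence with [a] and [F b], and only the explicit ['i] in [W] changes
   sign. *)
- have SE := antiE (let: And3 L _ _ := aS' in L).
  have Sus y : S (us y) = u (S y) by rewrite -{2}[y]uus Su uus.
  have [|y|y|Sa SFb] := comm S; [by right|..].
  + by rewrite /c !SE Su Sus half_conj addrC.
  + by rewrite /s !SE Su Sus is_conj; vec.
  by rewrite /W /Ws !SE Sa SFb conjCi scaleNr.
Qed.

End UnitarySquareRoot.

(** * Representations of a pair of groups *)

Section Representations.
Context {R : realType} {G : groupType} {G1 : {pred G}} {H : hilbertType R}.
Hypothesis hG1 : index_two G1.

Section Unitary.
Variable U : G -> H -> H.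
Hypothesis repU : unitary_rep G1 U.

Lemma urep_op g : g \in G1 -> unitary_op (U g).
Proof. by have [h _] := repU; exact: h. Qed.

Lemma urepM g h x : g \in G1 -> h \in G1 -> U (g * h)%g x = U g (U h x).
Proof. by move=> gG hG; have [_ ->] := repU. Qed.

Lemma urep1 x : U 1%g x = x.
Proof.
have h1 := index2_1 hG1.
apply: (au_inj (or_introl (urep_op h1))).
by rewrite -urepM// mulg1.
Qed.

Lemma urepVK g x : g \in G1 -> U (g^-1)%g (U g x) = x.
Proof. by move=> gG; rewrite -urepM ?index2_VE// mulVg urep1. Qed.

Lemma unitary_rep_au : au_rep G1 U.
Proof.
move=> g gG; have gV := index2_V hG1 gG; split=> // [|x|x].
- by left; exact: urep_op.
- exact: urepVK.
- by have := urepVK x gV; rewrite invgK.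
Qed.

(** Each [U g] commutes with the commutant, so whatever lies in the bicommutant commutes with
    [U g]. *)
Lemma commutant_von_neumann : von_neumann_algebra (rep_commutant G1 U).
Proof.
split=> [A dA|]; first by have [B] := comm_adjoint_exists unitary_rep_au dA; exists B.
apply/seteqP; split=> A.
  move=> [bA hA]; split=> // _ [g gG <-]; apply: hA; split.
    exact/unitary_bounded/urep_op.
  by move=> B [_ BU]; rewrite BU//; exists g.
move=> dA; split; first exact: comm_bounded dA.
by move=> B [_ BA]; rewrite BA.
Qed.

End Unitary.

Variable U : G -> H -> H.
Hypothesis repU : antiunitary_rep G1 U.

Lemma arep_unitary g : g \in G1 -> unitary_op (U g).
Proof. by have [_ _ hU] := repU => gG; have : [set` G1] g by []; rewrite -hU. Qed.

Lemma arep_antiunitary g : g \notin G1 -> antiunitary_op (U g).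
Proof.
have [hU _ hG] := repU => gG; have [ug|//] := hU g.
by have : [set` G1] g; [rewrite -hG|rewrite /= (negPf gG)].
Qed.

Lemma arepM g h x : U (g * h)%g x = U g (U h x).
Proof. by have [_ -> _] := repU. Qed.

Lemma arep_au g : au_op (U g).
Proof. by have [h _ _] := repU; exact: h. Qed.

Lemma arep1 x : U 1%g x = x.
Proof. by apply: (au_inj (arep_au 1%g)); rewrite -arepM mulg1. Qed.

Lemma arepVK g x : U (g^-1)%g (U g x) = x.
Proof. by rewrite -arepM mulVg arep1. Qed.

Lemma arepKV g x : U g (U (g^-1)%g x) = x.
Proof. by rewrite -arepM mulgV arep1. Qed.

Lemma antiunitary_rep_au : au_rep predT U.
Proof.
move=> g _; split=> // [|x|x]; first exact: arep_au.
  exact: arepVK.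
exact: arepKV.
Qed.

Lemma antiunitary_rep_unitary : unitary_rep G1 U.
Proof.
by split=> [g gG|g h _ _]; [exact: arep_unitary|have [_ ->] := repU].
Qed.

Lemma commutant_sub A : rep_commutant predT U A -> rep_commutant G1 U A.
Proof.
by move=> /rep_commutantP[bA AU]; apply/rep_commutantP; split=> // g _; exact: AU.
Qed.

Variable r : G.
Hypothesis hr : r \notin G1.

(** On the zero space [U r] would also be unitary, which puts [r] into [G1]. *)
Lemma arep_neq0 : exists x : H, x != 0.
Proof.
have hU := arep_antiunitary hr; apply: contrapT => h0.
have H0 (x : H) : x = 0 by apply/eqP; apply: contrapT => /negP x0; apply: h0; exists x.
have [_ _ hG] := repU; have : [set` G1] r; last by rewrite /= (negPf hr).
rewrite -hG; have [_ N S] := hU; split=> // a x y.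
by rewrite (H0 (U r (a *: x + y))) (H0 (_ + _)).
Qed.

Lemma commutant_intro A : rep_commutant G1 U A -> (forall x, A (U r x) = U r (A x)) ->
  rep_commutant predT U A.
Proof.
move=> dA Ar; apply/rep_commutantP; split=> [|g _ x]; first exact: comm_bounded dA.
have [gG|gG] := boolP (g \in G1); first exact: (comm_U _ dA gG).
have -> : g = ((g * r^-1) * r)%g by rewrite mulgVK.
by rewrite [in LHS]arepM [in RHS]arepM -Ar (comm_U _ dA)// index2_MN// index2_VE.
Qed.

Lemma commutant_split A : rep_commutant G1 U A ->
  exists B C, [/\ rep_commutant predT U B, rep_commutant predT U C
    & forall x, A x = B x + 'i%R *: C x].
Proof.
move=> dA; have auU1 := unitary_rep_au antiunitary_rep_unitary.
have uU := arep_unitary.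
have hU := arep_antiunitary hr; have hUV : antiunitary_op (U (r^-1)%g).
  by apply: arep_antiunitary; rewrite index2_VE.
have aE := antiE (let: And3 L _ _ := hU in L).
(* Conjugating twice is conjugation with [U (r * r)], which fixes [A] because [r * r] lies in [G1];
   this is [rA']. *)
pose A' x := U r (A (U (r^-1)%g x)).
have A'r x : A' (U r x) = U r (A x) by rewrite /A' arepVK.
have rA' x : U r (A' x) = A (U r x).
  have rr : (r * r)%g \in G1 by exact: index2_MN.
  rewrite /A' -arepM -(comm_U _ dA)// -[X in A X]arepM mulgK//.
have bA := comm_bounded dA; have AE := linE bA.1.
have dA' : rep_commutant G1 U A'.
  apply/rep_commutantP; split=> [|g gG x].
    have [M M0 AM] := bounded_linearP bA; split=> [a x y|].
      have UVE := antiE (let: And3 L _ _ := hUV in L).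
      by rewrite /A' !UVE !AE !aE conjCK.
    exists M => x; rewrite /A' (au_norm (arep_au r)); apply: le_trans (AM _) _.
    by rewrite (au_norm (arep_au _)).
  rewrite /A' -arepM -(mulgK r (r^-1 * g)%g) [X in A X]arepM.
  have rgr : (r^-1 * g * r)%g \in G1.
    by rewrite index2_MN// index2_Mr// index2_VE.
  by rewrite (comm_U _ dA)// -arepM !mulgA mulgV mul1g arepM.
exists (fun x => 2^-1 *: (A x + A' x)), (fun x => ('i%R / 2) *: (A' x - A x)); split.
- apply: commutant_intro => [|x]; first by apply: commZ => //; exact: commD.
  by rewrite !aE half_conj A'r rA' addrC.
- apply: commutant_intro => [|x]; first by apply: commZ => //; exact: commB.
  rewrite !aE A'r rA' rmorphM /= conjCi half_conj; vec.
- by move=> x; apply: inner_inj => z; rewrite !innerE; field: (@imag_sqr R).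
Qed.

Lemma commutant_complexification :
  is_complexification (rep_commutant predT U) (rep_commutant G1 U).
Proof.
have auU1 := unitary_rep_au antiunitary_rep_unitary.
have uU := arep_unitary.
have aE := antiE (let: And3 L _ _ := arep_antiunitary hr in L).
split=> [|p q _ _ x|a b [A B] [/= dA dB] x|[A B] [C D] [/= dA dB] [/= dC dD] x].
- split.
  + move=> [A B] [/= dA dB].
    exact: (commD auU1 (commutant_sub dA) (commZ uU 'i%R (commutant_sub dB))).
  + move=> [A B] [C D] /set_mem[/= dA dB] /set_mem[/= dC dD] ABCD.
    (* [A - C] and [B - D] commute with [U r], whereas ['i] changes sign when it passes [U r]; so
       [A - C] equals its own negative. *)
    have h x : A x - C x = - ('i%R *: (B x - D x)).
      have := congr1 (@^~ x) ABCD => /= e.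
      by apply: subr0_eq; rewrite opprK scalerBr addrACA -opprD e subrr.
    have h' x : A x - C x = 'i%R *: (B x - D x).
      apply: (au_inj (arep_au r)).
      rewrite (auD (arep_au r)) (auN (arep_au r)) -!(comm_U _ dA) -?(comm_U _ dC)//.
      by rewrite h !aE conjCi scaleNr !(comm_U _ dB, comm_U _ dD).
    have AC x : A x = C x.
      apply: subr0_eq; apply: (@scalerI _ _ 2); first by rewrite pnatr_eq0.
      by rewrite scaler0 -[2]/(1 + 1) scalerDl scale1r {1}h h' addNr.
    congr pair; apply/funext => x; first exact: AC.
    apply: subr0_eq; apply: (@scalerI _ _ 'i%R); first exact: neq0Ci.
    by rewrite -h' AC subrr scaler0.
  + move=> A /commutant_split[B [C [dB dC ABC]]]; exists (B, C) => //.
    by apply/funext => x; rewrite ABC.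
- by rewrite /=; vec.
- by rewrite /= ImagE; veci R.
- have AE := linE (comm_bounded dA).1; have BE := linE (comm_bounded dB).1.
  by rewrite /= !(AE, BE); veci R.
Qed.

End Representations.

(** * Equivalence over [G] from equivalence over [G1] *)

Section Equivalence.
Context {R : realType} {G : groupType} {G1 : {pred G}} {H1 H2 : hilbertType R}.
Hypothesis hG1 : index_two G1.
Variables (r : G) (U1 : G -> H1 -> H1) (U2 : G -> H2 -> H2).
Hypotheses (hr : r \notin G1) (rep1 : antiunitary_rep G1 U1) (rep2 : antiunitary_rep G1 U2).

Lemma equivalent_antiunitary : equivalent_rep G1 U1 U2 -> equivalent_rep predT U1 U2.
Proof.
move=> [T uT TU]; have {}TU g x : g \in G1 -> T (U1 g x) = U2 g (T x).
  by move=> /TU/(congr1 (@^~ x)).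
have [Ti [TiT TTi]] := inv_exists (or_introl uT).
have uTi := unitary_inv uT TiT TTi.
have TiU g y : g \in G1 -> Ti (U2 g y) = U1 g (Ti y).
  by move=> gG; rewrite -{1}[y]TTi -TU// TiT.
have rVG : (r^-1)%g \notin G1 by rewrite index2_VE.
have a1 := arep_antiunitary rep1 hr; have a1V := arep_antiunitary rep1 rVG.
have a2 := arep_antiunitary rep2 hr; have a2V := arep_antiunitary rep2 rVG.
pose u x := Ti (U2 r (T (U1 (r^-1)%g x))).
pose us x := U1 r (Ti (U2 (r^-1)%g (T x))).
have rr : (r * r)%g \in G1 by exact: index2_MN.
have uu : unitary_op u.
  apply: unitary_comp => //.
  apply: (@antiunitary_comp _ _ _ _ (fun y => U2 r (T y))) => //.
  exact: antiunitary_unitary_comp.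
have usu x : us (u x) = x by rewrite /us /u TTi (arepVK rep2) TiT (arepKV rep1).
have uus x : u (us x) = x by rewrite /us /u (arepVK rep1) TTi (arepKV rep2) TiT.
have [W [Ws [uW [WsW WWs] W2 WS WA]]] := unitary_sqrt uu usu uus.
have uU g x : g \in G1 -> U1 g (u x) = u (U1 g x).
  move=> gG; rewrite /u -TiU// -(arepM rep2).
  rewrite -(arepM rep1) -(mulgK r (r^-1 * g)%g) [in RHS](arepM rep1).
  have rgr : (r^-1 * g * r)%g \in G1 by rewrite index2_MN// index2_Mr.
  by rewrite (TU _ _ rgr) -(arepM rep2) !mulgA mulgV mul1g.
have Ju x : U1 r (u x) = us (U1 r x).
  rewrite /u /us; congr (U1 r (Ti _)); apply: (au_inj (or_intror a2)).
  rewrite (arepKV rep2) -(arepM rep2) -TU// -(arepM rep1) mulgK//.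
have JW := WA _ a1 Ju.
have ZU g x : g \in G1 -> T (W (U1 g x)) = U2 g (T (W x)).
  move=> gG; rewrite -TU// (WS _ (arep_unitary rep1 gG))// => y.
  exact: uU.
(* [U2_r T = T u U1_r], and moving [W] past [U1_r] produces the inverse that cancels one factor of
   [u = W^2]. *)
have Zr x : T (W (U1 r x)) = U2 r (T (W x)).
  have -> y : U2 r (T y) = T (u (U1 r y)) by rewrite /u (arepVK rep1) TTi.
  by rewrite -W2 JW WWs.
exists (fun x => T (W x)); first exact: unitary_comp.
move=> g _; apply/funext => x /=.
have [gG|gG] := boolP (g \in G1); first exact: ZU.
have -> : g = ((g * r^-1) * r)%g by rewrite mulgVK.
by rewrite (arepM rep1) (arepM rep2) ZU ?Zr// index2_MN.
Qed.

End Equivalence.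

(** * Real division algebras of operators *)

Section QuaternionOps.
Context {R : realType}.
Implicit Types a b c d : R.

Lemma quat_mulE a b c d a' b' c' d' : ((a, b, c, d) : quat R) * (a', b', c', d') =
  (a * a' - b * b' - c * c' - d * d', a * b' + b * a' + c * d' - d * c',
   a * c' - b * d' + c * a' + d * b', a * d' + b * c' - c * b' + d * a').
Proof. by []. Qed.

Lemma quat_addE a b c d a' b' c' d' : ((a, b, c, d) : quat R) + (a', b', c', d') =
  (a + a', b + b', c + c', d + d').
Proof. by []. Qed.

Lemma quat_oppE a b c d : - ((a, b, c, d) : quat R) = (- a, - b, - c, - d).
Proof. by []. Qed.

Lemma quat_scaleE k a b c d : k *: ((a, b, c, d) : quat R) = (k * a, k * b, k * c, k * d).
Proof. by []. Qed.

Lemma quat_oneE : 1 = (1, 0, 0, 0) :> quat R.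
Proof. by []. Qed.

Lemma quat_eq a b c d a' b' c' d' : a = a' -> b = b' -> c = c' -> d = d' ->
  (a, b, c, d) = (a', b', c', d') :> quat R.
Proof. by move=> -> -> -> ->. Qed.

End QuaternionOps.

Definition quatE := (@quat_mulE, @quat_addE, @quat_oppE, @quat_scaleE, @quat_oneE).

Section Presentations.
Context {R : realType} {H : hilbertType R}.
Variable X : set (H -> H).

(** Presentations replace an abstract isomorphism by concrete operators with the defining relations;
    for a commutant on a nonzero space the isomorphism can be recovered from them. *)
Definition real_presentation := forall A, X A -> exists a : R, forall x, A x = a%:C *: x.

Definition complex_presentation (I : H -> H) :=
  [/\ X I, forall x, I (I x) = - x
    & forall A, X A -> exists a b : R, forall x, A x = a%:C *: x + b%:C *: I x].

Definition quaternion_presentation (I J : H -> H) :=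
  [/\ X I /\ X J, (forall x, I (I x) = - x) /\ (forall x, J (J x) = - x),
      forall x, J (I x) = - I (J x)
    & forall A, X A -> exists a b c d : R, forall x,
        A x = a%:C *: x + b%:C *: I x + c%:C *: J x + d%:C *: I (J x)].

Lemma real_iso_presentation : real_algebra_iso R^o X -> real_presentation.
Proof.
move=> [phi [[_ _ psurj] _ pZ _ p1]] A /psurj[a _ <-]; exists a => x.
by rewrite -[a in LHS]mulr1 [LHS]pZ p1.
Qed.

Lemma complex_iso_presentation :
  real_algebra_iso (Rcomplex R) X -> exists I, complex_presentation I.
Proof.
move=> [phi [[pfun _ psurj] pD pZ pM p1]].
pose i : Rcomplex R := 0 +i* 1.
have p0 x : phi 0 x = 0.
  by apply: (@addrI _ (phi 0 x)); rewrite -pD !addr0.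
have pN a x : phi (- a) x = - phi a x.
  by apply/eqP; rewrite -subr_eq0 opprK -pD addNr p0.
exists (phi i); split; first exact: pfun.
  move=> x; have := pM i i => /(congr1 (@^~ x)) /= <-.
  have -> : i * i = - 1.
    by apply/eqP; rewrite eq_complex /=; apply/andP; split; apply/eqP; ring.
  by rewrite pN p1.
move=> A /psurj[[a b] _ <-]; exists a, b => x.
have -> : (a +i* b : Rcomplex R) = a *: 1 + b *: i.
  by apply/eqP; rewrite eq_complex /=; apply/andP; split; apply/eqP; rewrite /GRing.scale/=; ring.
by rewrite pD !pZ p1.
Qed.

Lemma quaternion_iso_presentation :
  real_algebra_iso (quat R) X -> exists I J, quaternion_presentation I J.
Proof.
move=> [phi [[pfun _ psurj] pD pZ pM p1]].
pose i : quat R := (0, 1, 0, 0); pose j : quat R := (0, 0, 1, 0).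
have p0 x : phi 0 x = 0.
  by apply: (@addrI _ (phi 0 x)); rewrite -pD !addr0.
have pN a x : phi (- a) x = - phi a x.
  by apply/eqP; rewrite -subr_eq0 opprK -pD addNr p0.
have pMx a b x : phi (a * b) x = phi a (phi b x) by rewrite pM.
exists (phi i), (phi j); split; [by split; exact: pfun|split=> x|move=> x|].
- by rewrite -pMx (_ : i * i = - 1) ?pN ?p1//; rewrite /i /j !quatE; apply: quat_eq; ring.
- by rewrite -pMx (_ : j * j = - 1) ?pN ?p1//; rewrite /i /j !quatE; apply: quat_eq; ring.
- by rewrite -!pMx -pN (_ : j * i = - (i * j))//; rewrite /i /j !quatE; apply: quat_eq; ring.
move=> A /psurj[[[[a b] c] d] _ <-]; exists a, b, c, d => x.
rewrite (_ : (a, b, c, d) = a *: 1 + b *: i + c *: j + d *: (i * j) :> quat R).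
  by rewrite !pD !pZ p1 pMx.
by rewrite /i /j !quatE; apply: quat_eq; rewrite /= /GRing.scale /=; ring.
Qed.

End Presentations.

Section PresentationIsos.
Context {R : realType} {G : groupType} {S : {pred G}} {H : hilbertType R}.
Variable U : G -> H -> H.
Hypotheses (auU : au_rep S U) (H0 : exists x : H, x != 0).

Local Notation D := (rep_commutant S U).

Lemma real_presentation_iso : real_presentation D -> real_algebra_iso R^o D.
Proof.
move=> hD; have [x0 x00] := H0.
exists (fun a x => a%:C *: x); split.
- split=> [a _|a b _ _ /(congr1 (@^~ x0)) /= /eqP|A /hD[a aA]].
  + exact: comm_real.
  + rewrite -subr_eq0 -scalerBl scaler_eq0 (negPf x00) orbF -rmorphB.
    by rewrite fmorph_eq0 subr_eq0 => /eqP.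
  + by exists a => //; apply/funext => x; rewrite aA.
- by move=> a b x; rewrite rmorphD scalerDl.
- by move=> k a x; rewrite -[k *: a]/(k * a) rmorphM scalerA.
- by move=> a b; apply/funext => x /=; rewrite rmorphM scalerA.
- by apply/funext => x; rewrite rmorph1 scale1r.
Qed.

Lemma complex_presentation_iso I :
  complex_presentation D I -> real_algebra_iso (Rcomplex R) D.
Proof.
move=> [dI II hD]; have [x0 x00] := H0; have IE := linE (comm_bounded dI).1.
(* Applying the conjugate [a - b I] multiplies [x0] by [a^2 + b^2]. *)
have inj0 (a b : R) : a%:C *: x0 + b%:C *: I x0 = 0 -> a = 0 /\ b = 0.
  move=> e; have : (a ^+ 2 + b ^+ 2)%:C *: x0 = 0.
    have <- : a%:C *: (a%:C *: x0 + b%:C *: I x0)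
       - b%:C *: I (a%:C *: x0 + b%:C *: I x0) = (a ^+ 2 + b ^+ 2)%:C *: x0.
      by rewrite !IE II; apply: inner_inj => z; rewrite !innerE; ring.
    by rewrite e IE !scaler0 subr0.
  move=> /eqP; rewrite scaler_eq0 (negPf x00) orbF fmorph_eq0.
  by rewrite paddr_eq0 ?sqr_ge0// !sqrf_eq0 => /andP[/eqP ? /eqP ?].
exists (fun (z : Rcomplex R) x => (complex.Re z)%:C *: x + (complex.Im z)%:C *: I x); split.
- split=> [[a b] _|[a b] [c d] _ _ /(congr1 (@^~ x0)) /= e|A /hD[a [b aA]]].
  + by apply: (commD auU); apply: (comm_realZ auU) => //; exact: comm_id.
  + have [] := inj0 (a - c) (b - d).
      rewrite !rmorphB /= !scalerBl addrACA -opprD e subrr//.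
    by move=> /eqP; rewrite subr_eq0 => /eqP -> /eqP; rewrite subr_eq0 => /eqP ->.
  + by exists (a +i* b) => //; apply/funext => x; rewrite aA.
- by move=> [a b] [c d] x /=; rewrite !rmorphD /=; vec.
- by move=> k [a b] x /=; rewrite !rmorphM /=; vec.
- move=> [a b] [c d]; apply/funext => x /=; rewrite !IE II !(rmorphD, rmorphB, rmorphM) /=.
  by vec.
- by apply/funext => x /=; rewrite scale1r scale0r addr0.
Qed.

Lemma quaternion_presentation_iso I J :
  quaternion_presentation D I J -> real_algebra_iso (quat R) D.
Proof.
move=> [[dI dJ] [II JJ] JI hD]; have [x0 x00] := H0.
have IE := linE (comm_bounded dI).1; have JE := linE (comm_bounded dJ).1.
pose phi (q : quat R) x := q.1.1.1%:C *: x + q.1.1.2%:C *: I x + q.1.2%:C *: J x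
  + q.2%:C *: I (J x).
(* Again the conjugate multiplies [x0] by the norm form, a sum of squares. *)
have inj0 (a b c d : R) : phi (a, b, c, d) x0 = 0 -> (a, b, c, d) = 0 :> quat R.
  move=> e; have : (a ^+ 2 + b ^+ 2 + c ^+ 2 + d ^+ 2)%:C *: x0 = 0.
    have <- : phi (a, - b, - c, - d) (phi (a, b, c, d) x0)
        = (a ^+ 2 + b ^+ 2 + c ^+ 2 + d ^+ 2)%:C *: x0.
      rewrite /phi /= !(IE, JE, II, JJ, JI).
      by apply: inner_inj => z; rewrite !innerE; ring.
    by rewrite e /phi !(IE, JE) !scaler0 !addr0.
  move=> /eqP; rewrite scaler_eq0 (negPf x00) orbF fmorph_eq0.
  rewrite !paddr_eq0 ?addr_ge0 ?sqr_ge0// !sqrf_eq0.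
  by move=> /andP[/andP[/andP[/eqP -> /eqP ->] /eqP ->] /eqP ->].
have pD p q x : phi (p + q) x = phi p x + phi q x.
  by move: p q => [[[? ?] ?] ?] [[[? ?] ?] ?]; rewrite /phi /= !rmorphD /=; vec.
have pZ k p x : phi (k *: p) x = k%:C *: phi p x.
  by move: p => [[[a b] c] d]; rewrite quat_scaleE /phi /= !rmorphM /=; vec.
exists phi; split=> //.
- split=> [[[[a b] c] d] _|p q _ _ /(congr1 (@^~ x0)) /= e|A /hD[a [b [c [d aA]]]]].
  + apply: (commD auU); first apply: (commD auU); first apply: (commD auU);
      apply: (comm_realZ auU) => //; [exact: comm_id|exact: comm_comp].
  + apply/eqP; rewrite -subr_eq0; apply/eqP; move: (p - q) (pD p (- q) x0) => [[[a b] c] d].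
    rewrite -scaleN1r pZ e -pZ -pD scaleN1r subrr => h; apply: inj0.
    by rewrite h /phi /= !scale0r !addr0.
  + by exists (a, b, c, d) => //; apply/funext => x; rewrite aA.
- move=> [[[a b] c] d] [[[a' b'] c'] d']; apply/funext => x.
  rewrite quat_mulE.
  rewrite /phi /= !(IE, JE, II, JJ, JI) !(rmorphD, rmorphB, rmorphM) /=.
  by vec.
- by apply/funext => x; rewrite /phi /= !scale0r !addr0 scale1r.
Qed.

End PresentationIsos.

(** * Frobenius' classification for the commutant of an irreducible representation *)

Section Frobenius.
Context {R : realType} {G : groupType} {S : {pred G}} {H : hilbertType R}.
Variable U : G -> H -> H.
Hypotheses (auU : au_rep S U) (irrU : irreducible_rep S U).

Local Notation D := (rep_commutant S U).

Definition skew (A : H -> H) := forall x y, inner (A x) y = - inner x (A y).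

(** By Schur the adjoint is [a - A] with [a] real, and it squares to -1 as well, so
    [a (a - 2 A) = 0]. If [a] were nonzero, [A] would be [a / 2], whose square is not -1. *)
Lemma skew_unit A : D A -> (forall x, A (A x) = - x) -> skew A.
Proof.
move=> dA AA; have [B dB AB] := comm_adjoint_exists auU dA; have BA := adjoint_sym AB.
have [[x0 x00] _] := irrU.
have [|a aP] := schur_selfadjoint auU irrU (commD auU dA dB).
  by move=> x y; rewrite !(innerE, innerrE) AB BA addrC.
have AE := linE (comm_bounded dA).1.
have BA' x : B x = a%:C *: x - A x by rewrite -aP addrC addKr.
have BB x : B (B x) = - x.
  by apply: inner_inj => y; rewrite !BA AA innerNl innerNr.
suff a0 : a = 0.
  by move=> x y; rewrite AB BA' a0 scale0r sub0r innerNr.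
apply/eqP; apply: contraT => an0.
have Ax : A x0 = (a / 2)%:C *: x0.
  have := BB x0; rewrite !BA' !AE AA => e.
  have aC : a%:C != 0 :> R[i] by rewrite fmorph_eq0.
  apply: (scalerI aC); apply: (@scalerI _ _ 2); first by rewrite pnatr_eq0.
  rewrite real_half.
  have {e} : a%:C *: (a%:C *: x0 - A x0) - (a%:C *: A x0 - - x0) + x0 = 0 by rewrite e addNr.
  move=> e; apply: subr0_eq; rewrite -[RHS]oppr0 -[in RHS]e.
  by apply: inner_inj => z; rewrite !innerE; field.
have := AA x0; rewrite Ax AE Ax scalerA -rmorphM /= => /eqP.
rewrite -subr_eq0 opprK -{2}[x0]scale1r -(rmorph1 (real_complex R)) -scalerDl -rmorphD.
rewrite scaler_eq0 (negPf x00) orbF fmorph_eq0 /= gt_eqF//.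
by rewrite ltr_wpDl// -expr2 sqr_ge0.
Qed.

Lemma skew_decomp A : D A -> exists (a : R) B, [/\ D B, skew B
  & forall x, A x = a%:C *: x + B x].
Proof.
move=> dA; have [B dB AB] := comm_adjoint_exists auU dA; have BA := adjoint_sym AB.
have [|a aP] := schur_selfadjoint auU irrU (commD auU dA dB).
  by move=> x y; rewrite !(innerE, innerrE) AB BA addrC.
have h2 : 2^-1 = (2^-1 : R)%:C :> R[i] by rewrite fmorphV rmorph_nat.
exists (a / 2), (fun x => 2^-1 *: (A x - B x)); split.
- by rewrite h2; apply: (comm_realZ auU); exact: commB.
- by move=> x y; rewrite !(innerE, innerrE) half_conj AB BA; ring.
- move=> x; rewrite real_half [a%:C / 2]mulrC -scalerA -aP.
  by apply: inner_inj => z; rewrite !innerE; field.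
Qed.

(** [A^2] is self-adjoint, hence a real scalar [c], and [- c |x|^2 = |A x|^2] makes it negative;
    dividing [A] by [sqrt (- c)] gives a unit. *)
Lemma skew_normalize A : D A -> skew A -> (exists x, A x != 0) ->
  exists (t : R) I, [/\ D I, skew I, forall x, I (I x) = - x
    & forall x, I x = t%:C *: A x].
Proof.
move=> dA kA [x Ax].
have [|c cP] := schur_selfadjoint auU irrU (comm_comp dA dA).
  by move=> y z; rewrite !kA opprK.
have AE := linE (comm_bounded dA).1.
have x0 : x != 0 by apply: contra_neq Ax => ->; rewrite AE.
have c0 : c < 0.
  have : (- c)%:C * inner x x = inner (A x) (A x) :> R[i].
    by rewrite kA cP innerZr real_conj -mulNr rmorphN.
  move=> h; have : 0 < (- c)%:C * inner x x by rewrite h dnorm_gt0.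
  by rewrite pmulr_lgt0 ?dnorm_gt0// -[0]/(0%:C) ltcR oppr_gt0.
pose t := (Num.sqrt (- c))^-1.
have tt : t * t * c = -1.
  rewrite -expr2 exprVn sqr_sqrtr ?oppr_ge0 ?ltW// invrN mulNr mulVf// lt_eqF//.
exists t, (fun x => t%:C *: A x); split=> //.
- exact: (comm_realZ auU).
- by move=> y z; rewrite innerZl innerZr real_conj kA mulrN.
- move=> y; rewrite AE cP.
  have -> : t%:C *: (t%:C *: (c%:C *: y)) = (t * t * c)%:C *: y by rewrite !rmorphM /=; vec.
  by rewrite tt rmorphN rmorph1 scaleN1r.
Qed.

(** The scalar is, up to a factor, a real inner product on skew elements; anticommuting means
    orthogonal, and units are split off by Gram-Schmidt steps. *)
Lemma skew_anticommutator A B : D A -> D B -> skew A -> skew B ->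
  exists e : R, forall x, A (B x) + B (A x) = e%:C *: x.
Proof.
move=> dA dB kA kB.
apply: (schur_selfadjoint auU irrU (commD auU (comm_comp dA dB) (comm_comp dB dA))).
by move=> x y; rewrite innerDl innerDr kA kB kB kA !opprK addrC.
Qed.

(* The skew elements anticommuting with given imaginary units are split off one
   unit at a time, as in Frobenius' theorem on real division algebras. *)
Lemma irreducible_presentation :
  [\/ real_presentation D, exists I, complex_presentation D I
    | exists I J, quaternion_presentation D I J].
Proof.
have [[A0 [dA0 kA0 nA0]]|no1] :=
  pselect (exists A, [/\ D A, skew A & exists x, A x != 0]); last first.
  apply: Or31 => A /skew_decomp[a [B [dB kB AB]]]; exists a => x.
  rewrite AB; suff -> : B x = 0 by rewrite addr0.
  apply/eqP; apply: contrapT => /negP Bx; apply: no1.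
  by exists B; split=> //; exists x.
have [t0 [I [dI kI II _]]] := skew_normalize dA0 kA0 nA0.
have IE := linE (comm_bounded dI).1.
have adjust B : D B -> skew B -> exists (b : R) T,
    [/\ D T, skew T, forall x, I (T x) = - T (I x) & forall x, T x = B x + b%:C *: I x].
  move=> dB kB; have [e eP] := skew_anticommutator dI dB kI kB.
  (* As [I^2 = -1], the added term contributes [- e] to the anticommutator with [I] and cancels that
     of [B]. *)
  pose T x := B x + (e / 2)%:C *: I x; exists (e / 2), T; split=> //.
  - by apply: (commD auU) => //; exact: (comm_realZ auU).
  - by move=> x y; rewrite /T !(innerE, innerrE) real_conj kB kI; ring.
  - move=> x; apply/eqP; rewrite -subr_eq0 opprK; apply/eqP.
    rewrite /T !IE II; have -> : I (B x) = e%:C *: x - B (I x) by rewrite -eP addrK.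
    rewrite real_half.
    by apply: inner_inj => z; rewrite !innerE; field.
have [[A1 [dA1 kA1 nA1 IA1]]|no2] := pselect
    (exists A, [/\ D A, skew A, exists x, A x != 0 & forall x, I (A x) = - A (I x)]);
  last first.
  apply: Or32; exists I; split=> // A /skew_decomp[a [B [dB kB AB]]].
  have [b [T [dT kT IT TE]]] := adjust _ dB kB; exists a, (- b) => x.
  rewrite AB rmorphN scaleNr; congr (_ + _); apply/eqP; rewrite -subr_eq0 opprK -TE.
  by apply: contrapT => /negP Tx; apply: no2; exists T; split=> //; exists x.
have [t1 [J [dJ kJ JJ JA1]]] := skew_normalize dA1 kA1 nA1.
have JE := linE (comm_bounded dJ).1.
have JI x : J (I x) = - I (J x).
  by rewrite !JA1 IE IA1 scalerN opprK.
apply: Or33; exists I, J; split=> // A /skew_decomp[a [B [dB kB AB]]].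
have [b [T [dT kT IT TE]]] := adjust _ dB kB.
have [e eP] := skew_anticommutator dJ dT kJ kT.
have [T' T'E] : exists T', forall x, T' x = T x + (e / 2)%:C *: J x by eexists => x.
have dT' : D T'.
  rewrite (_ : T' = fun x => T x + (e / 2)%:C *: J x); last exact/funext.
  by apply: (commD auU) => //; exact: (comm_realZ auU).
have kT' : skew T'.
  by move=> x y; rewrite !T'E !(innerE, innerrE) real_conj kT kJ; ring.
have IT' x : T' (I x) = - I (T' x) by rewrite !T'E !IE IT JI; vec.
have JT' x : T' (J x) = - J (T' x).
  apply/eqP; rewrite -subr_eq0 opprK; apply/eqP.
  rewrite !T'E !JE JJ; have -> : J (T x) = e%:C *: x - T (J x) by rewrite -eP addrK.
  rewrite real_half.
  by apply: inner_inj => z; rewrite !innerE; field.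
(* [T'] anticommutes with [I] and [J], hence commutes with [I J]; the product [T' I J] is
   self-adjoint, so a scalar [f], and [(I J)^2 = -1] gives [T' = - f I J]. *)
have dK : D (fun x => I (J x)) by exact: comm_comp.
have [|f fP] := schur_selfadjoint auU irrU (comm_comp dT' dK).
  by move=> x y; rewrite kT' kI kJ JI IT' JT' IE !innerNr !opprK.
exists a, (- b), (- (e / 2)), (- f) => x; rewrite AB.
have T'K : T' x = - f%:C *: I (J x).
  have KK : I (J (I (J x))) = - x by rewrite JI IE II opprK JJ.
  have := fP (I (J x)); rewrite KK (linE (comm_bounded dT').1).
  by rewrite scaleNr => <-; rewrite opprK.
have -> : B x = T' x - (e / 2)%:C *: J x - b%:C *: I x by rewrite T'E TE !addrK.
by rewrite T'K !rmorphN; vec.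
Qed.

End Frobenius.

(** * Restriction to eigenspaces of an imaginary unit *)

Section DivisionIrreducible.
Context {R : realType} {G : groupType} {S : {pred G}} {H : hilbertType R}.
Variable U : G -> H -> H.
Hypotheses (auU : au_rep S U) (H0 : exists x : H, x != 0).

Local Notation D := (rep_commutant S U).

(** An invariant projection is an idempotent of the commutant. *)
Lemma irreducible_of_iso (A : lalgType R) :
  (forall a : A, a * a = a -> a = 0 \/ a = 1) -> real_algebra_iso A D ->
  irreducible_rep S U.
Proof.
move=> idem [phi [[pfun pinj psurj] pD pZ pM p1]].
apply: irreducible_of_commutant => // P /psurj[p _ <-] _ PP.
have p0 x : phi 0 x = 0 by apply: (@addrI _ (phi 0 x)); rewrite -pD !addr0.
have [|->|->] := idem p; [|by left|by right => x; rewrite p1].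
apply: pinj; rewrite ?inE// pM; apply/funext => x; exact: PP.
Qed.

End DivisionIrreducible.

(** A nonzero imaginary part [v] satisfies [2 a v = v], so [a = 1 / 2]; the real part
    [a^2 - |v|^2 = a] is then impossible. *)
Lemma quat_idempotent (R : realType) (q : quat R) : q * q = q -> q = 0 \/ q = 1.
Proof.
case: q => [[[a b] c] d]; rewrite quat_mulE => -[ea eb ec ed].
have [s0|s0] := eqVneq (b ^+ 2 + c ^+ 2 + d ^+ 2) 0.
  move/eqP: s0; rewrite !paddr_eq0 ?addr_ge0 ?sqr_ge0// !sqrf_eq0.
  move=> /andP[/andP[/eqP b0 /eqP c0] /eqP d0]; subst b c d.
  have : a * (a - 1) = 0 by rewrite mulrBr mulr1 -{3}ea; ring.
  by move/eqP; rewrite mulf_eq0 subr_eq0 => /orP[] /eqP ->; [left|right].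
have key (t : R) : 2 * a * t = t -> (2 * a - 1) * t ^+ 2 = 0.
  by move=> e; rewrite mulrBl mul1r expr2 mulrA e subrr.
have : (2 * a - 1) * (b ^+ 2 + c ^+ 2 + d ^+ 2) = 0.
  rewrite !mulrDr !key ?addr0//.
  - by rewrite -[RHS]ed; ring.
  - by rewrite -[RHS]ec; ring.
  - by rewrite -[RHS]eb; ring.
move/eqP; rewrite mulf_eq0 (negPf s0) orbF subr_eq0 => /eqP a2.
have aux (a' b' c' d' : R) : a' * a' - b' * b' - c' * c' - d' * d' = a' ->
    2 * a' = 1 -> False.
  have := sqr_ge0 b'; have := sqr_ge0 c'; have := sqr_ge0 d'; nra.
by case: (aux a b c d ea a2).
Qed.

Section IrreducibleIff.
Context {R : realType} {G : groupType} {G1 : {pred G}} {H : hilbertType R}.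
Hypothesis hG1 : index_two G1.
Variables (r : G) (U : G -> H -> H).
Hypotheses (hr : r \notin G1) (repU : antiunitary_rep G1 U).

Local Notation D := (rep_commutant predT U).

Lemma irreducible_antiunitaryP : irreducible_rep predT U <->
  [\/ real_algebra_iso R^o D, real_algebra_iso (Rcomplex R) D
    | real_algebra_iso (quat R) D].
Proof.
have auU := antiunitary_rep_au repU; have H0 := arep_neq0 repU hr.
split=> [irrU|].
  have [h|[I h]|[I [J h]]] := irreducible_presentation auU irrU.
  - by apply: Or31; exact: real_presentation_iso.
  - by apply: Or32; exact: complex_presentation_iso h.
  - by apply: Or33; exact: quaternion_presentation_iso h.
have idem (F : fieldType) (a : F) : a * a = a -> a = 0 \/ a = 1.
  move=> e; have : a * (a - 1) = 0 by rewrite mulrBr mulr1 e subrr.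
  by move/eqP; rewrite mulf_eq0 subr_eq0 => /orP[] /eqP ->; [left|right].
case; apply: irreducible_of_iso => //.
- by move=> a; exact: (idem R).
- by move=> a; exact: (idem R[i]).
- exact: quat_idempotent.
Qed.

End IrreducibleIff.

Section Eigenspace.
Context {R : realType} {H : hilbertType R} (I : H -> H).
Hypotheses (bI : bounded_linear I).

(** The eigenspace for [- 'i] is treated as [eig] of [- I], so that each fact is proved once. *)
Definition eig : closed_subspace H :=
  kernel (bounded_linearB bI (bounded_linear_scale H 'i%R)).

Lemma eigP x : eig x <-> I x = 'i%R *: x.
Proof.
by split=> [/kernelE/eqP|e]; [rewrite subr_eq0 => /eqP|apply/kernelE; rewrite e subrr].
Qed.

Hypotheses (II : forall x, I (I x) = - x) (kI : skew I).

Lemma eig_proj x : proj eig x = 2^-1 *: (x - 'i%R *: I x).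
Proof.
have IE := linE bI.1; apply: proj_uniq => [|z /eigP Iz].
  by apply/eigP; rewrite !IE II; veci R.
have e : inner (I x) z = 'i%R * inner x z.
  by rewrite kI Iz innerZr conjCi mulNr opprK.
by rewrite !innerE e; field: (@imag_sqr R).
Qed.

End Eigenspace.

Section Subrepresentation.
Context {R : realType} {G : groupType} {G1 : {pred G}} {H : hilbertType R}.
Hypothesis hG1 : index_two G1.
Variable U : G -> H -> H.
Hypothesis repU : unitary_rep G1 U.

(** [sproj] acts as a cast: it changes nothing when [U g] preserves [E], and makes the formula total
    in [g]. *)
Definition sub_rep (E : closed_subspace H) g (x : subsp E) : subsp E :=
  sproj E (U g (val x)).

Section OneSubspace.
Variable E : closed_subspace H.
Hypothesis EU : forall g, g \in G1 -> forall x, E x -> E (U g x).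

Lemma sub_rep_val g x : g \in G1 -> val (@sub_rep E g x) = U g (val x).
Proof. by move=> gG; apply: proj_id; apply: EU => //; exact: subsp_in. Qed.

Lemma sub_rep_unitary : unitary_rep G1 (@sub_rep E).
Proof.
split=> [g gG|g h gG hG]; last first.
  apply/funext => x; apply: val_inj => /=.
  by rewrite !sub_rep_val ?index2_M// (urepM repU).
have [L N _] := urep_op repU gG; split=> [a x y|x|y].
- by apply: val_inj; rewrite subspD subspZ !sub_rep_val// subspD subspZ L.
- by rewrite !subsp_normE sub_rep_val.
- exists (sub_rep (g^-1)%g y); apply: val_inj; rewrite !sub_rep_val ?index2_VE//.
  by have := urepVK hG1 repU (val y) (index2_V hG1 gG); rewrite invgK.
Qed.

Lemma sproj_U g x : g \in G1 -> sproj E (U g x) = sub_rep g (sproj E x).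
Proof.
move=> gG; apply: val_inj; rewrite sub_rep_val//.
have dP : rep_commutant G1 U (proj E).
  by apply: proj_comm EU; exact: unitary_rep_au.
exact: (comm_U x dP gG).
Qed.

(** A projection commuting with the subrepresentation, extended by 0 on the orthogonal complement,
    commutes with [U]; its compression is thus a scalar, equal to 0 or 1. *)
Lemma sub_rep_irreducible : (exists2 x, E x & x != 0) ->
  (forall A, rep_commutant G1 U A ->
     exists z : R[i], forall x, E x -> proj E (A x) = z *: x) ->
  irreducible_rep G1 (@sub_rep E).
Proof.
move=> [x0 Ex0 x00] hM.
pose y0 : subsp E := Subsp (asboolT Ex0).
have y00 : y0 != 0 by apply: contra_neq x00 => /(congr1 val).
apply: irreducible_of_commutant; first exact: unitary_rep_au sub_rep_unitary.
  by exists y0.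
move=> P dP _ PP.
have [|z zP] := hM (fun x => val (P (sproj E x))).
  apply/rep_commutantP; split=> [|g gG x].
    apply: bounded_linear_comp; first exact: val_bounded.
    by apply: bounded_linear_comp; [exact: comm_bounded dP|exact: sproj_bounded].
  by rewrite sproj_U// (comm_U _ dP)// sub_rep_val.
have Pz y : P y = z *: y.
  apply: val_inj; rewrite subspZ -zP; last exact: subsp_in.
  by rewrite sproj_val proj_val.
have : (z * (z - 1)) *: y0 = 0.
  by have := PP y0; rewrite !Pz scalerA => e; rewrite mulrBr mulr1 scalerBl e subrr.
move/eqP; rewrite scaler_eq0 (negPf y00) orbF mulf_eq0 subr_eq0.
by case/orP => /eqP z01; [left|right] => y; rewrite Pz z01 ?scale0r ?scale1r.
Qed.

End OneSubspace.

Lemma intertwiner_commutant (E F : closed_subspace H) (T : subsp E -> subsp F) :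
  (forall g, g \in G1 -> forall x, E x -> E (U g x)) ->
  (forall g, g \in G1 -> forall x, F x -> F (U g x)) ->
  bounded_linear T -> (forall g, g \in G1 -> forall x, T (sub_rep g x) = sub_rep g (T x)) ->
  rep_commutant G1 U (fun x => val (T (sproj E x))).
Proof.
move=> EU FU bT TU; apply/rep_commutantP; split=> [|g gG x].
  apply: bounded_linear_comp; first exact: val_bounded.
  by apply: bounded_linear_comp => //; exact: sproj_bounded.
by rewrite sproj_U// TU// sub_rep_val.
Qed.

Lemma sum_decomposition (E F : closed_subspace H) :
  (forall g, g \in G1 -> forall x, E x -> E (U g x)) ->
  (forall g, g \in G1 -> forall x, F x -> F (U g x)) ->
  (forall x, proj E x + proj F x = x) ->
  (forall x, F x -> proj E x = 0) -> (forall x, E x -> proj F x = 0) ->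
  equivalent_rep G1 U (sum_rep (@sub_rep E) (@sub_rep F)).
Proof.
move=> EU FU EF1 EF FE.
exists (fun x => (sproj E x, sproj F x) : hsum (subsp E) (subsp F)); last first.
  by move=> g gG; apply/funext => x /=; rewrite /sum_rep /= !sproj_U.
split=> [a x y|x|[y z]].
- congr pair; first exact: sproj_linear.
  exact: sproj_linear.
- apply: norm_eq_inner; rewrite hsum_innerE.
  rewrite -[LHS]/(inner (proj E x) (proj E x) + inner (proj F x) (proj F x)).
  rewrite !proj_adj !proj_proj -innerDr.
  by rewrite EF1.
- exists (val y + val z).
  have EL := linE (sproj_linear E); have FL := linE (sproj_linear F).
  congr pair; rewrite ?EL ?FL sproj_val.
    rewrite (_ : sproj E (val z) = 0) ?addr0//; apply: val_inj.
    by rewrite subsp0; apply: EF; exact: subsp_in.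
  rewrite (_ : sproj F (val y) = 0) ?add0r//; apply: val_inj.
  by rewrite subsp0; apply: FE; exact: subsp_in.
Qed.

End Subrepresentation.

(** * The commutant of [G1] for each type of commutant of [G] *)

Section Commutant.
Context {R : realType} {G : groupType} {G1 : {pred G}} {H : hilbertType R}.
Hypothesis hG1 : index_two G1.
Variables (r : G) (U : G -> H -> H).
Hypotheses (hr : r \notin G1) (repU : antiunitary_rep G1 U).

Local Notation D := (rep_commutant predT U).
Local Notation M := (rep_commutant G1 U).

Let auU := antiunitary_rep_au repU.
Let uniU := antiunitary_rep_unitary repU.
Let auU1 := unitary_rep_au hG1 uniU.
Let uU : forall g, g \in G1 -> unitary_op (U g) := arep_unitary repU.

Lemma real_commutant A : real_presentation D -> M A ->
  exists z : R[i], forall x, A x = z *: x.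
Proof.
move=> hD /(commutant_split hG1 repU hr)[B [C [/hD[b bB] /hD[c cC] ABC]]].
by exists (b%:C + 'i%R * c%:C) => x; rewrite ABC bB cC; vec.
Qed.

Lemma complex_commutant I A : complex_presentation D I -> M A ->
  exists z w : R[i], forall x, A x = z *: x + w *: I x.
Proof.
move=> [_ _ hD] /(commutant_split hG1 repU hr)[B [C [/hD[b [b' bB]] /hD[c [c' cC]] ABC]]].
by exists (b%:C + 'i%R * c%:C), (b'%:C + 'i%R * c'%:C) => x; rewrite ABC bB cC; vec.
Qed.

Lemma complex_commutant_comm I A B : complex_presentation D I -> M A -> M B ->
  forall x, A (B x) = B (A x).
Proof.
move=> hI /(complex_commutant hI)[z [w zwA]] /(complex_commutant hI)[z' [w' zwB]] x.
have [dI _ _] := hI; rewrite zwA zwB [RHS]zwB zwA !(linE (comm_bounded dI).1).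
by vec.
Qed.

Lemma quaternion_commutant I J A : quaternion_presentation D I J -> M A ->
  exists z0 z1 z2 z3 : R[i], forall x,
    A x = z0 *: x + z1 *: I x + z2 *: J x + z3 *: I (J x).
Proof.
move=> [_ _ _ hD] /(commutant_split hG1 repU hr)[B [C [/hD hB /hD hC ABC]]].
have [b0 [b1 [b2 [b3 bB]]]] := hB; have [c0 [c1 [c2 [c3 cC]]]] := hC.
exists (b0%:C + 'i%R * c0%:C), (b1%:C + 'i%R * c1%:C), (b2%:C + 'i%R * c2%:C),
  (b3%:C + 'i%R * c3%:C) => x.
by rewrite ABC bB cC; vec.
Qed.

Lemma real_presentation_scalar : real_presentation D ->
  complex_algebra_iso R[i]^o M /\ irreducible_rep G1 U.
Proof.
move=> hD; have H0 := arep_neq0 repU hr; have [x0 x00] := H0; split.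
  exists (fun z x => z *: x); split.
  - split=> [a _|a b _ _ /(congr1 (@^~ x0)) /= /eqP|A /(real_commutant hD)[a aA]].
    + exact: comm_scale.
    + by rewrite -subr_eq0 -scalerBl scaler_eq0 (negPf x00) orbF subr_eq0 => /eqP.
    + by exists a => //; apply/funext => x; rewrite aA.
  - by move=> a b x; rewrite scalerDl.
  - by move=> k a x; rewrite scalerA.
  - by move=> a b; apply/funext => x /=; rewrite scalerA.
  - by apply/funext => x; rewrite scale1r.
apply: irreducible_of_commutant => // P /(real_commutant hD)[z zP] _ PP.
have : (z * (z - 1)) *: x0 = 0.
  by have := PP x0; rewrite !zP scalerA => e; rewrite mulrBr mulr1 scalerBl e subrr.
move/eqP; rewrite scaler_eq0 (negPf x00) orbF mulf_eq0 subr_eq0.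
by case/orP => /eqP z01; [left|right] => y; rewrite zP z01 ?scale0r ?scale1r.
Qed.

Section ImaginaryUnit.
Variable I : H -> H.
Hypotheses (dI : D I) (bI : bounded_linear I) (II : forall x, I (I x) = - x).

(** Otherwise [I] would be the scalar [- 'i], which does not commute with the antiunitary [U r]. *)
Lemma eig_neq0 : exists2 x, eig bI x & x != 0.
Proof.
have [x0 x00] := arep_neq0 repU hr; have IE := linE bI.1.
have aE := antiE (let: And3 L _ _ := arep_antiunitary repU hr in L).
apply: contrapT => h.
have P0 x : x - 'i%R *: I x = 0.
  apply/eqP; apply: contrapT => /negP x1; apply: h.
  exists (x - 'i%R *: I x) => //; apply/eigP; rewrite !IE II; veci R.
have Ix x : I x = - 'i%R *: x.
  by rewrite -[in RHS](subr0 x) -(P0 x) opprB addrC subrK; veci R.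
have := comm_U x0 dI (isT : r \in predT); rewrite !Ix aE conj_opp_i.
move=> /eqP; rewrite -subr_eq0 -scalerBl -opprD -mulr2n -mulr_natl.
rewrite scaler_eq0 oppr_eq0 mulf_eq0 pnatr_eq0 (negPf (neq0Ci _)) /=.
by move=> /eqP/(au_eq0 (arep_au repU r))/eqP; rewrite (negPf x00).
Qed.

Lemma eig_invariant g : g \in G1 -> forall x, eig bI x -> eig bI (U g x).
Proof.
move=> gG x /eigP Ix; apply/eigP; rewrite (comm_U x dI)// Ix.
by have [L _ _] := uU gG; rewrite (linE L).
Qed.

(* For the extension [V] of the restriction to the [i]-eigenspace, [U_r] and
   [V_r] differ by a [G1]-intertwiner between the two eigenspaces. *)
Lemma eig_extension (V : G -> subsp (eig bI) -> subsp (eig bI)) :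
  antiunitary_rep G1 V -> extension_of G1 (@sub_rep _ _ _ U (eig bI)) V ->
  exists A, [/\ M A, forall x, I (A x) = - 'i%R *: A x
    & forall y, A (val (V r y)) = U r (val y)].
Proof.
move=> repV extV; set E := eig bI in V repV extV *.
have EU := eig_invariant.
have aE := antiE (let: And3 L _ _ := arep_antiunitary repU hr in L).
have rVG : (r^-1)%g \notin G1 by rewrite index2_VE.
have aVE := antiE (let: And3 L _ _ := arep_antiunitary repV rVG in L).
have SE := linE (sproj_linear E).
exists (fun x => U r (val (V (r^-1)%g (sproj E x)))); split.
- apply/rep_commutantP; split=> [|g gG x].
    split=> [a x y|]; last first.
      exists 1 => x; rewrite mul1r (au_norm (arep_au repU r)) -subsp_normE.
      by rewrite (au_norm (arep_au repV _)) subsp_normE proj_norm.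
    by rewrite !SE !aVE subspD subspZ !aE conjCK.
  rewrite (sproj_U hG1 uniU)//.
  have rgr : (r^-1 * g * r)%g \in G1 by rewrite index2_MN// index2_Mr.
  rewrite -extV// -(arepM repV) -(mulgK r (r^-1 * g)%g) (arepM repV) extV//.
  rewrite (sub_rep_val _ _ rgr)//.
  by rewrite -(arepM repU) !mulgA mulgV mul1g (arepM repU).
- move=> x; rewrite (comm_U _ dI)//.
  by have /eigP -> := subsp_in (V (r^-1)%g (sproj E x)); rewrite aE conjCi.
- by move=> y; rewrite sproj_val (arepVK repV).
Qed.

End ImaginaryUnit.

(** The operator [A] from [eig_extension] is a combination of 1 and [I], so it preserves the
    eigenspace of [I] that it is supposed to leave; this forces [U r] to vanish there. *)
Lemma complex_not_extendable I (bI : bounded_linear I) : complex_presentation D I ->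
  ~ extendable G1 (@sub_rep _ _ _ U (eig bI)).
Proof.
move=> hI [V [repV extV]]; have [dI II _] := hI.
have [A [mA IA AV]] := eig_extension dI repV extV.
have [x Ex x0] := eig_neq0 dI bI II; have IE := linE bI.1.
have [z [w zwA]] := complex_commutant hI mA.
have IAx (y : subsp (eig bI)) : I (A (val y)) = 'i%R *: A (val y).
  have /eigP Iy := subsp_in y.
  by rewrite zwA Iy !IE Iy; vec.
pose y : subsp (eig bI) := Subsp (asboolT Ex).
have Urx : U r x = 0.
  have := IAx (V r y); rewrite IA AV /= => /eqP; rewrite eq_sym -subr_eq0 -scalerBl opprK.
  rewrite scaler_eq0 -mulr2n -mulr_natl mulf_eq0 pnatr_eq0 (negPf (neq0Ci _)) /=.
  by move=> /eqP.
by rewrite (au_eq0 (arep_au repU r) Urx) eqxx in x0.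
Qed.

(** On the eigenspace [A = w J], so [U_r = w J V_r]. Applying this twice, with [U_r] antilinear and
    [J^2 = -1], gives [U_r U_r = - |w|^2 U_r U_r] there. *)
Lemma quaternion_not_extendable I J (bI : bounded_linear I) :
  quaternion_presentation D I J -> ~ extendable G1 (@sub_rep _ _ _ U (eig bI)).
Proof.
move=> hIJ [V [repV extV]]; have [[dI dJ] [II JJ] JI _] := hIJ.
have [A [mA IA AV]] := eig_extension dI repV extV.
have [x Ex x0] := eig_neq0 dI bI II; have IE := linE bI.1.
have JE := linE (comm_bounded dJ).1.
have aE := antiE (let: And3 L _ _ := arep_antiunitary repU hr in L).
have [z0 [z1 [z2 [z3 zA]]]] := quaternion_commutant hIJ mA.
pose w := z2 - 'i%R * z3.
have AJ (y : subsp (eig bI)) : A (val y) = w *: J (val y).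
  have /eigP Iy := subsp_in y.
  have IJy : I (J (val y)) = - 'i%R *: J (val y).
    by rewrite -[LHS]opprK -JI Iy JE scaleNr.
  have Ay : A (val y) = (z0 + 'i%R * z1) *: val y + w *: J (val y).
    by rewrite zA Iy IJy /w; vec.
  (* The subtracted term is the component of [A y] in the eigenspace for ['i]; it is 0, and removing
     it from the expression [Ay] deletes the multiple of [y]. *)
  suff -> : A (val y) = A (val y) - 2^-1 *: (A (val y) - 'i%R *: I (A (val y))).
    rewrite !Ay !IE Iy IJy.
    by apply: inner_inj => v; rewrite !innerE; field: (@imag_sqr R).
  by rewrite IA; apply: inner_inj => v; rewrite !innerE; field: (@imag_sqr R).
pose y : subsp (eig bI) := Subsp (asboolT Ex).
have rr : (r * r)%g \in G1 by exact: index2_MN.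
have e1 : w *: J (val (V r y)) = U r x by rewrite -AJ AV.
have e2 : w *: J (U r (U r x)) = U r (val (V r y)).
  rewrite -AV AJ; congr (_ *: J _).
  by rewrite -(arepM repU) -(arepM repV) extV// (sub_rep_val (@eig_invariant I dI bI) _ rr).
have : (1 + w * Num.conj w) *: U r (U r x) = 0.
  have <- : U r (U r x) - U r (w *: J (val (V r y))) = (1 + w * Num.conj w) *: U r (U r x).
    rewrite aE -(comm_U _ dJ)// -e2 JE JJ; vec.
  by rewrite e1 subrr.
move/eqP; rewrite scaler_eq0 gt_eqF /=; last first.
  by rewrite ltr_wpDr// -normCK exprn_ge0.
by move=> /eqP/(au_eq0 (arep_au repU r))/(au_eq0 (arep_au repU r)) x00; rewrite x00 eqxx in x0.
Qed.

Lemma complex_presentationN I : complex_presentation D I ->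
  complex_presentation D (fun x => - I x).
Proof.
move=> [dI II hD]; have IE := linE (comm_bounded dI).1; split=> [|x|A /hD[a [b abA]]].
- exact: (commN auU).
- by rewrite IE II opprK.
- by exists a, (- b) => x; rewrite abA rmorphN; vec.
Qed.

Lemma quaternion_presentationN I J : quaternion_presentation D I J ->
  quaternion_presentation D (fun x => - I x) J.
Proof.
move=> [[dI dJ] [II JJ] JI hD]; have IE := linE (comm_bounded dI).1.
have JE := linE (comm_bounded dJ).1.
split=> [||x|A /hD[a [b [c [d abA]]]]].
- by split=> //; exact: (commN auU).
- by split=> // x; rewrite IE II opprK.
- by rewrite JE JI.
- by exists a, (- b), c, (- d) => x; rewrite abA !rmorphN; vec.
Qed.

Lemma complex_eig_scalar I (bI : bounded_linear I) : complex_presentation D I ->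
  forall A, M A -> exists z : R[i], forall x, eig bI x -> proj (eig bI) (A x) = z *: x.
Proof.
move=> hI A /(complex_commutant hI)[z [w zwA]]; exists (z + w * 'i%R) => x Ex.
have /eigP Ix := Ex; rewrite zwA Ix scalerA -scalerDl.
by rewrite (linE (proj_linear _)) proj_id.
Qed.

(** [J] and [I J] send the eigenspace into its orthogonal complement, so the compression only sees
    [z0 + z1 I]. *)
Lemma quaternion_eig_scalar I J (bI : bounded_linear I) : skew I ->
  quaternion_presentation D I J ->
  forall A, M A -> exists z : R[i], forall x, eig bI x -> proj (eig bI) (A x) = z *: x.
Proof.
move=> kI hIJ A /(quaternion_commutant hIJ)[z0 [z1 [z2 [z3 zA]]]].
have [[dI dJ] [II JJ] JI _] := hIJ; have JE := linE (comm_bounded dJ).1.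
have IE := linE bI.1.
exists (z0 + z1 * 'i%R) => x /eigP Ix.
have IJx : I (J x) = - 'i%R *: J x by rewrite -[LHS]opprK -JI Ix JE scaleNr.
rewrite eig_proj// zA !IE !IJx !Ix !IE !IJx !Ix.
by apply: inner_inj => v; rewrite !innerE; field: (@imag_sqr R).
Qed.

Lemma complex_presentation_iso_prod I : complex_presentation D I ->
  complex_algebra_iso (R[i]^o * R[i]^o)%type M.
Proof.
move=> hI; have [dI II hD] := hI; have bI := comm_bounded dI; have IE := linE bI.1.
have [x Ex x0] := eig_neq0 dI bI II; have /eigP Ix := Ex.
have hI' := complex_presentationN hI; have [dI' II' _] := hI'.
have [y Ey y0] := eig_neq0 dI' (bounded_linearN bI) II'; have /eigP Iy := Ey.
have {Iy} Iy : I y = - 'i%R *: y by rewrite scaleNr -Iy opprK.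
(* The coordinates are the scalars by which the operator acts on the eigenspaces of [I] for ['i] and
   [- 'i]; [x] and [y] detect them. *)
pose phi (p : R[i]^o * R[i]^o) v :=
  p.1 *: (2^-1 *: (v - 'i%R *: I v)) + p.2 *: (2^-1 *: (v + 'i%R *: I v)).
have phix p : phi p x = p.1 *: x.
  by rewrite /phi Ix; apply: inner_inj => v; rewrite !innerE; field: (@imag_sqr R).
have phiy p : phi p y = p.2 *: y.
  by rewrite /phi Iy; apply: inner_inj => v; rewrite !innerE; field: (@imag_sqr R).
exists phi; split.
- split=> [p _|p q _ _ pq|A /(complex_commutant hI)[z [w zwA]]].
  + have mI := @commutant_sub _ _ G1 _ _ _ dI.
    apply: (commD auU1); apply: (commZ uU); apply: (commZ uU).
      by apply: (commB auU1); [exact: comm_id|exact: (commZ uU)].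
    by apply: (commD auU1); [exact: comm_id|exact: (commZ uU)].
  + have /eqP := congr1 (@^~ x) pq; have /eqP := congr1 (@^~ y) pq.
    rewrite !phix !phiy -subr_eq0 -scalerBl scaler_eq0 (negPf y0) orbF subr_eq0 => /eqP e2.
    rewrite -subr_eq0 -scalerBl scaler_eq0 (negPf x0) orbF subr_eq0 => /eqP e1.
    by move: p q e1 e2 {pq} => [? ?] [? ?] /= -> ->.
  + exists (z + 'i%R * w, z - 'i%R * w) => //; apply/funext => v; rewrite zwA /phi /=.
    by apply: inner_inj => u; rewrite !innerE; field: (@imag_sqr R).
- by move=> p q v; rewrite /phi /=; vec.
- by move=> k p v; rewrite /phi /= -![k *: (_ : R[i]^o)]/(k * _); vec.
- move=> p q; apply/funext => v; rewrite /phi /= !IE II.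
  by apply: inner_inj => u; rewrite !innerE; field: (@imag_sqr R).
- apply/funext => v; rewrite /phi /=.
  by apply: inner_inj => u; rewrite !innerE; field.
Qed.

Lemma quaternion_presentation_iso_mx I J : quaternion_presentation D I J ->
  complex_algebra_iso 'M[R[i]]_2 M.
Proof.
move=> hIJ; have [[dI dJ] [II JJ] JI hD] := hIJ; have bI := comm_bounded dI.
have IE := linE bI.1; have JE := linE (comm_bounded dJ).1.
have [x Ex x0] := eig_neq0 dI bI II; have /eigP Ix := Ex.
have IJx : I (J x) = - 'i%R *: J x by rewrite -[LHS]opprK -JI Ix JE scaleNr.
have Jx0 : J x != 0.
  apply: contra_neq x0 => Jx0; apply: oppr_inj; rewrite oppr0 -JJ Jx0.
  by rewrite (linE (comm_bounded dJ).1).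
pose P v := 2^-1 *: (v - 'i%R *: I v); pose Q v := 2^-1 *: (v + 'i%R *: I v).
(* Matrices act on the pair [x], [J x] for [x] in the eigenspace for ['i], column by column; since
   [J^2 = -1], the map from [J x] back to [x] is [- J], whence the sign. *)
pose phi (m : 'M[R[i]]_2) v :=
  m 0 0 *: P v - m 0 1 *: P (J v) + m 1 0 *: J (P v) + m 1 1 *: Q v.
have phix m : phi m x = m 0 0 *: x + m 1 0 *: J x.
  rewrite /phi /P /Q IJx Ix !JE.
  by apply: inner_inj => v; rewrite !innerE; field: (@imag_sqr R).
have phiJ m : phi m (J x) = m 0 1 *: x + m 1 1 *: J x.
  rewrite /phi /P /Q JJ !IE IJx Ix !JE JJ.
  by apply: inner_inj => v; rewrite !innerE; field: (@imag_sqr R).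
have indep (a b : R[i]) : a *: x + b *: J x = 0 -> a = 0 /\ b = 0.
  move=> e; have e' : a *: x - b *: J x = 0.
    have <- : - 'i%R *: I (a *: x + b *: J x) = a *: x - b *: J x.
      by rewrite !IE IJx Ix; veci R.
    by rewrite e IE scaler0.
  have /eqP : (2 * a) *: x = 0.
    by rewrite -[RHS](addr0 (0 : H)) -{1}e -e'; vec.
  have /eqP : (2 * b) *: J x = 0.
    by rewrite -[RHS](subr0 (0 : H)) -{1}e -e'; vec.
  rewrite !scaler_eq0 ?mulf_eq0 pnatr_eq0 (negPf x0) (negPf Jx0) !orbF /=.
  by move=> /eqP -> /eqP ->.
exists phi; split.
- split=> [m _|m n _ _ mn|A /(quaternion_commutant hIJ)[z0 [z1 [z2 [z3 zA]]]]].
  + have mI := @commutant_sub _ _ G1 _ _ _ dI; have mJ := @commutant_sub _ _ G1 _ _ _ dJ.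
    have mP : M P by apply: (commZ uU); apply: (commB auU1); [exact: comm_id|exact: (commZ uU)].
    have mQ : M Q by apply: (commZ uU); apply: (commD auU1); [exact: comm_id|exact: (commZ uU)].
    apply: (commD auU1); last exact: (commZ uU).
    apply: (commD auU1); last by apply: (commZ uU); exact: comm_comp.
    apply: (commB auU1); first exact: (commZ uU).
    by apply: (commZ uU); exact: comm_comp.
  + have ex := congr1 (@^~ x) mn; have ey := congr1 (@^~ (J x)) mn.
    rewrite /= !phix !phiJ in ex ey.
    have [] := indep (m 0 0 - n 0 0) (m 1 0 - n 1 0).
      by rewrite !scalerBl addrACA -opprD ex subrr.
    move=> /eqP; rewrite subr_eq0 => /eqP e00 /eqP; rewrite subr_eq0 => /eqP e10.
    have [] := indep (m 0 1 - n 0 1) (m 1 1 - n 1 1).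
      by rewrite !scalerBl addrACA -opprD ey subrr.
    move=> /eqP; rewrite subr_eq0 => /eqP e01 /eqP; rewrite subr_eq0 => /eqP e11.
    have ord2 (i : 'I_2) : i = 0 \/ i = 1.
      by case: i => [[|[|//]] ?]; [left|right]; exact: val_inj.
    by apply/matrixP => i j; have [->|->] := ord2 i; have [->|->] := ord2 j.
  (* The columns are the coordinates of [A x] and [A (J x)] in terms of [x] and [J x], with
     [I x = 'i x] and [I (J x) = - 'i J x]. *)
  + exists (\matrix_(i < 2, j < 2)
      if i == 0 then if j == 0 then z0 + 'i%R * z1 else - z2 - 'i%R * z3
      else if j == 0 then z2 - 'i%R * z3 else z0 - 'i%R * z1) => //.
    apply/funext => v; rewrite zA /phi !mxE /= /P /Q !JE JI.
    by apply: inner_inj => u; rewrite !innerE; field: (@imag_sqr R).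
- by move=> m n v; rewrite /phi !mxE; vec.
- by move=> k m v; rewrite /phi !mxE /=; vec.
- move=> m n; apply/funext => v.
  have mnE i j : (m * n) i j = m i 0 * n 0 j + m i 1 * n 1 j.
    by rewrite mxE !big_ord_recl big_ord0 addr0; congr (_ + m i _ * n _ j); exact: val_inj.
  have PL : linear P by move=> a u w; rewrite /P !IE; vec.
  have QL : linear Q by move=> a u w; rewrite /Q !IE; vec.
  have PP u : P (P u) = P u.
    by rewrite /P !IE II; apply: inner_inj => w; rewrite !innerE; field: (@imag_sqr R).
  have QQ u : Q (Q u) = Q u.
    by rewrite /Q !IE II; apply: inner_inj => w; rewrite !innerE; field: (@imag_sqr R).
  have PQ u : P (Q u) = 0.
    by rewrite /P /Q !IE II; apply: inner_inj => w; rewrite !innerE; field: (@imag_sqr R).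
  have QP u : Q (P u) = 0.
    by rewrite /P /Q !IE II; apply: inner_inj => w; rewrite !innerE; field: (@imag_sqr R).
  have JP u : J (P u) = Q (J u) by rewrite /P /Q !JE JI; vec.
  have JQ u : J (Q u) = P (J u) by rewrite /P /Q !JE JI; vec.
  (* Only the relations between [P], [Q] and [J] matter from here on; abstracting [P] and [Q] lets
     them serve as rewrite rules. *)
  rewrite /phi /= !mnE; move: P Q PL QL PP QQ PQ QP JP JQ {phi phix phiJ}.
  move=> P Q /linE PE /linE QE PP QQ PQ QP JP JQ.
  by rewrite !(PE, QE, JE, JP, JQ, JJ, PP, QQ, PQ, QP); vec.
- apply/funext => v; rewrite /phi !mxE /= /P /Q.
  by apply: inner_inj => u; rewrite !innerE; field.
Qed.

End Commutant.

(** * Splitting the restriction to [G1] into two irreducible summands *)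

Section Decomposition.
Context {R : realType} {G : groupType} {G1 : {pred G}} {H : hilbertType R}.
Hypothesis hG1 : index_two G1.
Variables (r : G) (U : G -> H -> H).
Hypotheses (hr : r \notin G1) (repU : antiunitary_rep G1 U).

Local Notation D := (rep_commutant predT U).
Local Notation M := (rep_commutant G1 U).

Let auU := antiunitary_rep_au repU.
Let uniU := antiunitary_rep_unitary repU.

Section ImaginaryUnit.
Variable I : H -> H.
Hypotheses (dI : D I) (II : forall x, I (I x) = - x) (kI : skew I).

Let bI : bounded_linear I := comm_bounded dI.
Let nI x := - I x.
Let bN : bounded_linear nI := bounded_linearN bI.
Let dN : D nI := commN auU dI.
Let NN x : nI (nI x) = - x.
Proof. by rewrite /nI (linE bI.1) II opprK. Qed.
Let kN : skew nI.
Proof. by move=> x y; rewrite /nI innerNl kI innerNr. Qed.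

Let E := eig bI.
Let F := eig bN.
Let W1 := @sub_rep _ _ _ U E.
Let W2 := @sub_rep _ _ _ U F.

Let EU := @eig_invariant R G G1 H U repU I dI bI.
Let FU := @eig_invariant R G G1 H U repU nI dN bN.

Lemma eigN_proj x : proj F x = 2^-1 *: (x + 'i%R *: I x).
Proof. by rewrite eig_proj// /nI scalerN opprK. Qed.

Lemma eig_equivalent_sum : equivalent_rep G1 U (sum_rep W1 W2).
Proof.
apply: sum_decomposition => // [x|x /eigP Fx|x /eigP Ex].
- by rewrite eigN_proj eig_proj//; apply: inner_inj => z; rewrite !innerE; field.
- have Ix : I x = - 'i%R *: x by rewrite scaleNr -Fx opprK.
  by rewrite eig_proj// Ix; apply: inner_inj => z; rewrite !innerE; field: (@imag_sqr R).
- by rewrite eigN_proj Ex; apply: inner_inj => z; rewrite !innerE; field: (@imag_sqr R).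
Qed.

Lemma complex_decomposition : complex_presentation D I ->
  exists (K1 K2 : hilbertType R) (W1 : G -> K1 -> K1) (W2 : G -> K2 -> K2),
    [/\ unitary_rep G1 W1 /\ unitary_rep G1 W2,
        irreducible_rep G1 W1 /\ irreducible_rep G1 W2,
        ~ equivalent_rep G1 W1 W2,
        ~ extendable G1 W1 /\ ~ extendable G1 W2
      & equivalent_rep G1 U (sum_rep W1 W2)].
Proof.
move=> hI; have hN := complex_presentationN repU hI.
exists (subsp E), (subsp F), W1, W2; split.
- by split; apply: sub_rep_unitary.
- split; apply: sub_rep_irreducible => //.
  + exact: (eig_neq0 hr repU dI bI II).
  + exact: (complex_eig_scalar hG1 hr repU bI hI).
  + exact: (eig_neq0 hr repU dN bN NN).
  + exact: (complex_eig_scalar hG1 hr repU bN hN).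
(* Extended by 0, an equivalence lies in the commutant of [G1], so it is a combination of 1 and [I]
   and preserves [E]; but its values lie in [F]. *)
- move=> [T uT TU].
  have mT : M (fun x => val (T (sproj E x))).
    apply: intertwiner_commutant => //; first exact: unitary_bounded.
    by move=> g /TU/(congr1 (@^~ _)).
  have [x Ex x0] := eig_neq0 hr repU dI bI II.
  have [z [w zwT]] := complex_commutant hG1 hr repU hI mT.
  have /eigP Ix := Ex.
  have /eigP Fv := subsp_in (T (sproj E x)).
  have Ev : I (val (T (sproj E x))) = 'i%R *: val (T (sproj E x)).
    by rewrite zwT Ix !(linE bI.1) Ix; vec.
  have v0 : val (T (sproj E x)) = 0.
    move: Fv; rewrite /nI Ev => /eqP; rewrite eq_sym -addr_eq0 -scalerDl.
    rewrite -mulr2n -mulr_natl scaler_eq0 mulf_eq0 pnatr_eq0 (negPf (neq0Ci _)) /=.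
    by move/eqP.
  have Tx : T (sproj E x) = 0 by apply: val_inj; rewrite v0 subsp0.
  have : proj E x = 0 := congr1 val (au_eq0 (or_introl uT) Tx).
  by rewrite proj_id// => /eqP; rewrite (negPf x0).
- split.
  + exact: (complex_not_extendable hG1 hr repU hI).
  + exact: (complex_not_extendable hG1 hr repU hN).
- exact: eig_equivalent_sum.
Qed.

Lemma quaternion_decomposition J : skew J -> quaternion_presentation D I J ->
  exists (K1 K2 : hilbertType R) (W1 : G -> K1 -> K1) (W2 : G -> K2 -> K2),
    [/\ unitary_rep G1 W1 /\ unitary_rep G1 W2,
        irreducible_rep G1 W1 /\ irreducible_rep G1 W2,
        equivalent_rep G1 W1 W2,
        ~ extendable G1 W1 /\ ~ extendable G1 W2
      & equivalent_rep G1 U (sum_rep W1 W2)].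
Proof.
move=> kJ hIJ; have hN := quaternion_presentationN repU hIJ.
have [[_ dJ] [_ JJ] JI _] := hIJ.
have bJ := comm_bounded dJ; have JE := linE bJ.1.
exists (subsp E), (subsp F), W1, W2; split.
- by split; apply: sub_rep_unitary.
- split; apply: sub_rep_irreducible => //.
  + exact: (eig_neq0 hr repU dI bI II).
  + exact: (quaternion_eig_scalar hG1 hr repU bI kI hIJ).
  + exact: (eig_neq0 hr repU dN bN NN).
  + exact: (quaternion_eig_scalar hG1 hr repU bN kN hN).
(* [J] anticommutes with [I], hence exchanges the eigenspaces, and it is isometric because it is
   skew with square -1. *)
- have EJ (x : subsp E) : F (J (val x)).
    by apply/eigP; have /eigP Ix := subsp_in x; rewrite /nI -JI Ix JE.
  have FJ (y : subsp F) : E (J (val y)).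
    apply/eigP; have /eigP Iy := subsp_in y.
    by rewrite -[LHS]opprK -JI -[- J _]JE.1.2 -/(nI _) Iy JE.
  have vJ (x : subsp E) : val (sproj F (J (val x))) = J (val x) by apply: proj_id.
  exists (fun x => sproj F (J (val x))).
    split=> [a x y|x|y].
    - by apply: val_inj; rewrite vJ !subspD !subspZ !vJ bJ.1.
    - apply: norm_eq_inner; rewrite !subsp_innerE vJ kJ JJ innerNr opprK//.
    - exists (sproj E (- J (val y))); apply: val_inj; rewrite vJ -/(proj _ _) proj_id.
        by rewrite JE JJ opprK.
      by rewrite -scaleN1r -[_ *: _]addr0; apply: csubP => //; exact: csub0.
  move=> g gG; apply/funext => x /=; apply: val_inj; rewrite vJ.
  rewrite (sub_rep_val FU)// vJ (sub_rep_val EU)// (comm_U _ dJ)//.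
- split.
  + exact: (quaternion_not_extendable hG1 hr repU hIJ).
  + exact: (quaternion_not_extendable hG1 hr repU hN).
- exact: eig_equivalent_sum.
Qed.

End ImaginaryUnit.
End Decomposition.

(** * Extensions *)

Section HilbertSumMaps.
Context {R : realType} {H K : hilbertType R}.

Definition hinl (x : H) : hsum H K := (x, 0).
Definition hinr (y : K) : hsum H K := (0, y).

Lemma hsumE (v : hsum H K) : v = hinl v.1 + hinr v.2.
Proof. by case: v => x y; congr pair; rewrite /= ?addr0 ?add0r. Qed.

Lemma hinl_bounded : bounded_linear hinl.
Proof.
split=> [a x y|]; first by congr pair; rewrite /= ?scaler0 ?addr0.
exists 1 => x; rewrite mul1r (_ : `|hinl x| = `|x|)//.
by apply: norm_eq_inner; rewrite hsum_innerE /= inner0l addr0.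
Qed.

Lemma hinr_bounded : bounded_linear hinr.
Proof.
split=> [a x y|]; first by congr pair; rewrite /= ?scaler0 ?addr0.
exists 1 => x; rewrite mul1r (_ : `|hinr x| = `|x|)//.
by apply: norm_eq_inner; rewrite hsum_innerE /= inner0l add0r.
Qed.

Lemma hfst_bounded : bounded_linear (fst : hsum H K -> H).
Proof.
split=> [a x y//|]; exists 1 => x; rewrite mul1r.
rewrite -(@ler_pXn2r _ 2) ?nnegrE// -!inner_norm hsum_innerE lerDl.
exact: dnorm_ge0.
Qed.

Lemma hsnd_bounded : bounded_linear (snd : hsum H K -> K).
Proof.
split=> [a x y//|]; exists 1 => x; rewrite mul1r.
rewrite -(@ler_pXn2r _ 2) ?nnegrE// -!inner_norm hsum_innerE lerDr.
exact: dnorm_ge0.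
Qed.

Lemma hinl_eq0 x : (hinl x == 0) = (x == 0).
Proof. by apply/eqP/eqP => [/(congr1 fst)|->]. Qed.

Lemma hinr_eq0 x : (hinr x == 0) = (x == 0).
Proof. by apply/eqP/eqP => [/(congr1 snd)|->]. Qed.

End HilbertSumMaps.

Arguments hinl {R H} K x.
Arguments hinr {R} H {K} y.

Section DualOperators.
Context {R : realType} {H : hilbertType R}.

Lemma riesz_antiunitary : antiunitary_op (@riesz R H).
Proof.
split=> [a x y|x|y]; first exact: rieszP.
  by apply: norm_eq_inner; rewrite dual_innerE.
have bphi : bounded_linear (inner ^~ y : H -> R[i]^o).
  split=> [a u v|]; first by rewrite innerDl innerZl.
  by exists `|y| => x; rewrite mulrC; exact: ler_inner.
exists (Dual (asboolT bphi)); apply: inner_injr => z.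
by rewrite -rieszE.
Qed.

Lemma riesz_dual_op (A B : H -> H) (lam : dual H) : bounded_linear A ->
  (forall x y, inner (A x) y = inner x (B y)) -> riesz (dual_op A lam) = B (riesz lam).
Proof.
move=> bA AB; apply: inner_injr => z.
by rewrite -rieszE dual_opE// rieszE AB.
Qed.

End DualOperators.

Section Extension.
Context {R : realType} {G : groupType} {G1 : {pred G}}.
Hypothesis hG1 : index_two G1.
Variable r : G.
Hypothesis hr : r \notin G1.

Lemma antiunitary_repI (H : hilbertType R) (U : G -> H -> H) :
  (exists x : H, x != 0) -> (forall g, g \in G1 -> unitary_op (U g)) ->
  (forall g, g \notin G1 -> antiunitary_op (U g)) ->
  (forall g h x, U (g * h)%g x = U g (U h x)) -> antiunitary_rep G1 U.
Proof.
move=> [x x0] uU aU UM; split=> [g|g h|].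
- by have [/uU|/aU] := boolP (g \in G1); [left|right].
- by apply/funext => y; exact: UM.
- apply/seteqP; split=> g /=; last exact: uU.
  have [//|/aU ag] := boolP (g \in G1).
  by move/(antiunitary_not_unitary x0 ag).
Qed.

Lemma equivalent_rep_sym (H K : hilbertType R) (S : {pred G}) (U : G -> H -> H)
  (V : G -> K -> K) : equivalent_rep S U V -> equivalent_rep S V U.
Proof.
move=> [T uT TU]; have [B [BT TB]] := inv_exists (or_introl uT).
exists B; first exact: unitary_inv uT BT TB.
move=> g gS; apply/funext => y /=; apply: (au_inj (or_introl uT)); rewrite TB.
by have /(congr1 (@^~ (B y))) /= -> := TU g gS; rewrite TB.
Qed.

(** [J] is the candidate for the operator of [r]. As the complement of [G1] is the coset [G1 r],
    compatibility with conjugation by [r] and with [r * r] covers all products. *)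
Lemma antiunitary_extension (H : hilbertType R) (U : G -> H -> H) (J : H -> H) :
  (exists x : H, x != 0) -> unitary_rep G1 U -> antiunitary_op J ->
  (forall g x, g \in G1 -> J (U g x) = U (r * g * r^-1)%g (J x)) ->
  (forall x, J (J x) = U (r * r)%g x) ->
  exists V, [/\ antiunitary_rep G1 V, extension_of G1 U V & forall x, V r x = J x].
Proof.
move=> H0 repU aJ JU JJ.
have rVG : (r^-1)%g \notin G1 by rewrite index2_VE.
have rr : (r * r)%g \in G1 by exact: index2_MN.
have hrV g : g \notin G1 -> (g * r^-1)%g \in G1 by move=> gG; exact: index2_MN.
have hrg g : g \in G1 -> (r * g * r^-1)%g \in G1.
  by move=> gG; rewrite index2_MN// index2_Mr.
pose V g x := if g \in G1 then U g x else U (g * r^-1)%g (J x).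
exists V; split; last first.
- by move=> x; rewrite /V (negPf hr) mulgV (urep1 hG1 repU).
- by move=> g gG; apply/funext => x; rewrite /V gG.
apply: antiunitary_repI => // [g gG|g gG|g h x].
- by rewrite (_ : V g = U g); [exact: (urep_op repU gG)|apply/funext => x; rewrite /V gG].
- rewrite (_ : V g = fun x => U (g * r^-1)%g (J x)).
    exact: unitary_antiunitary_comp (urep_op repU (hrV _ gG)) aJ.
  by apply/funext => x; rewrite /V (negPf gG).
rewrite /V; have [gG|gG] := boolP (g \in G1); have [hG|hG] := boolP (h \in G1).
- by rewrite index2_M// (urepM repU).
- by rewrite index2_Ml// (negPf hG) -mulgA (urepM repU _ gG (hrV _ hG)).
- rewrite index2_Mr// (negPf gG) JU// -(urepM repU) ?hrg ?hrV//.
  by rewrite !mulgA mulgVK.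
- rewrite index2_MN// JU ?hrV// JJ -!(urepM repU) ?hrg ?hrV//.
    by rewrite !mulgA !mulgVK.
  by rewrite index2_M// ?hrg ?hrV.
Qed.

(** [V] is restricted to the invariant range of the isometry [T] and pulled back along it. *)
Lemma extendable_transport (H K : hilbertType R) (U : G -> H -> H) (V : G -> K -> K)
  (T : H -> K) : (exists x : H, x != 0) ->
  antiunitary_rep G1 V -> linear T -> (forall x, `|T x| = `|x|) ->
  (forall g x, g \in G1 -> T (U g x) = V g (T x)) ->
  (forall g x, exists y, V g (T x) = T y) -> extendable G1 U.
Proof.
move=> H0 repV TL TN TU Tinv; have TE := linE TL.
have Tinj : injective T.
  move=> x y Txy; apply/eqP; rewrite -subr_eq0 -normr_eq0 -TN TE.1.1.1 TE.1.2 Txy subrr.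
  by rewrite normr0.
pose f g x := projT1 (cid (Tinv g x)).
have fE g x : T (f g x) = V g (T x) by rewrite /f; case: cid => y /=.
have fM g h x : f (g * h)%g x = f g (f h x).
  by apply: Tinj; rewrite !fE (arepM repV).
have fK g x : f g (f (g^-1)%g x) = x.
  by apply: Tinj; rewrite !fE (arepKV repV).
have fN g x : `|f g x| = `|x| by rewrite -TN fE (au_norm (arep_au repV g)).
exists f; split; last by move=> g gG; apply/funext => x; apply: Tinj; rewrite fE TU.
apply: antiunitary_repI => // g gG.
- have [L _ _] := arep_unitary repV gG; split=> // [a x y|y]; last by exists (f (g^-1)%g y).
  by apply: Tinj; rewrite TL !fE TL L.
- have [L _ _] := arep_antiunitary repV gG; split=> // [a x y|y]; last by exists (f (g^-1)%g y).
  by apply: Tinj; rewrite TL !fE TL L.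
Qed.

End Extension.

Section ExtendableCase.
Context {R : realType} {G : groupType} {G1 : {pred G}} {H : hilbertType R}.
Hypothesis hG1 : index_two G1.
Variables (r : G) (U V : G -> H -> H).
Hypotheses (hr : r \notin G1) (repU : unitary_rep G1 U) (irrU : irreducible_rep G1 U).
Hypotheses (repV : antiunitary_rep G1 V) (extV : extension_of G1 U V).

Lemma extension_irreducible : irreducible_rep predT V.
Proof.
have [H0 hE] := irrU; split=> // E Ec Ez El EV; apply: hE => // g gG x Ex.
by rewrite -extV//; exact: EV.
Qed.

(** Schur over [G1] gives a complex scalar; commuting with the antiunitary [V r] makes it real. *)
Lemma extension_commutant : real_presentation (rep_commutant predT V).
Proof.
have auU := unitary_rep_au hG1 repU; have [[x0 x00] _] := irrU.
move=> A dA; have mA : rep_commutant G1 U A.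
  apply/rep_commutantP; split=> [|g gG x]; first exact: comm_bounded dA.
  by rewrite -extV// (comm_U x dA).
have [z zA] := schur auU (urep_op repU) irrU mA.
exists (complex.Re z) => x; rewrite zA; congr (_ *: x).
apply/esym/RRe_real/CrealP.
have aE := antiE (let: And3 L _ _ := arep_antiunitary repV hr in L).
have := comm_U x0 dA (isT : r \in predT); rewrite !zA aE => /eqP.
rewrite eq_sym -subr_eq0 -scalerBl scaler_eq0 => /orP[|/eqP Vx].
  by rewrite subr_eq0 => /eqP.
by rewrite (au_eq0 (arep_au repV r) Vx) eqxx in x00.
Qed.

End ExtendableCase.

(** * The sum of [U] and its twisted dual *)

Section DualTwist.
Context {R : realType} {G : groupType} {G1 : {pred G}} {H : hilbertType R}.
Hypothesis hG1 : index_two G1.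
Variables (r : G) (U : G -> H -> H).
Hypotheses (hr : r \notin G1) (repU : unitary_rep G1 U) (irrU : irreducible_rep G1 U).

Local Notation Utau := (fun g => dual_rep U (r * g * r^-1)%g).
Local Notation V := (sum_rep U Utau).

Let auU := unitary_rep_au hG1 repU.

Let tauG g : g \in G1 -> (r * g * r^-1)%g \in G1.
Proof. by move=> gG; rewrite index2_MN// ?index2_Mr// index2_VE. Qed.

Lemma riesz_Utau g lam : g \in G1 ->
  riesz (Utau g lam) = U (r * g * r^-1)%g (riesz lam).
Proof.
move=> gG; rewrite /dual_rep; apply: riesz_dual_op.
  by apply: unitary_bounded; apply: (urep_op repU); rewrite index2_VE// tauG.
apply: unitary_adjoint; first by apply: (urep_op repU); rewrite index2_VE// tauG.
by move=> y; exact: urepVK (tauG gG).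
Qed.

Lemma Utau_unitary : unitary_rep G1 Utau.
Proof.
have aR := @riesz_antiunitary R H.
have [Phi [PhiK rieszK]] := inv_exists (or_intror aR).
split=> [g gG|g h gG hG]; last first.
  apply/funext => l /=; apply: (au_inj (or_intror aR)).
  rewrite !riesz_Utau ?index2_M// -(urepM repU) ?tauG//.
  by rewrite !mulgA mulgVK.
have -> : Utau g = fun l => Phi (U (r * g * r^-1)%g (riesz l)).
  by apply/funext => l; apply: (au_inj (or_intror aR)); rewrite rieszK riesz_Utau.
apply: (@antiunitary_comp _ _ _ _ Phi (fun l => U (r * g * r^-1)%g (riesz l))).
  exact: antiunitary_inv aR PhiK rieszK.
by apply: unitary_antiunitary_comp => //; apply: (urep_op repU); exact: tauG.
Qed.

Let auUtau := unitary_rep_au hG1 Utau_unitary.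

(** [riesz] intertwines [Utau] with the twist of [U] by conjugation with [r], so it carries
    commutants over, with scalars conjugated. *)
Lemma Utau_irreducible : irreducible_rep G1 Utau.
Proof.
have aR := @riesz_antiunitary R H; have RE := antiE (let: And3 L _ _ := aR in L).
have [Phi [PhiK rieszK]] := inv_exists (or_intror aR).
have aP := antiunitary_inv aR PhiK rieszK.
have PE := antiE (let: And3 L _ _ := aP in L).
have [[x0 x00] _] := irrU.
have Px0 : Phi x0 != 0.
  by apply: contra_neq x00 => /(au_eq0 (or_intror aP)).
apply: irreducible_of_commutant => //; first by exists (Phi x0).
move=> P dP _ PP; have bP := comm_bounded dP; have PL := linE bP.1.
have [|z zP] := @schur _ _ _ _ _ auU (urep_op repU) (fun x => riesz (P (Phi x))) irrU.
  apply/rep_commutantP; split=> [|g gG x].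
    have [M M0 PM] := bounded_linearP bP; split=> [a x y|].
      by rewrite PE.1.1.1 PE.1.1.2 !PL !RE conjCK.
    exists M => x; rewrite (au_norm (or_intror aR)); apply: le_trans (PM _) _.
    by rewrite (au_norm (or_intror aP)).
  (* Conjugation by [r] is onto [G1], so commuting with the twisted operators amounts to commuting
     with all [U g]. *)
  have rgr : (r^-1 * g * r)%g \in G1 by rewrite index2_MN// index2_Mr// index2_VE.
  have -> : g = (r * (r^-1 * g * r) * r^-1)%g by rewrite !mulgA mulgV mul1g mulgK.
  rewrite -(riesz_Utau _ rgr) -(comm_U _ dP)//; congr (riesz (P _)).
  by apply: (au_inj (or_intror aR)); rewrite rieszK (riesz_Utau _ rgr) rieszK.
have Pz l : P l = Num.conj z *: l.
  apply: (au_inj (or_intror aR)); rewrite RE conjCK.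
  by have := zP (riesz l); rewrite PhiK.
have : (Num.conj z * (Num.conj z - 1)) *: Phi x0 = 0.
  have := PP (Phi x0); rewrite !Pz scalerA => e.
  by rewrite mulrBr mulr1 scalerBl e subrr.
move/eqP; rewrite scaler_eq0 (negPf Px0) orbF mulf_eq0 subr_eq0.
by case/orP => /eqP z01; [left|right] => y; rewrite Pz z01 ?scale0r ?scale1r.
Qed.

Lemma V_unitary : unitary_rep G1 V.
Proof.
split=> [g gG|g h gG hG]; last first.
  apply/funext => x /=; rewrite /sum_rep /= (urepM repU)//.
  by congr pair; have [_ ->] := Utau_unitary.
have [L1 _ S1] := urep_op repU gG; have [L2 _ S2] := urep_op Utau_unitary gG.
split=> [a x y|x|[x y]].
- by congr pair; [exact: L1|exact: L2].
- apply: norm_eq_inner; rewrite !hsum_innerE.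
  congr (_ + _); first exact: (unitary_inner (urep_op repU gG)).
  exact: (unitary_inner (urep_op Utau_unitary gG)).
- by have [x' <-] := S1 x; have [y' <-] := S2 y; exists (x', y').
Qed.

Local Notation M := (rep_commutant G1 V).

Lemma hinl_Utau g x : g \in G1 -> hinl (dual H) (U g x) = V g (hinl _ x).
Proof.
move=> gG; congr pair => /=.
by have [/linE L _ _] := urep_op Utau_unitary gG; rewrite L.
Qed.

Lemma V_compress A : M A -> exists z : R[i], forall x, (A (hinl _ x)).1 = z *: x.
Proof.
move=> mA; apply: (@schur _ _ _ _ _ auU (urep_op repU)) => //.
apply/rep_commutantP; split=> [|g gG x].
  apply: bounded_linear_comp; first exact: hfst_bounded.
  by apply: bounded_linear_comp; [exact: comm_bounded mA|exact: hinl_bounded].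
by rewrite hinl_Utau// (comm_U _ mA).
Qed.

Lemma hinr_Utau g l : g \in G1 -> hinr H (Utau g l) = V g (hinr _ l).
Proof.
by move=> gG; congr pair => /=; have [/linE L _ _] := urep_op repU gG; rewrite L.
Qed.

(** The off-diagonal blocks are intertwiners between inequivalent irreducible representations. *)
Lemma V_diagonal A : ~ equivalent_rep G1 Utau U -> M A ->
  exists a b : R[i], forall v, A v = (a *: v.1, b *: v.2).
Proof.
move=> neq mA; have bA := comm_bounded mA; have AE := linE bA.1.
have [a aA] := V_compress mA.
have [|b bA2] := @schur _ _ _ _ _ auUtau (urep_op Utau_unitary) (fun l => (A (hinr _ l)).2)
    Utau_irreducible.
  apply/rep_commutantP; split=> [|g gG x].
    apply: bounded_linear_comp; first exact: hsnd_bounded.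
    by apply: bounded_linear_comp; [exact: bA|exact: hinr_bounded].
  by rewrite hinr_Utau// (comm_U _ mA).
have A12 l : (A (hinr _ l)).1 = 0.
  apply/eqP; apply: contrapT => /negP h; apply: neq.
  apply: (@schur_intertwiner _ _ _ _ _ _ _ auUtau auU (urep_op Utau_unitary) (urep_op repU)
    Utau_irreducible irrU (fun l => (A (hinr _ l)).1)).
  - apply: bounded_linear_comp; first exact: hfst_bounded.
    by apply: bounded_linear_comp; [exact: bA|exact: hinr_bounded].
  - by move=> g gG x; rewrite hinr_Utau// (comm_U _ mA).
  - by exists l.
have A21 x : (A (hinl _ x)).2 = 0.
  apply/eqP; apply: contrapT => /negP h; apply: neq; apply: equivalent_rep_sym.
  apply: (@schur_intertwiner _ _ _ _ _ _ _ auU auUtau (urep_op repU) (urep_op Utau_unitary)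
    irrU Utau_irreducible (fun x => (A (hinl _ x)).2)).
  - apply: bounded_linear_comp; first exact: hsnd_bounded.
    by apply: bounded_linear_comp; [exact: bA|exact: hinl_bounded].
  - by move=> g gG y; rewrite hinl_Utau// (comm_U _ mA).
  - by exists x.
exists a, b => v; rewrite [v in LHS]hsumE AE.
apply: injective_projections => /=.
  by rewrite aA A12 addr0.
by rewrite A21 bA2 add0r.
Qed.

Lemma V_extension : exists (W : G -> hsum H (dual H) -> hsum H (dual H)) (Phi : H -> dual H),
  [/\ antiunitary_rep G1 W, extension_of G1 V W, cancel Phi riesz, antiunitary_op Phi
    & forall v, W r v = (riesz v.2, Phi (U (r * r)%g v.1))].
Proof.
have aR := @riesz_antiunitary R H; have RE := antiE (let: And3 L _ _ := aR in L).
have [Phi [PhiK rieszK]] := inv_exists (or_intror aR).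
have aP := antiunitary_inv aR PhiK rieszK.
have PE := antiE (let: And3 L _ _ := aP in L).
have rr : (r * r)%g \in G1 by exact: index2_MN.
have [Lr Nr Sr] := urep_op repU rr.
have UtauP g x : g \in G1 -> Utau g (Phi x) = Phi (U (r * g * r^-1)%g x).
  by move=> gG; apply: (au_inj (or_intror aR)); rewrite riesz_Utau// !rieszK.
have [[x0 x00] _] := irrU.
(* With [riesz] as first component, the second is forced: the square of [J] has to be
   [V (r * r)]. *)
pose J (v : hsum H (dual H)) : hsum H (dual H) := (riesz v.2, Phi (U (r * r)%g v.1)).
have [|||g v gG|v|W [repW extW Wr]] := @antiunitary_extension R G G1 hG1 r hr _ V J.
- by exists (hinl _ x0); rewrite hinl_eq0.
- exact: V_unitary.
- split=> [a x y|x|[x y]].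
  + by congr pair; rewrite /= ?Lr ?RE ?PE.
  + apply: norm_eq_inner; rewrite !hsum_innerE addrC; congr (_ + _).
    exact: etrans (antiunitary_inner aP _ _) (unitary_inner (urep_op repU rr) _ _).
  + have [x' x'y] := Sr (riesz y); exists (x', Phi x).
    by rewrite /J /= rieszK x'y PhiK.
- rewrite /J /sum_rep /=; congr pair; first by rewrite riesz_Utau.
  rewrite UtauP ?tauG// -!(urepM repU) ?tauG// !mulgA !mulgVK//.
- by rewrite /J /sum_rep /= rieszK -[in RHS](PhiK v.2) UtauP// mulgA mulgK.
by exists W, Phi; split.
Qed.

Lemma V_irreducible_extension : ~ extendable G1 U -> exists W,
  [/\ antiunitary_rep G1 W, extension_of G1 V W & irreducible_rep predT W].
Proof.
move=> next; have [W [Phi [repW extW rieszK aP Wr]]] := V_extension.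
exists W; split=> //; have [[x0 x00] _] := irrU.
have RE := antiE (let: And3 L _ _ := @riesz_antiunitary R H in L).
have PE := antiE (let: And3 L _ _ := aP in L).
have PhiK l : Phi (riesz l) = l by apply: (au_inj (or_intror riesz_antiunitary)); rewrite rieszK.
apply: irreducible_of_commutant; first exact: (antiunitary_rep_au repW).
  by exists (hinl _ x0); rewrite hinl_eq0.
move=> P dP PPa PP; have bP := comm_bounded dP; have PL := linE bP.1.
have mP : M P.
  apply/rep_commutantP; split=> // g gG v.
  by rewrite -extW// (comm_U v dP).
have [a aP1] := V_compress mP.
have Pn1 x : inner (P (hinl _ x)) (hinl _ x) = a * inner x x.
  by rewrite hsum_innerE aP1 innerZl inner0r addr0.
have Pn x : inner (P (hinl _ x)) (P (hinl _ x)) = a * inner x x.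
  by rewrite -PPa PP Pn1.
have a0 : 0 <= a.
  by rewrite -(@pmulr_lge0 _ (inner x0 x0)) ?dnorm_gt0// -Pn dnorm_ge0.
have aC : Num.conj a = a by apply/CrealP; exact: ger0_real.
have rr : (r * r)%g \in G1 by exact: index2_MN.
have [/linE Lr _ Sr] := urep_op repU rr.
have Pr v : P (W r v) = W r (P v) by exact: (comm_U v dP).
(* [W r] maps the first summand onto the second, which transfers what is known about [P] on the
   first. *)
have hinrE l : exists x, U (r * r)%g x = riesz l /\ hinr H l = W r (hinl _ x).
  have [x xl] := Sr (riesz l); exists x; split=> //.
  by rewrite Wr /= xl PhiK RE.
have Pr2 l : (P (hinr _ l)).2 = a *: l.
  have [x [xl ->]] := hinrE l.
  by rewrite Pr Wr /= aP1 Lr xl PE aC PhiK.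
have Wl0 : W r 0 = 0 := au0 (arep_au repW r).
have [a00|an0] := eqVneq a 0.
  left => v; rewrite [v]hsumE PL.
  have Pl x : P (hinl _ x) = 0 by apply: inner_eq0; rewrite Pn a00 mul0r.
  by have [x [_ ->]] := hinrE v.2; rewrite Pr !Pl Wl0 addr0.
have [a1|an1] := eqVneq a 1.
  right => v; rewrite [v in LHS]hsumE PL [v in RHS]hsumE.
  have Pl x : P (hinl _ x) = hinl _ x.
    apply/eqP; rewrite -subr_eq0; apply/eqP/inner_eq0.
    rewrite !(innerE, innerrE) -!PPa PP !Pn1.
    by rewrite hsum_innerE inner0l a1; ring.
  by have [x [_ ->]] := hinrE v.2; rewrite Pr !Pl.
exfalso; apply: next.
(* [|P (x, 0)|^2 = a |x|^2], so division by [sqrtC a] yields an isometry. *)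
have s0 : sqrtC a != 0 by rewrite sqrtC_eq0.
have sC : Num.conj (sqrtC a)^-1 = (sqrtC a)^-1.
  by apply/CrealP; rewrite rpredV ger0_real// sqrtC_ge0.
have [HlL _] := @hinl_bounded R H (dual H).
apply: (@extendable_transport _ _ _ _ _ U W (fun x => (sqrtC a)^-1 *: P (hinl _ x))) => //.
- by exists x0.
- by move=> c x y; rewrite HlL bP.1; vec.
- move=> x; apply: norm_eq_inner; rewrite innerZl innerZr sC Pn !mulrA -invfM -expr2 sqrtCK.
  by rewrite mulVf ?mul1r.
- move=> g x gG; rewrite hinl_Utau// (comm_U _ mP)// extW//.
  by have [/linE L _ _] := urep_op V_unitary gG; rewrite L.
move=> g x; set e := W g _.
have Pe : P e = e.
  by rewrite /e (comm_U _ dP)// PL PP.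
(* Apply [P] to [P (0, l) = (z, a l)]. As [a] is not 1, the image of the first summand under [P] is
   already the whole range of [P], which [W] preserves. *)
have Phr l : (1 - a) *: P (hinr _ l) = P (hinl _ (P (hinr _ l)).1).
  have az : hinr H (a *: l) = a *: hinr H l by congr pair; rewrite /= scaler0.
  have h : P (hinl _ (P (hinr H l)).1) + a *: P (hinr _ l) = P (hinr _ l).
    by rewrite -[RHS]PP [P (hinr H l) in RHS]hsumE !PL Pr2 az PL.
  by rewrite scalerBl scale1r -{1}h addrK.
have a1 : 1 - a != 0 by rewrite subr_eq0 eq_sym.
exists (sqrtC a *: (e.1 + (1 - a)^-1 *: (P (hinr _ e.2)).1)).
have HE := linE HlL.
rewrite HE PL scalerA mulVf// scale1r HE PL HE PL -Phr scalerA mulVf// scale1r.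
by rewrite -PL -hsumE Pe.
Qed.

Section IrreducibleExtension.
Variable W : G -> hsum H (dual H) -> hsum H (dual H).
Hypotheses (repW : antiunitary_rep G1 W) (extW : extension_of G1 V W).
Hypothesis irrW : irreducible_rep predT W.

Let MW A : rep_commutant G1 V A <-> rep_commutant G1 W A.
Proof.
by split=> /rep_commutantP[bA AU]; apply/rep_commutantP; split=> // g gG v;
  have := AU g gG v; rewrite extW.
Qed.

Let p1 (v : hsum H (dual H)) : hsum H (dual H) := hinl _ v.1.

Let mp1 : M p1.
Proof.
apply/rep_commutantP; split=> [|g gG v]; last by rewrite /p1 -hinl_Utau.
by apply: bounded_linear_comp; [exact: hinl_bounded|exact: hfst_bounded].
Qed.

Let nonzero : (exists x : H, x != 0) /\ (exists l : dual H, l != 0).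
Proof. by have [? _] := irrU; have [? _] := Utau_irreducible. Qed.

Let not_real : ~ real_presentation (rep_commutant predT W).
Proof.
move=> hR; have [[x0 x00] [l0 l00]] := nonzero.
have [z zp] := real_commutant hG1 hr repW hR ((MW p1).1 mp1).
have : z *: hinl (dual H) x0 = hinl _ x0 by rewrite -zp.
have : z *: hinr H l0 = 0 by rewrite -zp.
move=> /eqP; rewrite scaler_eq0 hinr_eq0 (negPf l00) orbF => /eqP ->.
by rewrite scale0r => /esym/eqP; rewrite hinl_eq0 (negPf x00).
Qed.

(** The projection [p1] rules out a real commutant. The commutant of [G1] is diagonal, hence
    commutative, which rules out quaternions. *)
Lemma sum_extension_complex : ~ equivalent_rep G1 Utau U ->
  real_algebra_iso (Rcomplex R) (rep_commutant predT W).
Proof.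
move=> neq; have auW := antiunitary_rep_au repW; have [[x0 x00] _] := nonzero.
have [//|[I hI]|[I [J hIJ]]] := irreducible_presentation auW irrW.
  apply: complex_presentation_iso hI => //; exact: (arep_neq0 repW hr).
have [[dI dJ] [II JJ] JI _] := hIJ.
have [a [b IE]] := V_diagonal neq ((MW _).2 (commutant_sub dI)).
have [c [d JE]] := V_diagonal neq ((MW _).2 (commutant_sub dJ)).
have IJ v : I (J v) = J (I v).
  by rewrite !IE !JE /= !scalerA [a * c]mulrC [b * d]mulrC.
have h v : I (J v) = 0.
  apply: (@scalerI _ _ 2); first by rewrite pnatr_eq0.
  by rewrite scaler0 -[2]/(1 + 1) scalerDl scale1r {1}IJ JI addNr.
have : hinl (dual H) x0 = 0.
  apply: oppr_inj; rewrite oppr0 -II; have := h (- J (I (hinl _ x0))).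
  by rewrite (linE (comm_bounded dJ).1) JJ opprK.
by move/eqP; rewrite hinl_eq0 (negPf x00).
Qed.

(** An equivalence gives an off-diagonal operator [e12] that does not commute with [p1], whereas a
    complex presentation would make the commutant of [G1] commutative. *)
Lemma sum_extension_quaternion : equivalent_rep G1 Utau U ->
  real_algebra_iso (quat R) (rep_commutant predT W).
Proof.
move=> [T uT TU]; have auW := antiunitary_rep_au repW; have [_ [l0 l00]] := nonzero.
have [//|[I hI]|[I [J hIJ]]] := irreducible_presentation auW irrW; last first.
  apply: quaternion_presentation_iso hIJ => //; exact: (arep_neq0 repW hr).
pose e12 (v : hsum H (dual H)) : hsum H (dual H) := hinl _ (T v.2).
have me : M e12.
  apply/rep_commutantP; split=> [|g gG v].
    apply: bounded_linear_comp; first exact: hinl_bounded.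
    by apply: bounded_linear_comp; [exact: unitary_bounded|exact: hsnd_bounded].
  rewrite -[RHS]hinl_Utau// /e12; congr hinl.
  by have := TU g gG => /(congr1 (@^~ v.2)).
have := complex_commutant_comm hG1 hr repW hI ((MW _).1 mp1) ((MW _).1 me) (hinr _ l0).
rewrite /e12 /p1 /= (linE (unitary_bounded uT).1) => /(congr1 fst) /= T0.
by have := au_eq0 (or_introl uT) T0 => /eqP; rewrite (negPf l00).
Qed.

End IrreducibleExtension.

End DualTwist.

Theorem theorem2p11 (R : realType) (G : groupType) (G1 : {pred G})
    (hG1 : index_two G1) (r : G) (hr : r \notin G1) :
  let tau (g : G) := (r * g * r^-1)%g in
  (* (a) *)
  (forall (H1 H2 : hilbertType R) (U1 : G -> H1 -> H1) (U2 : G -> H2 -> H2),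
     antiunitary_rep G1 U1 -> antiunitary_rep G1 U2 ->
     equivalent_rep predT U1 U2 <-> equivalent_rep G1 U1 U2) /\
  (* (b) *)
  (forall (H : hilbertType R) (U : G -> H -> H),
     antiunitary_rep G1 U ->
     von_neumann_algebra (rep_commutant G1 U) /\
     is_complexification (rep_commutant predT U) (rep_commutant G1 U)) /\
  (* (c) *)
  (forall (H : hilbertType R) (U : G -> H -> H),
     antiunitary_rep G1 U ->
     (irreducible_rep predT U <->
        [\/ real_algebra_iso R^o (rep_commutant predT U),
            real_algebra_iso (Rcomplex R) (rep_commutant predT U)
          | real_algebra_iso (quat R) (rep_commutant predT U)]) /\
     (* (i) *)
     (real_algebra_iso R^o (rep_commutant predT U) ->
        complex_algebra_iso R[i]^o (rep_commutant G1 U) /\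
        irreducible_rep G1 U) /\
     (* (ii) *)
     (real_algebra_iso (Rcomplex R) (rep_commutant predT U) ->
        complex_algebra_iso (R[i]^o * R[i]^o)%type (rep_commutant G1 U) /\
        exists (K1 K2 : hilbertType R)
               (W1 : G -> K1 -> K1) (W2 : G -> K2 -> K2),
          [/\ unitary_rep G1 W1 /\ unitary_rep G1 W2,
              irreducible_rep G1 W1 /\ irreducible_rep G1 W2,
              ~ equivalent_rep G1 W1 W2,
              ~ extendable G1 W1 /\ ~ extendable G1 W2
            & equivalent_rep G1 U (sum_rep W1 W2)]) /\
     (* (iii) *)
     (real_algebra_iso (quat R) (rep_commutant predT U) ->
        complex_algebra_iso 'M[R[i]]_2 (rep_commutant G1 U) /\
        exists (K1 K2 : hilbertType R)
               (W1 : G -> K1 -> K1) (W2 : G -> K2 -> K2),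
          [/\ unitary_rep G1 W1 /\ unitary_rep G1 W2,
              irreducible_rep G1 W1 /\ irreducible_rep G1 W2,
              equivalent_rep G1 W1 W2,
              ~ extendable G1 W1 /\ ~ extendable G1 W2
            & equivalent_rep G1 U (sum_rep W1 W2)])) /\
  (* (d) *)
  (forall (H : hilbertType R) (U : G -> H -> H),
     unitary_rep G1 U -> irreducible_rep G1 U ->
     (* (i) *)
     (extendable G1 U /\
      forall Ubar : G -> H -> H,
        antiunitary_rep G1 Ubar -> extension_of G1 U Ubar ->
        irreducible_rep predT Ubar /\
        real_algebra_iso R^o (rep_commutant predT Ubar)) \/
     (* (ii) *)
     (~ extendable G1 U /\
      let Utau := fun g => dual_rep U (tau g) in
      let V := sum_rep U Utau in
      (exists Vbar, [/\ antiunitary_rep G1 Vbar, extension_of G1 V Vbar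
                      & irreducible_rep predT Vbar]) /\
      forall Vbar, antiunitary_rep G1 Vbar -> extension_of G1 V Vbar ->
        irreducible_rep predT Vbar ->
        (~ equivalent_rep G1 Utau U ->
           real_algebra_iso (Rcomplex R) (rep_commutant predT Vbar)) /\
        (equivalent_rep G1 Utau U ->
           real_algebra_iso (quat R) (rep_commutant predT Vbar)))).
Proof.
move=> tau; split; [|split; [|split]].
- move=> H1 H2 U1 U2 rep1 rep2; split; last exact: (equivalent_antiunitary hG1 hr rep1 rep2).
  by move=> [T uT TU]; exists T => // g _; exact: TU.
- move=> H U repU; split; last exact: commutant_complexification hr.
  exact: (commutant_von_neumann hG1 (antiunitary_rep_unitary repU)).
- move=> H U repU; have auU := antiunitary_rep_au repU.
  have irrP := irreducible_antiunitaryP hr repU.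
  split; [exact: irrP|split; [|split]] => iso.
  + exact: (real_presentation_scalar hG1 hr repU (real_iso_presentation iso)).
  (* Irreducibility is recovered first, because [skew_unit] rests on Schur's lemma. *)
  + have irrU := irrP.2 (Or32 _ _ iso).
    have [I hI] := complex_iso_presentation iso; split.
      exact: (complex_presentation_iso_prod hG1 hr repU hI).
    have [dI II _] := hI.
    exact: (complex_decomposition hG1 hr repU dI II (skew_unit auU irrU dI II) hI).
  + have irrU := irrP.2 (Or33 _ _ iso).
    have [I [J hIJ]] := quaternion_iso_presentation iso; split.
      exact: (quaternion_presentation_iso_mx hG1 hr repU hIJ).
    have [[dI dJ] [II JJ] _ _] := hIJ.
    exact: (quaternion_decomposition hG1 hr repU dI II (skew_unit auU irrU dI II)
      (skew_unit auU irrU dJ JJ) hIJ).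
move=> H U repU irrU; have [ext|next] := pselect (extendable G1 U); [left|right].
- split=> // V repV extV; split; first exact: (extension_irreducible irrU extV).
  apply: real_presentation_iso; first exact: (antiunitary_rep_au repV).
    exact: (arep_neq0 repV hr).
  exact: (extension_commutant hG1 hr repU irrU repV extV).
split=> // Utau V; split.
  exact: (V_irreducible_extension hG1 hr repU irrU next).
move=> W repW extW irrW; split.
  exact: (sum_extension_complex hG1 hr repU irrU repW extW irrW).
exact: (sum_extension_quaternion hG1 hr repU irrU repW extW irrW).
Qed.
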